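(* Let $N>2$ be an even integer and let $X$ be the pseudo-process associated with $\partial u/\partial t=\kappa_N\,\partial^N u/\partial x^N$, with maximum $M(t)=\max_{0\le s\le t}X(s)$ and minimum $m(t)=\min_{0\le s\le t}X(s)$. For every $x\in\mathbb{R}$, every $\lambda\in\mathbb{C}$ with $\Re(\lambda)>0$, every $\mu\in\mathbb{R}$ and every $\nu>0$, $$\mathbb{E}_x\left[\int_0^{+\infty} e^{-\lambda t+i\mu X(t)-\nu M(t)}\,dt\right]=\frac{e^{(i\mu-\nu)x}}{\prod_{j\in J}\big(\sqrt[N]{\lambda}-(i\mu-\nu)\theta_j\big)\prod_{k\in K}\big(\sqrt[N]{\lambda}-i\mu\theta_k\big)},$$ $$\mathbb{E}_x\left[\int_0^{+\infty} e^{-\lambda t+i\mu X(t)+\nu m(t)}\,dt\right]=\frac{e^{(i\mu+\nu)x}}{\prod_{j\in J}\big(\sqrt[N]{\lambda}-i\mu\theta_j\big)\prod_{k\in K}\big(\sqrt[N]{\lambda}-(i\mu+\nu)\theta_k\big)}.$$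
   Context: Notation. $\kappa_N=(-1)^{1+N/2}$; $\theta_l=e^{i(2l+N/2+1)\pi/N}$, $0\le l\le N-1$, are the $N$th roots of $\kappa_N$; $J=\{l:\Re\theta_l>0\}$, $K=\{l:\Re\theta_l<0\}$; $\sqrt[N]{\lambda}$ is the principal root. Kernel. $p(t;\xi)=\frac1{2\pi}\int_{-\infty}^{+\infty}e^{-i\xi u+\kappa_N t(-iu)^N}\,du$ ($t>0$) is the fundamental solution of $\partial u/\partial t=\kappa_N\partial^N u/\partial x^N$; $\int p(t;\xi)\,d\xi=1$ and $\rho=\int|p(t;\xi)|\,d\xi<\infty$ does not depend on $t$. Pseudo-process. $X=(X(t))_{t\ge0}$ is governed by signed measures $\mathbb{P}_x$ with expectations $\mathbb{E}_x$: for $0=t_0<t_1<\dots<t_k$, $x_0=x$, and bounded Borel $F$, $\mathbb{E}_x[F(X(t_1),\dots,X(t_k))]=\int_{\mathbb{R}^k}F(x_1,\dots,x_k)\prod_{i=1}^k p(t_i-t_{i-1};x_{i-1}-x_i)\,dx_1\cdots dx_k$, and $X(0)=x$ under $\mathbb{P}_x$. Expectations of functionals of the whole path. For $n\in\mathbb{N}$ put $t_{n,k}=k/2^n$, $X_{n,k}=X(t_{n,k})$, $M_{n,k}=\max_{0\le j\le k}X_{n,j}$, $m_{n,k}=\min_{0\le j\le k}X_{n,j}$, and let $X_n(t)=\sum_{k\ge 0} X_{n,k}\mathbf 1_{[t_{n,k},t_{n,k+1})}(t)$ be the step-process. The expectation of a functional of $X$ is by definition the limit as $n\to\infty$ of the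 expectations of the same functional of $X_n$; the latter is a series of bounded functions of finitely many $X_{n,j}$ and its expectation is the sum of the expectations of the terms (when this is absolutely convergent, extended in $\lambda$ by analytic continuation from large $\Re(\lambda)$ to $\Re(\lambda)>0$). Concretely, $$\mathbb{E}_x\Big[\int_0^{\infty}e^{-\lambda t+i\mu X(t)-\nu M(t)}dt\Big]=\lim_{n\to\infty}\frac{1-e^{-\lambda/2^n}}{\lambda}\sum_{k=0}^\infty e^{-\lambda t_{n,k}}\,\mathbb{E}_x\big[e^{i\mu X_{n,k}-\nu M_{n,k}}\big],$$ and similarly with $-\nu M$ replaced by $+\nu m$. *)

(* Defs.v *)
From HB Require Import structures.
From mathcomp Require Import all_boot all_order all_algebra.
From mathcomp Require Import complex.
From mathcomp Require Import all_classical all_reals all_analysis.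

Set Implicit Arguments.
Unset Strict Implicit.
Unset Printing Implicit Defensive.

Import Order.TTheory GRing.Theory Num.Theory.
Import numFieldNormedType.Exports.

Import Normc.

Local Open Scope classical_set_scope.
Local Open Scope complex_scope.
Local Open Scope ring_scope.

Section tuple_lebesgue.
Context {R : realType}.
Local Notation T := (measurableTypeR R).

Definition cons_tuple k (z : T * k.-tuple T) : k.+1.-tuple T :=
  [tuple of z.1 :: z.2].

Definition uncons_tuple k (w : k.+1.-tuple T) : T * k.-tuple T :=
  (thead w, [tuple of behead w]).

Lemma measurable_cons_tuple k :
  measurable_fun [set: T * k.-tuple T] (@cons_tuple k).
Proof.
by apply: measurable_cons; [exact: measurable_fst|exact: measurable_snd].
Qed.

Lemma measurable_uncons_tuple k :
  measurable_fun [set: k.+1.-tuple T] (@uncons_tuple k).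
Proof.
apply/measurable_fun_pairP; split => /=.
  exact: measurable_tnth.
exact: measurable_behead.
Qed.

Lemma uncons_tupleK k : cancel (@uncons_tuple k) (@cons_tuple k).
Proof. by move=> w; apply/val_inj; rewrite /= [in RHS](tuple_eta w). Qed.

Lemma cons_tupleK k : cancel (@cons_tuple k) (@uncons_tuple k).
Proof.
by move=> [a w]; congr pair; exact/val_inj.
Qed.

Section cons_measure.
Context k (mu : {sigma_finite_measure set (k.-tuple T) -> \bar R}).

Definition cons_measure : set (k.+1.-tuple T) -> \bar R :=
  pushforward (@lebesgue_measure R \x mu)%E (@cons_tuple k).

Let cons_measure0 : cons_measure set0 = 0%E.
Proof. by rewrite /cons_measure /pushforward preimage_set0 measure0. Qed.

Let cons_measure_ge0 A : (0 <= cons_measure A)%E.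
Proof. by rewrite /cons_measure /pushforward measure_ge0. Qed.

Let cons_measure_sigma_additive : semi_sigma_additive cons_measure.
Proof.
move=> F mF tF mUF; rewrite /cons_measure /pushforward preimage_bigcup.
apply: measure_semi_sigma_additive.
- by move=> n; rewrite -[X in measurable X]setTI; exact: measurable_cons_tuple.
- apply/trivIsetP => /= i j _ _ ij; rewrite -preimage_setI.
  by move/trivIsetP : tF => /(_ _ _ _ _ ij) ->//; rewrite preimage_set0.
- by rewrite -preimage_bigcup -[X in measurable X]setTI;
    exact: measurable_cons_tuple.
Qed.

HB.instance Definition _ := isMeasure.Build _ _ _ cons_measure
  cons_measure0 cons_measure_ge0 cons_measure_sigma_additive.

Let cons_measure_sigma_finite : sigma_finite setT cons_measure.
Proof.
have /sigma_finiteP[F [TF ndF Foo]] := sigma_finiteT (@lebesgue_measure R).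
have /sigma_finiteP[G [TG ndG Goo]] := sigma_finiteT mu.
exists (fun n => @uncons_tuple k @^-1` (F n `*` G n)).
  apply/seteqP; split=> // w _.
  have [i _ Fiw] : (\bigcup_i F i) (thead w) by rewrite -TF.
  have [j _ Gjw] : (\bigcup_i G i) [tuple of behead w] by rewrite -TG.
  exists (maxn i j) => //; split=> /=.
  - by move: Fiw; exact/subsetPset/ndF/leq_maxl.
  - by move: Gjw; exact/subsetPset/ndG/leq_maxr.
move=> n; have [mF Fn] := Foo n; have [mG Gn] := Goo n; split.
  rewrite -[X in measurable X]setTI; apply: measurable_uncons_tuple => //.
  exact: measurableX.
rewrite /cons_measure /pushforward.
rewrite -comp_preimage (_ : _ \o _ = id) ?preimage_id; last first.
  by apply/funext => z; exact: cons_tupleK.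
by rewrite product_measure1E// lte_mul_pinfty// ge0_fin_numE.
Qed.

HB.instance Definition _ := Measure_isSigmaFinite.Build _ _ _ cons_measure
  cons_measure_sigma_finite.

End cons_measure.

(* Lebesgue measure on R^k, transported from the iterated product R * R^(k-1);
   the library has the sigma-algebra on k.-tuple T but no product measure. *)
Fixpoint lebesgue_tuple k : {sigma_finite_measure set (k.-tuple T) -> \bar R} :=
  match k with
  | 0%N => \d_([tuple] : 0.-tuple T)
  | k'.+1 => cons_measure (lebesgue_tuple k')
  end.

End tuple_lebesgue.

Section pseudo_process.
Context {R : realType}.
Local Notation T := (measurableTypeR R).
Local Notation C := R[i].
Local Notation Re := (@complex.Re R).
Local Notation Im := (@complex.Im R).

Definition cexp (z : C) : C := (expR (Re z))%:C * (cos (Im z) +i* sin (Im z)).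

(* Principal argument, with values in ]-pi, pi]. *)
Definition carg (z : C) : R :=
  let a := acos (Re z / normc z) in if 0 <= Im z then a else - a.

(* Principal N-th root of z; it is not N.-root, whose cut is the positive half-line. *)
Definition croot (N : nat) (z : C) : C :=
  (normc z `^ N%:R^-1)%:C * cexp ('i%C * (carg z / N%:R)%:C).

Definition cintegral d (S : measurableType d) (mu : {measure set S -> \bar R})
    (f : S -> C) : C :=
  (\int[mu]_s Re (f s)) +i* (\int[mu]_s Im (f s)).

Definition kappa (N : nat) : C := (-1) ^+ (1 + N./2).

Definition theta (N l : nat) : C :=
  cexp ('i%C * ((2 * l + N./2 + 1)%:R * pi / N%:R)%:C).

Definition idxJ (N : nat) : {set 'I_N} := [set l : 'I_N | 0 < Re (theta N l)]%SET.

Definition idxK (N : nat) : {set 'I_N} := [set l : 'I_N | Re (theta N l) < 0]%SET.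

Definition kernel (N : nat) (t xi : R) : C :=
  ((2 * pi)^-1)%:C *
  cintegral (@lebesgue_measure R) (fun u : R =>
    cexp (- 'i%C * (xi * u)%:C + kappa N * t%:C * (- 'i%C * u%:C) ^+ N)).

(* Expectation of F (X t_1, ..., X t_k) under P_x, for ts = (t_1, ..., t_k);
   the sequences 0 :: ts and x :: xs supply t_0 = 0 and x_0 = x. *)
Definition Efd (N : nat) (x : R) k (ts : k.-tuple R)
    (F : k.-tuple R -> C) : C :=
  cintegral (lebesgue_tuple k) (fun xs : k.-tuple T =>
    F xs * \prod_(i < k) kernel N (tnth ts i - nth 0 (0 :: ts) i)
                                  (nth 0 (x :: xs) i - tnth xs i)).

(* Expectation of phi (X_{n,k}, M_{n,k}, m_{n,k}) under P_x. *)
Definition Estep (N : nat) (x : R) (phi : R -> R -> R -> C) (n k : nat) : C :=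
  Efd N x [tuple (i.+1)%:R / 2 ^+ n | i < k] (fun xs =>
    phi (last x xs) (\big[Num.max/x]_(y <- xs) y)
                    (\big[Num.min/x]_(y <- xs) y)).

(* k-th term of the expectation of the integral over t in [0, +oo[ of
   exp (- lambda t) phi (X_n t, M_n t, m_n t), X_n being the step-process. *)
Definition step_term (N : nat) (x : R) (phi : R -> R -> R -> C) (n : nat)
    (lambda : C) (k : nat) : C :=
  (1 - cexp (- lambda / 2 ^+ n)) / lambda *
  (cexp (- lambda * (k%:R / 2 ^+ n)) * Estep N x phi n k).

(* The expectation under P_x of the integral over t in [0, +oo[ of
   exp (- lambda t) phi (X t, M t, m t) exists and equals v: it is the limit
   of the expectations G n lambda for the step-processes, where G n is the
   analytic continuation to the right half-plane of the sum of the series,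
   which converges absolutely for large Re lambda only. *)
Definition expectation_laplace (N : nat) (x : R) (phi : R -> R -> R -> C)
    (lambda v : C) : Prop :=
  exists G : nat -> C^o -> C^o,
    [/\ forall n z, 0 < Re z -> derivable (G n) z 1,
        forall n, exists L : R, forall z : C, L < Re z ->
          cvgn (series (fun k => normc (step_term N x phi n z k))) /\
          series (step_term N x phi n z : (C^o)^nat) @ \oo --> G n z &
        G n lambda @[n --> \oo] --> (v : C^o)].

End pseudo_process.

Arguments idxJ : clear implicits.
Arguments idxK : clear implicits.

(* Main.v *)
(* Under the weight exp (i mu X), the positions of the step-process at the
   times k h form a walk whose step densities kernel N (j h) are a convolution
   semigroup.  Spitzer's identity, which only uses that y |-> max (y, 0) induces
   a Rota-Baxter operator and so holds for signed measures, says that the means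
   c_k of exp (i mu X_k - nu M_k) satisfy k c_k = sum_(j = 1)^k psi (j h) c_(k-j),
   where psi t is the mean of exp (i mu X(t) - nu max (X(t), 0)).  Hence
   sum_k c_k w^k = exp (sum_j psi (j h) w^j / j), and with w = exp (- lambda h)
   the expectation for the step-process is
     1/lambda exp (sum_j (psi (j h) - 1) / j exp (- lambda j h)),
   which continues analytically to Re lambda > 0.  As h tends to 0 the exponent
   is a Riemann sum for E = \int_0^oo (psi t - 1) / t exp (- lambda t) dt, since
   |psi t - 1| = O(t^(1/N)).
   The Laplace transform of psi follows from that of the kernel, which is found
   by Fourier inversion from the partial fractions of 1 / (lambda + u^N); it
   gives dE/dlambda, and along the ray lambda s^N the product of exp E with the
   normalised denominator of the statement is constant and tends to 1.
   The minimum is reduced to the maximum by the reflection X |-> - X. *)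

(* The measures are signed, so the means c_k are only known to satisfy |c_k| <= A^k with a constant
   A >= 1, and the series in k can be summed directly only for large Re lambda. By contrast psi (j
   h) involves a single kernel, and self-similarity bounds it uniformly in j and h; hence the
   exponent converges for every Re lambda > 0, and its closed form is the continuation. The term - 1
   in psi - 1 comes from the prefactor 1 - w, written as the exponential of - sum_j w^j / j; it
   removes the singularity of 1/t at 0. No complex logarithm occurs: exponentials of sums are
   compared with products through ordinary derivatives along real segments. The ray is parametrised
   by lambda s^N because a root of lambda s^N is then s times a root of lambda, so each factor of
   the denominator is affine in s and no root has to be differentiated. Complex differentiability is
   carried by an explicit quadratic remainder, which passes through series, integrals and [cexp]. *)
Require Import Defs.
From mathcomp Require Import all_boot all_order all_algebra.
From mathcomp Require Import complex.
From mathcomp Require Import all_classical all_reals all_analysis.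
From mathcomp Require Import measurable_realfun ring lra.
Import Order.TTheory GRing.Theory Num.Theory.
Import numFieldNormedType.Exports.
Import Normc.
Local Open Scope classical_set_scope.
Local Open Scope complex_scope.
Local Open Scope ring_scope.
Set Implicit Arguments.
Unset Strict Implicit.
Unset Printing Implicit Defensive.

(** * Complex-valued functions and integrals *)

Section complex_numbers.
Context {R : realType}.
Local Notation C := R[i].
Local Notation Re := (@complex.Re R).
Local Notation Im := (@complex.Im R).
Implicit Types (z w : C) (r : R).

Lemma cReD z w : Re (z + w) = Re z + Re w. Proof. by case: z w => [a b] [c d]. Qed.
Lemma cImD z w : Im (z + w) = Im z + Im w. Proof. by case: z w => [a b] [c d]. Qed.
Lemma cReN z : Re (- z) = - Re z. Proof. by case: z. Qed.
Lemma cImN z : Im (- z) = - Im z. Proof. by case: z. Qed.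
Lemma cReB z w : Re (z - w) = Re z - Re w. Proof. by rewrite cReD cReN. Qed.
Lemma cImB z w : Im (z - w) = Im z - Im w. Proof. by rewrite cImD cImN. Qed.
Lemma cReM z w : Re (z * w) = Re z * Re w - Im z * Im w.
Proof. by case: z w => [a b] [c d]. Qed.
Lemma cImM z w : Im (z * w) = Re z * Im w + Im z * Re w.
Proof. by case: z w => [a b] [c d]. Qed.
Lemma cRe_real r : Re r%:C = r. Proof. by []. Qed.
Lemma cIm_real r : Im r%:C = 0. Proof. by []. Qed.
Lemma cRe_rM r z : Re (r%:C * z) = r * Re z. Proof. by rewrite cReM /= mul0r subr0. Qed.
Lemma cIm_rM r z : Im (r%:C * z) = r * Im z. Proof. by rewrite cImM /= mul0r addr0. Qed.
Lemma cRe_iM z : Re ('i%C * z) = - Im z. Proof. by rewrite cReM /= mul0r mul1r sub0r. Qed.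
Lemma cIm_iM z : Im ('i%C * z) = Re z. Proof. by rewrite cImM /= mul0r mul1r add0r. Qed.
Definition ReImE :=
  (cReD, cImD, cReN, cImN, cRe_iM, cIm_iM, cReM, cImM, cRe_real, cIm_real).

Lemma complexP z w : Re z = Re w -> Im z = Im w -> z = w.
Proof. by case: z w => [a b] [c d] /= -> ->. Qed.

Lemma RealD (r s : R) : (r + s)%:C = r%:C + s%:C :> C. Proof. by apply: complexP => /=; rewrite ?addr0. Qed.
Lemma RealN r : (- r)%:C = - r%:C :> C. Proof. by apply: complexP => /=; rewrite ?oppr0. Qed.
Lemma RealB (r s : R) : (r - s)%:C = r%:C - s%:C :> C. Proof. by rewrite RealD RealN. Qed.
Lemma RealM (r s : R) : (r * s)%:C = r%:C * s%:C :> C.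
Proof. by apply: complexP; rewrite !ReImE /= ?mul0r ?mulr0 ?subr0 ?addr0. Qed.
Lemma Real1 : 1%:C = 1 :> C. Proof. by []. Qed.
Lemma Real0 : 0%:C = 0 :> C. Proof. by []. Qed.
Lemma RealX r n : (r ^+ n)%:C = r%:C ^+ n :> C.
Proof. by elim: n => [//|n IH]; rewrite !exprS RealM IH. Qed.
Lemma Real_nat n : n%:R%:C = n%:R :> C.
Proof. by elim: n => [//|n IH]; rewrite -!natr1 RealD IH. Qed.
Lemma Real_eq0 r : (r%:C == 0 :> C) = (r == 0).
Proof. by rewrite eq_complex /= eqxx andbT. Qed.
Lemma RealV r : (r^-1)%:C = (r%:C)^-1 :> C.
Proof.
have [->|r0] := eqVneq r 0; first by rewrite Real0 !invr0.
have rC : r%:C != 0 :> C by rewrite Real_eq0.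
by apply: (mulfI rC); rewrite -RealM !mulfV.
Qed.
Definition RealE := (RealD, RealN, RealM, RealX, Real_nat, RealV).

Lemma mulii : 'i%C * 'i%C = -1 :> C. Proof. by rewrite -expr2 sqr_i. Qed.

Lemma normc_ge0 z : 0 <= normc z. Proof. by case: z => a b; exact: sqrtr_ge0. Qed.

Lemma normr_complex z : `|z| = (normc z)%:C. Proof. by []. Qed.

Lemma normc_real r : normc r%:C = `|r|.
Proof. by rewrite /= expr0n /= addr0 sqrtr_sqr. Qed.

Lemma normc_i : normc ('i%C : C) = 1.
Proof. by rewrite /= expr0n /= add0r expr1n sqrtr1. Qed.

Lemma normcB z w : normc (z - w) <= normc z + normc w.
Proof. by have := le_normcD z (- w); rewrite normcN. Qed.

Lemma normcBC z w : normc (z - w) = normc (w - z).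
Proof. by rewrite -normcN opprB. Qed.

Lemma normcX z n : normc (z ^+ n) = normc z ^+ n.
Proof. by elim: n => [|n IH]; rewrite ?expr0 ?normc1// !exprS normcM IH. Qed.

Lemma Re_le_normc z : `|Re z| <= normc z.
Proof.
by case: z => a b /=; rewrite -sqrtr_sqr ler_wsqrtr// lerDl sqr_ge0.
Qed.

Lemma Im_le_normc z : `|Im z| <= normc z.
Proof.
by case: z => a b /=; rewrite -sqrtr_sqr ler_wsqrtr// lerDr sqr_ge0.
Qed.

Lemma normc_le_ReIm z : normc z <= `|Re z| + `|Im z|.
Proof.
case: z => a b /=; rewrite -[leRHS]ger0_norm ?addr_ge0// -sqrtr_sqr ler_wsqrtr//.
rewrite sqrrD !real_normK ?num_real// addrAC lerDl mulrn_wge0// mulr_ge0//.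
Qed.

Lemma normc_eq0 z : (normc z == 0) = (z == 0).
Proof. by apply/eqP/eqP => [/eq0_normc//|->]; rewrite normc0. Qed.

Lemma normc_gt0 z : (0 < normc z) = (z != 0).
Proof. by rewrite lt_neqAle normc_ge0 andbT eq_sym normc_eq0. Qed.

Lemma normc_sum (I : Type) (s : seq I) (P : pred I) (F : I -> C) :
  normc (\sum_(i <- s | P i) F i) <= \sum_(i <- s | P i) normc (F i).
Proof.
elim/big_rec2: _ => [|i x y _ h]; first by rewrite normc0.
by rewrite (le_trans (le_normcD _ _))// lerD2l.
Qed.

Lemma cexpD z w : cexp (z + w) = cexp z * cexp w.
Proof.
apply: complexP; rewrite /cexp !ReImE /= expRD cosD sinD; ring.
Qed.

Lemma cexp0 : cexp 0 = 1 :> C.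
Proof. by apply: complexP; rewrite /cexp !ReImE /= expR0 cos0 sin0; ring. Qed.

Lemma cexp_real r : cexp r%:C = (expR r)%:C.
Proof. by apply: complexP; rewrite /cexp !ReImE /= cos0 sin0; ring. Qed.

Lemma cexp_ir r : cexp ('i%C * r%:C) = cos r +i* sin r.
Proof.
by apply: complexP; rewrite /cexp !ReImE /= oppr0 expR0 !mul1r ?mul0r ?subr0 ?addr0.
Qed.

Lemma Re_cexp z : Re (cexp z) = expR (Re z) * cos (Im z).
Proof. by rewrite /cexp !ReImE /=; ring. Qed.

Lemma Im_cexp z : Im (cexp z) = expR (Re z) * sin (Im z).
Proof. by rewrite /cexp !ReImE /=; ring. Qed.

Lemma normc_cexp z : normc (cexp z) = expR (Re z).
Proof.
rewrite /cexp normcM normc_real ger0_norm ?expR_ge0//=.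
by rewrite cos2Dsin2 sqrtr1 mulr1.
Qed.

Lemma cexpNM z : cexp (- z) * cexp z = 1.
Proof. by rewrite -cexpD addNr cexp0. Qed.

Lemma cexpMn z n : cexp (n%:R * z) = cexp z ^+ n.
Proof. by elim: n => [|n IH]; rewrite ?mul0r ?cexp0 ?expr0// -natr1 mulrDl mul1r cexpD IH exprSr. Qed.

End complex_numbers.

Section complex_integral.
Context d (T : measurableType d) {R : realType} (mu : {measure set T -> \bar R}).
Local Notation C := R[i].
Local Notation Re := (@complex.Re R).
Local Notation Im := (@complex.Im R).
Implicit Types (f g : T -> C) (h : T -> R).

Definition rint h := mu.-integrable setT (EFin \o h).

Definition cmeas f :=
  measurable_fun setT (fun x => Re (f x)) /\ measurable_fun setT (fun x => Im (f x)).

Definition cint f := rint (fun x => Re (f x)) /\ rint (fun x => Im (f x)).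

Lemma measurable_continuous_comp (phi : R -> R) h : continuous phi ->
  measurable_fun setT h -> measurable_fun setT (fun x => phi (h x)).
Proof. by move=> /continuous_measurable_fun mphi mh; exact: (measurableT_comp mphi mh). Qed.

Lemma rint_meas h : rint h -> measurable_fun setT h.
Proof. by move=> /measurable_int/measurable_EFinP. Qed.

Lemma rint_le h k : measurable_fun setT h -> rint k ->
  (forall x, `|h x| <= k x) -> rint h.
Proof.
move=> mh ik hk; apply: (le_integrable _ _ _ ik) => //; first exact/measurable_EFinP.
by move=> x _ /=; rewrite lee_fin (le_trans (hk x))// ler_norm.
Qed.

Lemma rintD h k : rint h -> rint k -> rint (fun x => h x + k x).
Proof. by move=> ih ik; exact: (integrableD _ ih ik). Qed.

Lemma rintB h k : rint h -> rint k -> rint (fun x => h x - k x).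
Proof. by move=> ih ik; exact: (integrableB _ ih ik). Qed.

Lemma rintZl (r : R) h : rint h -> rint (fun x => r * h x).
Proof. by move=> ih; exact: (integrableZl _ r ih). Qed.

Lemma rint0 : rint (fun=> 0).
Proof. exact: integrable0. Qed.

Lemma cint_cmeas f : cint f -> cmeas f.
Proof. by move=> [/rint_meas ? /rint_meas ?]. Qed.

Lemma cint_le f h : cmeas f -> rint h -> (forall x, normc (f x) <= h x) -> cint f.
Proof.
move=> [mr mi] ih fh; split; apply: (rint_le _ ih) => // x.
- exact: le_trans (Re_le_normc _) (fh x).
- exact: le_trans (Im_le_normc _) (fh x).
Qed.

Lemma cmeas_normc f : cmeas f -> measurable_fun setT (fun x => normc (f x)).
Proof.
move=> [mr mi].
rewrite (_ : (fun x => _) = fun x => Num.sqrt (Re (f x) ^+ 2 + Im (f x) ^+ 2)); last first.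
  by apply/funext => x; case: (f x).
apply: (measurable_continuous_comp (@sqrt_continuous R)).
by apply: measurable_funD; exact: measurable_funX.
Qed.

Lemma cint_normc f : cint f -> rint (fun x => normc (f x)).
Proof.
move=> cf; have [ir ii] := cf.
have i2 := rintD (integrable_norm ir) (integrable_norm ii).
apply: (rint_le (cmeas_normc (cint_cmeas cf)) i2) => x.
by rewrite ger0_norm ?normc_ge0// normc_le_ReIm.
Qed.

Lemma eq_cintegral f g : f =1 g -> cintegral mu f = cintegral mu g.
Proof. by move=> /funext ->. Qed.

Lemma cintD f g : cint f -> cint g -> cint (fun x => f x + g x).
Proof.
move=> [fr fi] [gr gi]; split.
- by under eq_fun do rewrite cReD; exact: rintD.
- by under eq_fun do rewrite cImD; exact: rintD.
Qed.

Lemma cintZl (c : C) f : cint f -> cint (fun x => c * f x).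
Proof.
move=> [fr fi]; split.
- by under eq_fun do rewrite cReM; apply: rintB; exact: rintZl.
- by under eq_fun do rewrite cImM; apply: rintD; exact: rintZl.
Qed.

Lemma cintN f : cint f -> cint (fun x => - f x).
Proof. by under eq_fun do rewrite -mulN1r; exact: cintZl. Qed.

Lemma cintB f g : cint f -> cint g -> cint (fun x => f x - g x).
Proof. by move=> cf cg; apply: cintD => //; exact: cintN. Qed.

Lemma cintegral0 : cintegral mu (fun=> 0) = 0.
Proof. by apply: complexP; rewrite /= /Rintegral integral0. Qed.

Lemma cintegralD f g : cint f -> cint g ->
  cintegral mu (fun x => f x + g x) = cintegral mu f + cintegral mu g.
Proof.
move=> [fr fi] [gr gi]; apply: complexP; rewrite /= -RintegralD//.
- by apply: eq_Rintegral => x _; rewrite cReD.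
- by apply: eq_Rintegral => x _; rewrite cImD.
Qed.

Lemma cintegralZl (c : C) f : cint f ->
  cintegral mu (fun x => c * f x) = c * cintegral mu f.
Proof.
move=> [fr fi]; apply: complexP; rewrite !ReImE /=.
- rewrite -!RintegralZl// -RintegralB//; try exact: rintZl.
  by apply: eq_Rintegral => x _; rewrite cReM.
- rewrite -!RintegralZl// -RintegralD//; try exact: rintZl.
  by apply: eq_Rintegral => x _; rewrite cImM.
Qed.

Lemma cintegralZr (c : C) f : cint f ->
  cintegral mu (fun x => f x * c) = cintegral mu f * c.
Proof. by move=> cf; rewrite mulrC -cintegralZl//; apply: eq_cintegral => x; rewrite mulrC. Qed.

Lemma cintegralN f : cint f -> cintegral mu (fun x => - f x) = - cintegral mu f.
Proof.
by move=> cf; rewrite -[RHS]mulN1r -cintegralZl//; apply: eq_cintegral => x; rewrite mulN1r.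
Qed.

Lemma cintegralB f g : cint f -> cint g ->
  cintegral mu (fun x => f x - g x) = cintegral mu f - cintegral mu g.
Proof. by move=> cf cg; rewrite cintegralD ?cintegralN//; exact: cintN. Qed.

Lemma cint_sum (I : Type) (s : seq I) (F : I -> T -> C) : (forall i, cint (F i)) ->
  cint (fun x => \sum_(i <- s) F i x).
Proof.
move=> cF; elim: s => [|i s IH].
  by under eq_fun do rewrite big_nil; split; exact: rint0.
by under eq_fun do rewrite big_cons; exact: cintD.
Qed.

Lemma cintegral_sum (I : Type) (s : seq I) (F : I -> T -> C) : (forall i, cint (F i)) ->
  cintegral mu (fun x => \sum_(i <- s) F i x) = \sum_(i <- s) cintegral mu (F i).
Proof.
move=> cF; elim: s => [|i s IH].
  by under eq_fun do rewrite big_nil; rewrite big_nil cintegral0.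
under eq_fun do rewrite big_cons; rewrite big_cons cintegralD ?IH//.
exact: cint_sum.
Qed.

(** The factor 2 comes from bounding the real and imaginary parts separately; constants such as
    [moment_const] absorb it. *)
Lemma cintegral_norm f h : cmeas f -> rint h -> (forall x, normc (f x) <= h x) ->
  normc (cintegral mu f) <= 2 * \int[mu]_x h x.
Proof.
move=> mf ih fh; have [fr fi] := cint_le mf ih fh.
rewrite (le_trans (normc_le_ReIm _))//= mulrDl mul1r lerD//.
- rewrite (le_trans (le_normr_Rintegral _ fr))// le_Rintegral//.
    exact: integrable_norm.
  by move=> x _; exact: le_trans (Re_le_normc _) (fh x).
- rewrite (le_trans (le_normr_Rintegral _ fi))// le_Rintegral//.
    exact: integrable_norm.
  by move=> x _; exact: le_trans (Im_le_normc _) (fh x).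
Qed.

(** Convergence by coordinates, so that real limit theorems apply to each part; [ccvg_cvg] returns
    to the norm topology. *)
Definition ccvg (u : nat -> C) (l : C) :=
  ((fun n => Re (u n)) @ \oo --> Re l) /\ ((fun n => Im (u n)) @ \oo --> Im l).

Lemma rdct (h_ : nat -> T -> R) (h k : T -> R) :
  (forall n, measurable_fun setT (h_ n)) -> rint k ->
  (forall n x, `|h_ n x| <= k x) ->
  (forall x, (fun n => h_ n x) @ \oo --> h x) ->
  rint h /\ ((fun n => \int[mu]_x h_ n x) @ \oo --> \int[mu]_x h x).
Proof.
move=> mh ik hk hc.
have mhE n : measurable_fun setT (EFin \o h_ n) by exact/measurable_EFinP.
have mhl : measurable_fun setT h.
  by apply: (measurable_fun_cvg mh) => x _; exact: hc.
have hcE : \forall x \ae mu, setT x -> (fun n => (h_ n x)%:E) @ \oo --> (h x)%:E.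
  by apply/aeW => x _; apply/cvg_EFin; [exact: nearW|exact: hc].
have hkE : \forall x \ae mu, forall n, setT x -> (`|(h_ n x)%:E| <= (k x)%:E)%E.
  by apply/aeW => x n _; rewrite lee_fin.
have mhlE : measurable_fun setT (EFin \o h) by exact/measurable_EFinP.
have [ih _ hl] := dominated_convergence measurableT mhE mhlE hcE ik hkE.
split=> //; apply: fine_cvg; rewrite fineK ?integrable_fin_num//.
Qed.

Lemma cdct (f_ : nat -> T -> C) f h :
  (forall n, cmeas (f_ n)) -> rint h -> (forall n x, normc (f_ n x) <= h x) ->
  (forall x, ccvg (fun n => f_ n x) (f x)) ->
  cint f /\ ccvg (fun n => cintegral mu (f_ n)) (cintegral mu f).
Proof.
move=> mf ih fh fc.
have [|||ir lr] := @rdct (fun n x => Re (f_ n x)) (fun x => Re (f x)) h _ ih.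
- by move=> n; have [] := mf n.
- by move=> n x; exact: le_trans (Re_le_normc _) (fh n x).
- by move=> x; have [] := fc x.
have [|||ii li] := @rdct (fun n x => Im (f_ n x)) (fun x => Im (f x)) h _ ih.
- by move=> n; have [] := mf n.
- by move=> n x; exact: le_trans (Im_le_normc _) (fh n x).
- by move=> x; have [] := fc x.
by split; split.
Qed.

End complex_integral.

Section complex_measurability.
Context d (T : measurableType d) {R : realType}.
Local Notation C := R[i].
Local Notation Re := (@complex.Re R).
Local Notation Im := (@complex.Im R).
Implicit Types (f g : T -> C) (h : T -> R).

Lemma cmeas_cst (c : C) : cmeas (fun _ : T => c).
Proof. by split; exact: measurable_cst. Qed.

Lemma cmeas_real h : measurable_fun setT h -> cmeas (fun x => (h x)%:C).
Proof. by move=> mh; split => //; exact: measurable_cst. Qed.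

Lemma cmeasD f g : cmeas f -> cmeas g -> cmeas (fun x => f x + g x).
Proof.
move=> [fr fi] [gr gi]; split.
- by under eq_fun do rewrite cReD; exact: measurable_funD.
- by under eq_fun do rewrite cImD; exact: measurable_funD.
Qed.

Lemma cmeasM f g : cmeas f -> cmeas g -> cmeas (fun x => f x * g x).
Proof.
move=> [fr fi] [gr gi]; split.
- by under eq_fun do rewrite cReM; apply: measurable_funB; exact: measurable_funM.
- by under eq_fun do rewrite cImM; apply: measurable_funD; exact: measurable_funM.
Qed.

Lemma cmeasN f : cmeas f -> cmeas (fun x => - f x).
Proof.
by move=> mf; under eq_fun do rewrite -mulN1r; apply: cmeasM => //; exact: cmeas_cst.
Qed.

Lemma cmeasB f g : cmeas f -> cmeas g -> cmeas (fun x => f x - g x).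
Proof. by move=> mf mg; apply: cmeasD => //; exact: cmeasN. Qed.

Lemma cmeas_cexp f : cmeas f -> cmeas (fun x => cexp (f x)).
Proof.
move=> [fr fi]; split.
- under eq_fun do rewrite Re_cexp; apply: measurable_funM.
    exact: (measurableT_comp (@measurable_expR R)).
  exact: (measurable_continuous_comp (@continuous_cos R)).
- under eq_fun do rewrite Im_cexp; apply: measurable_funM.
    exact: (measurableT_comp (@measurable_expR R)).
  exact: (measurable_continuous_comp (@continuous_sin R)).
Qed.

Lemma cmeas_prod (I : Type) (s : seq I) (F : I -> T -> C) : (forall i, cmeas (F i)) ->
  cmeas (fun x => \prod_(i <- s) F i x).
Proof.
move=> cF; elim: s => [|i s IH].
  by under eq_fun do rewrite big_nil; exact: cmeas_cst.
by under eq_fun do rewrite big_cons; exact: cmeasM.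
Qed.

Lemma cmeas_if (b : T -> bool) f g : measurable_fun setT b -> cmeas f -> cmeas g ->
  cmeas (fun x => if b x then f x else g x).
Proof.
move=> mb [fr fi] [gr gi]; split.
- by under eq_fun do rewrite (fun_if Re); exact: measurable_fun_ifT.
- by under eq_fun do rewrite (fun_if Im); exact: measurable_fun_ifT.
Qed.

Lemma cmeas_comp d' (T' : measurableType d') (phi : T' -> T) f :
  cmeas f -> measurable_fun setT phi -> cmeas (fun x => f (phi x)).
Proof. by move=> [fr fi] mphi; split; [exact: (measurableT_comp fr mphi)|exact: (measurableT_comp fi mphi)]. Qed.

End complex_measurability.

(** * Fubini's theorem for complex integrands *)

Section complex_fubini.
Context d1 d2 (T1 : measurableType d1) (T2 : measurableType d2) {R : realType}.
Context (m1 : {sigma_finite_measure set T1 -> \bar R}).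
Context (m2 : {sigma_finite_measure set T2 -> \bar R}).
Local Notation C := R[i].
Local Notation Re := (@complex.Re R).
Local Notation Im := (@complex.Im R).

(** By Tonelli the integrals of the positive and negative parts are measurable in x, and [fine]
    keeps their difference measurable even where it is infinite. *)
Lemma measurable_Rintegral_param (f : T1 * T2 -> R) : measurable_fun setT f ->
  measurable_fun setT (fun x => \int[m2]_y f (x, y)).
Proof.
move=> mf; have mfE : measurable_fun setT (EFin \o f) by exact/measurable_EFinP.
suff h : measurable_fun setT (fun x => \int[m2]_y (f (x, y))%:E)%E.
  exact: (measurableT_comp (fine_measurable measurableT) h).
under eq_fun do rewrite integralE.
apply: emeasurable_funB.
- have hfunepos : measurable_fun setT ((EFin \o f)^\+)%E by exact: measurable_funepos.
  apply: (eq_measurable_fun _ _ (measurable_fun_fubini_tonelli_F (EFin \o f)^\+%E hfunepos (funepos_ge0 _))) => z _.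
  by apply: eq_integral => t _; rewrite !funeposE.
- have hfuneneg : measurable_fun setT ((EFin \o f)^\-)%E by exact: measurable_funeneg.
  apply: (eq_measurable_fun _ _ (measurable_fun_fubini_tonelli_F (EFin \o f)^\-%E hfuneneg (funeneg_ge0 _))) => z _.
  by apply: eq_integral => t _; rewrite !funenegE.
Qed.

Lemma cmeas_cintegral_param (f : T1 * T2 -> C) : cmeas f ->
  cmeas (fun x => cintegral m2 (fun y => f (x, y))).
Proof.
move=> [fr fi]; split => /=.
- exact: (measurable_Rintegral_param fr).
- exact: (measurable_Rintegral_param fi).
Qed.

(** The bound g makes every section over the first factor integrable, and G makes the iterated
    integral of |f| finite, which is Tonelli's criterion for the product. *)
Lemma rfubini (f : T1 * T2 -> R) (g : T1 -> T2 -> R) (G : T1 -> R) :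
  measurable_fun setT f -> (forall x, rint m2 (g x)) ->
  (forall x y, `|f (x, y)| <= g x y) -> rint m1 G ->
  (forall x, \int[m2]_y g x y <= G x) ->
  [/\ rint (m1 \x m2)%E f,
      \int[(m1 \x m2)%E]_z f z = \int[m1]_x \int[m2]_y f (x, y),
      \int[(m1 \x m2)%E]_z f z = \int[m2]_y \int[m1]_x f (x, y) &
      rint m1 (fun x => \int[m2]_y f (x, y))].
Proof.
move=> mf ig fg iG gG.
have mfE : measurable_fun setT (EFin \o f) by exact/measurable_EFinP.
have ms x : measurable_fun setT (fun y => f (x, y)).
  by apply: (measurableT_comp mf); exact: pair1_measurable.
have isec x : rint m2 (fun y => f (x, y)) by apply: (rint_le _ (ig x)).
have ifp : (m1 \x m2)%E.-integrable setT (EFin \o f).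
  apply/(integrable12ltyP _ _ mfE).
  apply: (@le_lt_trans _ _ (\int[m1]_x (EFin \o G) x)%E); last first.
    by rewrite ltey_eq (integrable_fin_num measurableT iG).
  apply: ge0_le_integral => //.
  - by move=> x _; exact: integral_ge0.
  - apply: (@measurable_fun_fubini_tonelli_F _ _ _ _ _ m2 (abse \o (EFin \o f))%E).
      exact: measurableT_comp.
    by move=> z /=.
  - by apply/measurable_EFinP; exact: rint_meas iG.
  - move=> x _; apply: (@le_trans _ _ (\int[m2]_y (g x y)%:E)%E).
      apply: ge0_le_integral => //.
      + by apply: measurableT_comp => //; apply/measurable_EFinP; exact: ms.
      + by apply/measurable_EFinP; exact: rint_meas (ig x).
      + by move=> y _; rewrite /= lee_fin.
    by rewrite -[leLHS]fineK ?lee_fin ?gG// (integrable_fin_num measurableT (ig x)).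
have e12 : (\int[m1]_x (\int[m2]_y f (x, y))%:E)%E = (\int[m1]_x \int[m2]_y (f (x, y))%:E)%E.
  apply: eq_integral => x _.
  by rewrite /Rintegral fineK// (integrable_fin_num measurableT (isec x)).
(* In this order only almost every section is known to be integrable, so the two integrands agree
   almost everywhere. *)
have e21 : (\int[m2]_y (\int[m1]_x f (x, y))%:E)%E = (\int[m2]_y \int[m1]_x (f (x, y))%:E)%E.
  apply: ae_eq_integral => //.
  - apply/measurable_EFinP.
    suff h : measurable_fun setT (fun y => \int[m1]_x (f (x, y))%:E)%E.
      exact: (measurableT_comp (fine_measurable measurableT) h).
    under eq_fun do rewrite integralE.
    apply: emeasurable_funB.
    + have hfunepos : measurable_fun setT ((EFin \o f)^\+)%E by exact: measurable_funepos.
  apply: (eq_measurable_fun _ _ (measurable_fun_fubini_tonelli_G (EFin \o f)^\+%E hfunepos (funepos_ge0 _))) => z _.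
  by apply: eq_integral => t _; rewrite !funeposE.
    + have hfuneneg : measurable_fun setT ((EFin \o f)^\-)%E by exact: measurable_funeneg.
  apply: (eq_measurable_fun _ _ (measurable_fun_fubini_tonelli_G (EFin \o f)^\-%E hfuneneg (funeneg_ge0 _))) => z _.
  by apply: eq_integral => t _; rewrite !funenegE.
  - exact: (measurable_fubini_G ifp).
  - have := ae_integrable2 ifp; apply: filterS => y iy _.
    by rewrite /Rintegral fineK// (integrable_fin_num measurableT iy).
split => //.
- by congr fine; rewrite e12 -(integral12_prod_meas1 ifp).
- by congr fine; rewrite e21 -(integral21_prod_meas1 ifp).
- have := integrable_fubini_F ifp; apply: eq_integrable => // x _.
  by rewrite /= /Rintegral fineK// (integrable_fin_num measurableT (isec x)).
Qed.

Lemma cfubini (f : T1 * T2 -> C) (g : T1 -> T2 -> R) (G : T1 -> R) :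
  cmeas f -> (forall x, rint m2 (g x)) ->
  (forall x y, normc (f (x, y)) <= g x y) -> rint m1 G ->
  (forall x, \int[m2]_y g x y <= G x) ->
  [/\ cint (m1 \x m2)%E f,
      cintegral (m1 \x m2)%E f = cintegral m1 (fun x => cintegral m2 (fun y => f (x, y))),
      cintegral (m1 \x m2)%E f = cintegral m2 (fun y => cintegral m1 (fun x => f (x, y))) &
      cint m1 (fun x => cintegral m2 (fun y => f (x, y)))].
Proof.
move=> [mr mi] ig fg iG gG.
have [|r1 r2 r3 r4] := rfubini mr ig _ iG gG.
  by move=> x y; exact: le_trans (Re_le_normc _) (fg x y).
have [|i1 i2 i3 i4] := rfubini mi ig _ iG gG.
  by move=> x y; exact: le_trans (Im_le_normc _) (fg x y).
by split => //; apply: complexP.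
Qed.

End complex_fubini.

(** * Affine changes of variables on the line *)

Section affine_change_of_variables.
Context {R : realType}.
Local Notation mu := (@lebesgue_measure R).
Local Notation T := (measurableTypeR R).

Lemma measurable_affine (x c : R) : measurable_fun setT (fun s : T => x + c * s : T).
Proof. by apply: measurable_funD => //; exact: measurable_funM. Qed.

Definition affine_image (x c : R) : {measure set T -> \bar R} :=
  mscale (NngNum (normr_ge0 c))
    (measure_function_pushforward__canonical__measure_function_Measure mu
      (measurable_affine x c)).

(** Uniqueness of Lebesgue measure reduces this to intervals ]a, b]; for c < 0 their preimages are
    closed on the left and open on the right. *)
Lemma lebesgue_measure_affine (x c : R) (A : set T) : c != 0 -> measurable A ->
  mu A = (`|c|%:E * mu ((fun s : T => (x + c * s)%R : T) @^-1` A))%E.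
Proof.
move=> c0 mA; have cp : 0 < `|c| by rewrite normr_gt0.
pose nu := affine_image x c.
suff h : forall X, ocitv X -> mu X = nu X.
  by rewrite (lebesgue_measure_unique h mA).
move=> _ [[a b] _ <-].
change (mu `]a, b]%classic =
  `|c|%:E * mu ((fun s : T => (x + c * s)%R : T) @^-1` `]a, b]%classic))%E.
have [cneg|cpos|ceq] := ltgtP c 0; last by rewrite ceq eqxx in c0.
- rewrite (_ : _ @^-1` _ = `[(b - x) / c, (a - x) / c[%classic); last first.
    apply/seteqP; split => s /=; rewrite !in_itv /=.
      by rewrite ler_ndivrMr// ltr_ndivlMr// mulrC => /andP[h1 h2]; apply/andP; split; lra.
    by rewrite ler_ndivrMr// ltr_ndivlMr// mulrC => /andP[h1 h2]; apply/andP; split; lra.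
  rewrite !lebesgue_measure_itv /= !lte_fin ltr_ndivrMr// divfK// ltrD2r.
  case: ifP => [ab|_]; last by rewrite mule0.
  by rewrite -!EFinB -EFinM ltr0_norm//; congr EFin; field.
- rewrite (_ : _ @^-1` _ = `](a - x) / c, (b - x) / c]%classic); last first.
    apply/seteqP; split => s /=; rewrite !in_itv /=.
      by rewrite ler_pdivlMr// ltr_pdivrMr// mulrC => /andP[h1 h2]; apply/andP; split; lra.
    by rewrite ler_pdivlMr// ltr_pdivrMr// mulrC => /andP[h1 h2]; apply/andP; split; lra.
  rewrite !lebesgue_measure_itv /= !lte_fin ltr_pdivrMr// divfK// ltrD2r.
  case: ifP => [ab|_]; last by rewrite mule0.
  by rewrite -!EFinB -EFinM gtr0_norm//; congr EFin; field.
Qed.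

Lemma ge0_integral_affine (x c : R) (f : R -> \bar R) : c != 0 ->
  measurable_fun setT f -> (forall y, 0 <= f y)%E ->
  (\int[mu]_y f y = `|c|%:E * \int[mu]_s f (x + c * s)%R)%E.
Proof.
move=> c0 mf f0; have cp : 0 < `|c| by rewrite normr_gt0.
pose nu := affine_image x c.
rewrite (@eq_measure_integral _ _ _ _ nu); last first.
  by move=> A mA _; rewrite /= (lebesgue_measure_affine x c0 mA).
rewrite ge0_integral_mscale//=; congr (_ * _)%E.
by rewrite ge0_integral_pushforward//=; exact: measurable_affine.
Qed.

Lemma rint_affine (x c : R) (f : R -> R) : c != 0 -> rint mu f ->
  rint mu (fun s => f (x + c * s)).
Proof.
move=> c0 /integrableP[/measurable_EFinP mf foo]; apply/integrableP; split.
  by apply/measurable_EFinP; exact: (measurableT_comp mf (measurable_affine x c)).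
move: foo; rewrite (ge0_integral_affine x c0)//; last first.
  by apply: measurableT_comp => //; exact/measurable_EFinP.
rewrite /=; set I := (\int[mu]_s _)%E.
have : (0 <= I)%E by exact: integral_ge0.
case: I => [r _ _|_|//]; first exact: ltry.
by rewrite gt0_muley ?lte_fin ?normr_gt0.
Qed.

Lemma Rintegral_affine (x c : R) (f : R -> R) : c != 0 -> rint mu f ->
  \int[mu]_y f y = `|c| * \int[mu]_s f (x + c * s).
Proof.
move=> c0 fi; have mf := rint_meas fi; have fa := rint_affine x c0 fi.
have mfa := rint_meas fa.
have cp : 0 < `|c| by rewrite normr_gt0.
have mE : measurable_fun setT (EFin \o f) by exact/measurable_EFinP.
pose fx s := f (x + c * s).
have e : (\int[mu]_y (f y)%:E = `|c|%:E * \int[mu]_s (fx s)%:E)%E.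
  rewrite integralE [in RHS]integralE muleBr//; last first.
    apply: fin_num_adde_defl; rewrite fin_numN.
    exact: (integrable_neg_fin_num measurableT fa).
  congr (_ - _)%E.
  - rewrite (ge0_integral_affine x c0)//; last exact: measurable_funepos.
    by congr (_ * _)%E; apply: eq_integral => s _; rewrite !funeposE.
  - rewrite (ge0_integral_affine x c0)//; last exact: measurable_funeneg.
    by congr (_ * _)%E; apply: eq_integral => s _; rewrite !funenegE.
by rewrite /Rintegral e fineM// (integrable_fin_num measurableT fa).
Qed.

Lemma cint_affine (x c : R) (f : R -> R[i]) : c != 0 -> cint mu f ->
  cint mu (fun s => f (x + c * s)).
Proof.
move=> c0 [fr fi]; split; [exact: (rint_affine x c0 fr)|exact: (rint_affine x c0 fi)].
Qed.

Lemma cintegral_affine (x c : R) (f : R -> R[i]) : c != 0 -> cint mu f ->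
  cintegral mu f = `|c|%:C * cintegral mu (fun s => f (x + c * s)).
Proof.
move=> c0 [fr fi]; apply: complexP; rewrite ?cRe_rM ?cIm_rM /=.
  exact: Rintegral_affine.
exact: Rintegral_affine.
Qed.

End affine_change_of_variables.

(** * Complex functions of a real variable *)

Section complex_derivative.
Context {R : realType}.
Local Notation C := R[i].
Local Notation Re := (@complex.Re R).
Local Notation Im := (@complex.Im R).
Implicit Types (f g F : R -> C) (h k : R -> R) (x : R).

(** Differentiation in a real variable only; complex differentiability is [cdiff]. *)
Definition cderive f x (df : C) :=
  is_derive x 1 (fun t => Re (f t)) (Re df) /\ is_derive x 1 (fun t => Im (f t)) (Im df).

Definition ccont f :=
  continuous (fun t => Re (f t)) /\ continuous (fun t => Im (f t)).

Lemma is_derive_eqr h x d d' : is_derive x 1 h d -> d = d' -> is_derive x 1 h d'.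
Proof. by move=> ? <-. Qed.

Lemma cderive_eqr f x (d d' : C) : cderive f x d -> d = d' -> cderive f x d'.
Proof. by move=> ? <-. Qed.

Lemma is_derive_continuous h (dh : R -> R) : (forall x, is_derive x 1 h (dh x)) ->
  continuous h.
Proof.
move=> hd x; apply/differentiable_continuous/derivable1_diffP.
by have [] := hd x.
Qed.

Lemma cderive_ccont f (df : R -> C) : (forall x, cderive f x (df x)) -> ccont f.
Proof.
move=> fd; split.
- by apply: (@is_derive_continuous _ (fun x => Re (df x))) => x; have [] := fd x.
- by apply: (@is_derive_continuous _ (fun x => Im (df x))) => x; have [] := fd x.
Qed.

Lemma cderive_cst (c : C) x : cderive (fun=> c) x 0.
Proof. by split; exact: is_derive_cst. Qed.

Lemma cderive_real h x dh : is_derive x 1 h dh -> cderive (fun t => (h t)%:C) x dh%:C.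
Proof. by move=> hd; split => //; exact: is_derive_cst. Qed.

Lemma cderive_id x : cderive (fun t => t%:C) x 1.
Proof. by have := cderive_real (is_derive_id x (1 : R)). Qed.

Lemma cderiveD f g x df dg : cderive f x df -> cderive g x dg ->
  cderive (fun t => f t + g t) x (df + dg).
Proof.
move=> [fr fi] [gr gi]; split.
- by under eq_fun do rewrite cReD; rewrite cReD; exact: is_deriveD.
- by under eq_fun do rewrite cImD; rewrite cImD; exact: is_deriveD.
Qed.

Lemma is_deriveMr h k x dh dk : is_derive x 1 h dh -> is_derive x 1 k dk ->
  is_derive x 1 (fun t => h t * k t) (dh * k x + h x * dk).
Proof.
move=> hd kd; apply: is_derive_eqr (is_deriveM hd kd) _.
by rewrite /GRing.scale /= mulrC addrC [k x * _]mulrC [dk * _]mulrC.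
Qed.

Lemma cderiveM f g x df dg : cderive f x df -> cderive g x dg ->
  cderive (fun t => f t * g t) x (df * g x + f x * dg).
Proof.
move=> [fr fi] [gr gi]; split.
- under eq_fun do rewrite cReM.
  apply: is_derive_eqr (is_deriveB (is_deriveMr fr gr) (is_deriveMr fi gi)) _.
  by rewrite cReD !cReM; ring.
- under eq_fun do rewrite cImM.
  apply: is_derive_eqr (is_deriveD (is_deriveMr fr gi) (is_deriveMr fi gr)) _.
  by rewrite cImD !cImM; ring.
Qed.

Lemma cderiveZl (c : C) f x df : cderive f x df -> cderive (fun t => c * f t) x (c * df).
Proof.
by move=> fd; apply: cderive_eqr (cderiveM (cderive_cst c x) fd) _; rewrite mul0r add0r.
Qed.

Lemma cderiveN f x df : cderive f x df -> cderive (fun t => - f t) x (- df).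
Proof.
move=> fd; rewrite -mulN1r; under eq_fun do rewrite -mulN1r; exact: cderiveZl.
Qed.

Lemma cderiveB f g x df dg : cderive f x df -> cderive g x dg ->
  cderive (fun t => f t - g t) x (df - dg).
Proof. by move=> fd gd; apply: cderiveD => //; exact: cderiveN. Qed.

Lemma is_derive_comp h k x dh dk : is_derive (k x) 1 h dh -> is_derive x 1 k dk ->
  is_derive x 1 (fun t => h (k t)) (dh * dk).
Proof. by move=> hd kd; exact: is_derive1_comp. Qed.

Lemma cderive_cexp f x df : cderive f x df ->
  cderive (fun t => cexp (f t)) x (df * cexp (f x)).
Proof.
move=> [fr fi]; split.
- under eq_fun do rewrite Re_cexp.
  apply: is_derive_eqr (is_deriveMr (is_derive_comp (is_derive_expR _) fr)
    (is_derive_comp (is_derive_cos _) fi)) _.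
  by rewrite cReM Re_cexp Im_cexp; ring.
- under eq_fun do rewrite Im_cexp.
  apply: is_derive_eqr (is_deriveMr (is_derive_comp (is_derive_expR _) fr)
    (is_derive_comp (is_derive_sin _) fi)) _.
  by rewrite cImM Re_cexp Im_cexp; ring.
Qed.

Lemma ccontM f g : ccont f -> ccont g -> ccont (fun t => f t * g t).
Proof.
move=> [fr fi] [gr gi]; split.
- under eq_fun do rewrite cReM; move=> x; apply: cvgB; apply: cvgM;
    [exact: fr|exact: gr|exact: fi|exact: gi].
- under eq_fun do rewrite cImM; move=> x; apply: cvgD; apply: cvgM;
    [exact: fr|exact: gi|exact: fi|exact: gr].
Qed.

Lemma ccontD f g : ccont f -> ccont g -> ccont (fun t => f t + g t).
Proof.
move=> [fr fi] [gr gi]; split.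
- by under eq_fun do rewrite cReD; move=> x; apply: cvgD; [exact: fr|exact: gr].
- by under eq_fun do rewrite cImD; move=> x; apply: cvgD; [exact: fi|exact: gi].
Qed.

Lemma ccont_cst (c : C) : ccont (fun=> c).
Proof. by split=> x; exact: cvg_cst. Qed.

Lemma ccont_real h : continuous h -> ccont (fun t => (h t)%:C).
Proof. by move=> ch; split=> // x; exact: cvg_cst. Qed.

Lemma ccont_cmeas f : ccont f -> cmeas (f : measurableTypeR R -> C).
Proof. by move=> [fr fi]; split; exact: continuous_measurable_fun. Qed.

End complex_derivative.

(** * Improper integrals from antiderivatives *)

Section improper_ftc.
Context {R : realType}.
Local Notation mu := (@lebesgue_measure R).
Local Notation C := R[i].

(** The fundamental theorem evaluates the integral on each interval, and dominated convergence with
    dominant |h| lets the intervals exhaust the support of h. *)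
Lemma ftc_exhaustion (f F h : R -> R) (a b : nat -> R) (l : R) :
  continuous f -> (forall x : R, is_derive x 1 F (f x)) -> rint mu h ->
  (forall n, a n < b n) ->
  (forall n x, x \in `[a n, b n] -> h x = f x) ->
  (forall x, h x != 0 -> \forall n \near \oo, x \in `[a n, b n]) ->
  (fun n => F (b n) - F (a n)) @ \oo --> l ->
  \int[mu]_x h x = l.
Proof.
move=> cf dF ih ab hf hx Fl.
have ib n : (fun x => if x \in `[a n, b n] then h x else 0) = h \_ `[a n, b n].
  by apply/funext => x; rewrite patchE mem_setE.
have [] := @rdct _ _ _ mu (fun n x => if x \in `[a n, b n] then h x else 0) h (fun x => `|h x|).
- move=> n; rewrite ib; apply/(measurable_restrictT _ _).1 => //.
  by apply: measurable_funTS; exact: rint_meas ih.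
- exact: integrable_norm.
- by move=> n x; case: ifP => // _; rewrite normr0.
- move=> x; apply: cvg_near_cst; have [->|hx0] := eqVneq (h x) 0.
    by apply: nearW => n; case: ifP.
  by apply: filterS (hx x hx0) => n ->.
move=> _ cv; suff e : (fun n => \int[mu]_x (if x \in `[a n, b n] then h x else 0)) =
    (fun n => F (b n) - F (a n)).
  by rewrite e in cv; exact: (cvg_unique _ cv Fl).
apply/funext => n; rewrite ib -Rintegral_mkcond.
transitivity (\int[mu]_(x in `[a n, b n]) f x).
  by apply: eq_Rintegral => x; rewrite inE => /hf.
rewrite /Rintegral (@continuous_FTC2 _ _ F)//.
- exact: continuous_subspaceT.
- have cF := is_derive_continuous dF; split.
  + by move=> x _; have [] := dF x.
  + by apply: cvg_at_right_filter; exact: cF.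
  + by apply: cvg_at_left_filter; exact: cF.
- by move=> x _; rewrite derive1E; have [_ ->] := dF x.
Qed.

Lemma near_nat_ge (y : R) : \forall n \near \oo, y <= n%:R.
Proof. exact: nbhs_infty_ger. Qed.

Lemma ftc_line (f F : R -> R) (l1 l2 : R) :
  continuous f -> (forall x : R, is_derive x 1 F (f x)) -> rint mu f ->
  (fun n => F n.+1%:R) @ \oo --> l1 -> (fun n => F (- n.+1%:R)) @ \oo --> l2 ->
  \int[mu]_x f x = l1 - l2.
Proof.
move=> cf dF fi c1 c2.
apply: (@ftc_exhaustion f F f (fun n => - n.+1%:R) (fun n => n.+1%:R)) => //.
- by move=> n; rewrite (@lt_trans _ _ 0)// oppr_lt0.
- move=> x _; have := near_nat_ge `|x|; apply: filterS => n xn.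
  rewrite in_itv /= -ler_norml (le_trans xn)// ler_nat//.
- exact: cvgB.
Qed.

Lemma ftc_half_line (f F : R -> R) (l : R) :
  continuous f -> (forall x : R, is_derive x 1 F (f x)) ->
  rint mu (fun x => if 0 <= x then f x else 0) ->
  (fun n => F n.+1%:R) @ \oo --> l ->
  \int[mu]_x (if 0 <= x then f x else 0) = l - F 0.
Proof.
move=> cf dF fi c1.
apply: (@ftc_exhaustion f F _ (fun n => 0) (fun n => n.+1%:R)) => //.
- by move=> n x; rewrite in_itv /= => /andP[-> _].
- move=> x; case: ifP => [x0 _|_]; last by rewrite eqxx.
  have := near_nat_ge x; apply: filterS => n xn.
  by rewrite in_itv /= x0 /= (le_trans xn)// ler_nat.
- by apply: cvgB => //; exact: cvg_cst.
Qed.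

Lemma cftc_line (f F : R -> C) (l1 l2 : C) :
  ccont f -> (forall x : R, cderive F x (f x)) -> cint mu f ->
  ccvg (fun n => F n.+1%:R) l1 -> ccvg (fun n => F (- n.+1%:R)) l2 ->
  cintegral mu f = l1 - l2.
Proof.
move=> [cr ci] dF [ir ii] [r1 i1] [r2 i2]; apply: complexP; rewrite /= ?cReB ?cImB.
- by apply: (@ftc_line _ (fun x => complex.Re (F x)) _ _ cr _ ir r1 r2) => x; have [] := dF x.
- by apply: (@ftc_line _ (fun x => complex.Im (F x)) _ _ ci _ ii i1 i2) => x; have [] := dF x.
Qed.

Lemma cftc_half_line (f F : R -> C) (l : C) :
  ccont f -> (forall x : R, cderive F x (f x)) ->
  cint mu (fun x => if 0 <= x then f x else 0) ->
  ccvg (fun n => F n.+1%:R) l ->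
  cintegral mu (fun x => if 0 <= x then f x else 0) = l - F 0.
Proof.
have e (P : C -> R) : P 0 = 0 -> (fun x : R => P (if 0 <= x then f x else 0)) =
    (fun x => if 0 <= x then P (f x) else 0).
  by move=> P0; apply/funext => x; case: ifP.
move=> [cr ci] dF [ir ii] [r1 i1]; apply: complexP; rewrite /= ?cReB ?cImB.
- rewrite (e (@complex.Re R))//; rewrite (e (@complex.Re R))// in ir.
  by apply: (@ftc_half_line _ (fun x => complex.Re (F x)) _ cr _ ir r1) => x; have [] := dF x.
- rewrite (e (@complex.Im R))//; rewrite (e (@complex.Im R))// in ii.
  by apply: (@ftc_half_line _ (fun x => complex.Im (F x)) _ ci _ ii i1) => x; have [] := dF x.
Qed.

End improper_ftc.

Section complex_limits.
Context {R : realType}.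
Local Notation C := R[i].
Implicit Types (u v : nat -> C) (l m : C).

Lemma ccvg_cst l : ccvg (fun=> l) l.
Proof. by split; exact: cvg_cst. Qed.

Lemma ccvgD u v l m : ccvg u l -> ccvg v m -> ccvg (fun n => u n + v n) (l + m).
Proof.
move=> [ur ui] [vr vi]; split.
- by under eq_fun do rewrite cReD; rewrite cReD; exact: cvgD.
- by under eq_fun do rewrite cImD; rewrite cImD; exact: cvgD.
Qed.

Lemma ccvgM u v l m : ccvg u l -> ccvg v m -> ccvg (fun n => u n * v n) (l * m).
Proof.
move=> [ur ui] [vr vi]; split.
- by under eq_fun do rewrite cReM; rewrite cReM; apply: cvgB; exact: cvgM.
- by under eq_fun do rewrite cImM; rewrite cImM; apply: cvgD; exact: cvgM.
Qed.

Lemma ccvgN u l : ccvg u l -> ccvg (fun n => - u n) (- l).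
Proof.
move=> cu; rewrite -mulN1r; under eq_fun do rewrite -mulN1r.
by apply: ccvgM => //; exact: ccvg_cst.
Qed.

Lemma ccvgB u v l m : ccvg u l -> ccvg v m -> ccvg (fun n => u n - v n) (l - m).
Proof. by move=> cu cv; apply: ccvgD => //; exact: ccvgN. Qed.

Lemma ccvg_real (r : nat -> R) (s : R) : r @ \oo --> s -> ccvg (fun n => (r n)%:C) s%:C.
Proof. by move=> rs; split => //; exact: cvg_cst. Qed.

Lemma ccvg_cexp u l : ccvg u l -> ccvg (fun n => cexp (u n)) (cexp l).
Proof.
move=> [ur ui]; split.
- under eq_fun do rewrite Re_cexp; rewrite Re_cexp; apply: cvgM.
    by apply: continuous_cvg => //; exact: continuous_expR.
  by apply: continuous_cvg => //; exact: continuous_cos.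
- under eq_fun do rewrite Im_cexp; rewrite Im_cexp; apply: cvgM.
    by apply: continuous_cvg => //; exact: continuous_expR.
  by apply: continuous_cvg => //; exact: continuous_sin.
Qed.

Lemma ccvg_unique u l m : ccvg u l -> ccvg u m -> l = m.
Proof.
move=> [ur ui] [vr vi]; apply: complexP; first exact: cvg_unique ur vr.
exact: cvg_unique ui vi.
Qed.

Lemma cvg0_bound (w e : nat -> R) : (forall n, `|w n| <= e n) -> e @ \oo --> 0 ->
  w @ \oo --> 0.
Proof.
move=> we e0; apply: norm_cvg0; apply: (squeeze_cvgr _ (cvg_cst 0) e0).
by apply: nearW => n; rewrite normr_ge0 /=.
Qed.

Lemma ccvg_bound u l (e : nat -> R) : (forall n, normc (u n - l) <= e n) ->
  e @ \oo --> 0 -> ccvg u l.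
Proof.
move=> ue e0; split; apply/subr_cvg0; apply: (cvg0_bound _ e0) => n.
- by rewrite -cReB; exact: le_trans (Re_le_normc _) (ue n).
- by rewrite -cImB; exact: le_trans (Im_le_normc _) (ue n).
Qed.

Lemma ccvg_normc0 u l : ccvg u l -> (fun n => normc (u n - l)) @ \oo --> 0.
Proof.
move=> [ur ui]; apply: (@cvg0_bound _ (fun n => `|complex.Re (u n) - complex.Re l| + `|complex.Im (u n) - complex.Im l|)).
  by move=> n; rewrite ger0_norm ?normc_ge0// -cReB -cImB normc_le_ReIm.
rewrite -[0]addr0; apply: cvgD; rewrite -[0](@normr0 _ R); apply: cvg_norm; exact/subr_cvg0.
Qed.

Lemma ccvg_near_cst u l : (\forall n \near \oo, u n = l) -> ccvg u l.
Proof. by move=> ul; split; apply: cvg_near_cst; apply: filterS ul => n ->. Qed.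

Lemma cvgn_expR (r : R) : 0 < r -> (fun n : nat => expR (- (r * n%:R))) @ \oo --> 0.
Proof.
move=> r0; under eq_fun do rewrite -mulNr mulrC expRM_natl.
apply: cvg_expr; rewrite ger0_norm ?expR_ge0// expR_lt1 oppr_lt0//.
Qed.

End complex_limits.

(** * Exponential, Cauchy and Poisson integrals *)

Section exponential_integrals.
Context {R : realType}.
Local Notation mu := (@lebesgue_measure R).
Local Notation C := R[i].
Local Notation Re := (@complex.Re R).

Lemma measurable_ge0 : measurable_fun setT (fun x : measurableTypeR R => 0 <= x : bool).
Proof.
apply: (measurable_fun_bool true); rewrite setTI.
rewrite (_ : _ @^-1` _ = `[0, +oo[%classic); first exact: measurable_itv.
by apply/seteqP; split => x /=; rewrite in_itv /= andbT.
Qed.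

Lemma rint_eq_off (f g : R -> R) (a : R) : measurable_fun setT f -> measurable_fun setT g ->
  (forall x, x != a -> f x = g x) -> \int[mu]_x f x = \int[mu]_x g x.
Proof.
move=> mf mg fg; congr fine; apply: ae_eq_integral => //; try exact/measurable_EFinP.
exists [set a]; split => //; first exact: lebesgue_measure_set1.
move=> x /= h; apply: contrapT => /eqP xa; apply: h => _.
by rewrite fg.
Qed.

(** Used at 0, where a closed half-line and its reflection overlap. *)
Lemma cintegral_eq_off (f g : R -> C) (a : R) :
  cmeas (f : measurableTypeR R -> C) -> cmeas (g : measurableTypeR R -> C) ->
  (forall x, x != a -> f x = g x) -> cintegral mu f = cintegral mu g.
Proof.
move=> [fr fi] [gr gi] fg; apply: complexP => /=.
- by apply: (rint_eq_off (a := a)) => // x /fg ->.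
- by apply: (rint_eq_off (a := a)) => // x /fg ->.
Qed.

(** The integrand is r^-1 times the density of the exponential law, which has mass 1. *)
Lemma integral_exp_half_line (r : R) : 0 < r ->
  rint mu (fun x => if 0 <= x then expR (- (r * x)) else 0) /\
  \int[mu]_x (if 0 <= x then expR (- (r * x)) else 0) = r^-1.
Proof.
move=> r0.
have e : (fun x => if 0 <= x then expR (- (r * x)) else 0) =
    (fun x => r^-1 * exponential_pdf r x).
  apply/funext => x; case: ifPn => [x0|]; last first.
    by rewrite -ltNge => x0; rewrite lt0_exponential_pdf// mulr0.
  by rewrite exponential_pdfE// mulrA mulVf ?gt_eqF// mul1r mulNr.
have ip := integrable_exponential_pdf r0.
split; first by rewrite e; exact: rintZl.
by rewrite e RintegralZl// /Rintegral integral_exponential_pdf//= mulr1.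
Qed.

Lemma cmeas_half_line (f : R -> C) : cmeas (f : measurableTypeR R -> C) ->
  cmeas ((fun x => if 0 <= x then f x else 0) : measurableTypeR R -> C).
Proof. by move=> mf; apply: cmeas_if => //; exact: measurable_ge0. Qed.

Lemma cderive_exp_line (c : C) x :
  cderive (fun t : R => cexp (c * t%:C)) x (c * cexp (c * x%:C)).
Proof.
by apply: cderive_cexp; apply: cderive_eqr (cderiveZl c (cderive_id x)) _; rewrite mulr1.
Qed.

Lemma cmeas_exp_line (c : C) :
  cmeas ((fun t => cexp (c * t%:C)) : measurableTypeR R -> C).
Proof. exact/ccont_cmeas/(cderive_ccont (cderive_exp_line c)). Qed.

Lemma cintegral_exp_half_line (c : C) : 0 < Re c ->
  cint mu (fun x => if 0 <= x then cexp (- c * x%:C) else 0) /\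
  cintegral mu (fun x => if 0 <= x then cexp (- c * x%:C) else 0) = c^-1.
Proof.
move=> c0; have cn0 : c != 0 by apply: contraTneq c0 => ->; rewrite ltxx.
have [ie _] := integral_exp_half_line c0.
have nE x : normc (cexp (- c * x%:C)) = expR (- (Re c * x)).
  by rewrite normc_cexp mulNr cReN cReM /= mulr0 subr0.
have ic : cint mu (fun x => if 0 <= x then cexp (- c * x%:C) else 0).
  apply: (cint_le _ ie); first exact/cmeas_half_line/cmeas_exp_line.
  by move=> x; case: ifP => _; rewrite ?normc0// nE.
split=> //.
pose F (x : R) := - c^-1 * cexp (- c * x%:C).
have dF x : cderive F x (cexp (- c * x%:C)).
  apply: cderive_eqr (cderiveZl _ (cderive_exp_line _ x)) _.
  by rewrite mulrA mulrNN mulVf// mul1r.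
rewrite (@cftc_half_line _ _ F 0 _ dF ic).
- by rewrite /F mulr0 cexp0 mulr1 opprK add0r.
- exact: cderive_ccont (cderive_exp_line (- c)).
- apply: (@ccvg_bound _ _ _ (fun n => normc c^-1 * expR (- (Re c * n.+1%:R)))).
    by move=> n; rewrite subr0 /F normcM normcN nE.
  rewrite -[0](mulr0 (normc c^-1)); apply: cvgM; first exact: cvg_cst.
  have := cvgn_expR c0; rewrite -(cvg_shiftS (fun n => expR (- (Re c * n%:R)))).
  exact.
Qed.

(* Locked, so that rewriting does not see the product in the definition of cexp. *)
Definition cis : R -> C := locked (fun t => cexp ('i%C * t%:C)).

Lemma cisE t : cis t = cexp ('i%C * t%:C).
Proof. by rewrite /cis -lock. Qed.

Lemma normc_cis t : normc (cis t) = 1.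
Proof. by rewrite cisE normc_cexp !ReImE oppr0 expR0. Qed.

Lemma cisD s t : cis (s + t) = cis s * cis t.
Proof. by rewrite !cisE RealD mulrDr cexpD. Qed.

Lemma cis0 : cis 0 = 1.
Proof. by rewrite cisE Real0 mulr0 cexp0. Qed.

Lemma cmeas_cis d (T : measurableType d) (h : T -> R) : measurable_fun setT h ->
  cmeas (fun x => cis (h x)).
Proof.
by move=> mh; under eq_fun do rewrite cisE; apply: cmeas_cexp; apply: cmeasM; [exact: cmeas_cst|exact: cmeas_real].
Qed.

Lemma integral_cauchy : rint mu (fun x => (1 + x ^+ 2)^-1) /\
  \int[mu]_x (1 + x ^+ 2)^-1 = pi.
Proof.
have f0 (x : R) : 0 <= (oneDsqr x)^-1 by rewrite invr_ge0 ltW// oneDsqr_gt0.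
have e : (\int[mu]_x ((oneDsqr x)^-1)%:E = pi%:E)%E.
  rewrite ge0_symfun_integralT//; last 2 first.
  - exact: continuous_oneDsqrV.
  - by move=> x /=; rewrite /oneDsqr sqrrN.
  rewrite (_ : [set x | _] = `[0, +oo[%classic); last first.
    by apply/seteqP; split => x/=; rewrite in_itv/= andbT.
  by rewrite integral0y_oneDsqr -EFinM; congr EFin; field.
have m : measurable_fun setT (fun x : measurableTypeR R => (oneDsqr x)^-1).
  exact: (continuous_measurable_fun (@continuous_oneDsqrV R)).
split; last by rewrite /Rintegral e.
apply/integrableP; split; first exact/measurable_EFinP.
apply: (@le_lt_trans _ _ (\int[mu]_x ((oneDsqr x)^-1)%:E)%E); last by rewrite e ltry.
rewrite le_eqVlt; apply/orP; left; apply/eqP; apply: eq_integral => x _ /=.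
by congr EFin; exact: (ger0_norm (f0 x)).
Qed.

(** Split at 0 into two half-line exponentials of rates e - i v and e + i v; the sum of the inverses
    of these rates is the right-hand side. *)
Lemma integral_poisson_kernel (e v : R) : 0 < e ->
  cintegral mu (fun u => cis (u * v) * (expR (- (e * `|u|)))%:C) =
  (2 * e / (e ^+ 2 + v ^+ 2))%:C.
Proof.
move=> e0.
pose fp (c : C) (u : R) := if 0 <= u then cexp (- c * u%:C) else 0.
pose cp : C := e%:C - 'i%C * v%:C. pose cm : C := e%:C + 'i%C * v%:C.
have rp : 0 < Re cp by rewrite /cp !ReImE !oppr0 addr0.
have rm : 0 < Re cm by rewrite /cm !ReImE oppr0 addr0.
have [ip ep] := cintegral_exp_half_line rp.
have [im em] := cintegral_exp_half_line rm.
have n1 : (-1 : R) != 0 by rewrite oppr_eq0 oner_eq0.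
have im' := cint_affine 0 n1 im.
rewrite (@cintegral_eq_off _ (fun u => fp cp u + fp cm (0 + -1 * u)) 0).
- rewrite cintegralD// ep.
  have := cintegral_affine 0 n1 im; rewrite em normrN1 Real1 mul1r => <-.
  have np : cp != 0 by apply: contraTneq rp => ->; rewrite ltxx.
  have nm : cm != 0 by apply: contraTneq rm => ->; rewrite ltxx.
  have h : (e ^+ 2 + v ^+ 2)%:C = cp * cm.
    by apply: complexP; rewrite /cp /cm !ReImE; ring.
  have nh : (e ^+ 2 + v ^+ 2)%:C != 0 :> C by rewrite h mulf_neq0.
  rewrite RealM RealV h !RealE; apply: (mulIf (mulf_neq0 np nm)).
  rewrite mulfVK ?mulf_neq0// mulrDl mulrA mulVf// mul1r [cp * cm]mulrC mulrA mulVf// mul1r.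
  by rewrite /cp /cm; ring.
- apply: cmeasM; first by apply: cmeas_cis; exact: measurable_funM.
  apply/cmeas_real/(measurableT_comp (@measurable_expR R))/measurableT_comp => //.
  by apply: measurable_funM => //; exact: measurableT_comp.
- apply: cmeasD; [exact: cint_cmeas ip|exact: cint_cmeas im'].
- move=> u u0; rewrite /fp add0r mulN1r oppr_ge0 cisE -cexp_real -cexpD.
  have [up|un|ueq] := ltgtP u 0; last by rewrite ueq eqxx in u0.
  + rewrite add0r; congr cexp; rewrite ltr0_norm// /cm !RealE; ring.
  + rewrite addr0; congr cexp; rewrite gtr0_norm// /cp !RealE; ring.
Qed.

End exponential_integrals.

(** * Fourier inversion *)

Section fourier_inversion.
Context {R : realType}.
Local Notation mu := (@lebesgue_measure R).
Local Notation T := (measurableTypeR R).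
Local Notation C := R[i].

Lemma cintegral_real (h : R -> R) : cintegral mu (fun x => (h x)%:C) = (\int[mu]_x h x)%:C.
Proof. by apply: complexP => //=; rewrite /Rintegral integral0. Qed.

Lemma rint_exp_abs (e : R) : 0 < e -> rint mu (fun u => expR (- (e * `|u|))).
Proof.
move=> e0; have [ie _] := integral_exp_half_line e0.
have n1 : (-1 : R) != 0 by rewrite oppr_eq0 oner_eq0.
apply: (rint_le _ (rintD ie (rint_affine 0 n1 ie))).
  apply: (measurableT_comp (@measurable_expR R)); apply: measurableT_comp => //.
  by apply: measurable_funM => //; exact: measurableT_comp.
move=> u /=; rewrite ger0_norm ?expR_ge0// add0r mulN1r oppr_ge0.
have [u0|u0] := leP 0 u.
  by rewrite ger0_norm// lerDl; case: ifP => // _; exact: expR_ge0.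
by rewrite add0r (ltW u0) ltr0_norm.
Qed.

Lemma cmeas_exp_abs (e : R) : cmeas (fun u : T => (expR (- (e * `|u|)))%:C : C).
Proof.
apply/cmeas_real/(measurableT_comp (@measurable_expR R))/measurableT_comp => //.
by apply: measurable_funM => //; exact: measurableT_comp.
Qed.

Lemma normc_real_ge0 (r : R) : 0 <= r -> normc (r%:C : C) = r.
Proof. by move=> r0; rewrite normc_real ger0_norm. Qed.

Lemma cvg_harmonic_real : (fun n => (n.+1%:R : R)^-1) @ \oo --> 0.
Proof. exact: cvg_harmonic. Qed.

(* The Fourier integral is regularised by the factor exp (- e |u|), whose
   transform is the Poisson kernel, and e tends to 0. *)
Lemma fourier_inversion (f : R -> C) (h : R -> R) (B x : R) :
  ccont f -> cint mu f -> (forall y, normc (f y) <= B) -> rint mu h ->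
  (forall u, normc (cintegral mu (fun y => f y * cis (u * y))) <= h u) ->
  cintegral mu (fun u => cintegral mu (fun y => f y * cis (u * y)) * cis (- (u * x)))
    = (2 * pi)%:C * f x.
Proof.
move=> cf fi fB ih fh.
have mf := ccont_cmeas cf.
pose fhat u := cintegral mu (fun y => f y * cis (u * y)).
have mul (u : T * T -> R) : measurable_fun setT u -> cmeas (fun z => cis (u z)).
  exact: cmeas_cis.
have mF : cmeas (fun z : T * T => f z.2 * cis (z.1 * z.2)).
  apply: cmeasM; first exact: (cmeas_comp mf).
  by apply: cmeas_cis; exact: measurable_funM.
have mfhat : cmeas (fhat : T -> C) := cmeas_cintegral_param mu mF.
have mcx : cmeas ((fun u => cis (- (u * x))) : T -> C).
  by apply: cmeas_cis; apply: measurableT_comp => //; exact: measurable_funM.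
pose e n : R := n.+1%:R^-1.
have e0 n : 0 < e n by rewrite /e invr_gt0.
pose K n u : C := fhat u * cis (- (u * x)) * (expR (- (e n * `|u|)))%:C.
have [_ cvK] : cint mu (fun u => fhat u * cis (- (u * x))) /\
    ccvg (fun n => cintegral mu (K n)) (cintegral mu (fun u => fhat u * cis (- (u * x)))).
  refine (@cdct _ T R mu K _ h _ ih _ _).
  - by move=> n; apply: cmeasM; [exact: cmeasM|exact: cmeas_exp_abs].
  - move=> n u; rewrite /K 2!normcM normc_cis mulr1 normc_real_ge0 ?expR_ge0//.
    rewrite (le_trans _ (fh u))// ler_piMr ?normc_ge0// -[leRHS]expR0 ler_expR.
    by rewrite oppr_le0 mulr_ge0// ltW.
  - move=> u; rewrite -[X in ccvg _ X]mulr1; apply: ccvgM; first exact: ccvg_cst.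
    rewrite -Real1 -expR0; apply: ccvg_real.
    apply: continuous_cvg; first exact: continuous_expR.
    rewrite -oppr0 -(mul0r `|u|); apply: cvgN; apply: cvgM; last exact: cvg_cst.
    exact: cvg_harmonic_real.
have ic := integral_cauchy (R := R).
pose H n (s : R) : C := (2 * (1 + s ^+ 2)^-1)%:C * f (x + e n * s).
(* By Fubini the regularised integral is f integrated against a Poisson kernel of width e n centred
   at x; y = x + e n s moves the width from the kernel into the argument of f. *)
have KH n : cintegral mu (K n) = cintegral mu (H n).
  pose F (z : T * T) := f z.2 * (cis (z.1 * (z.2 - x)) * (expR (- (e n * `|z.1|)))%:C).
  have [|||||_ q1 q2 _] := @cfubini _ _ T T _ mu mu F
      (fun u y => expR (- (e n * `|u|)) * normc (f y))
      (fun u => (\int[mu]_y normc (f y)) * expR (- (e n * `|u|))) _ _ _ _ _.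
  - apply: cmeasM; first exact: (cmeas_comp mf).
    apply: cmeasM; last exact: (cmeas_comp (cmeas_exp_abs _)).
    by apply: cmeas_cis; apply: measurable_funM => //; exact: measurable_funB.
  - by move=> u; apply: rintZl; exact: cint_normc.
  - move=> u y; rewrite /F /= 2!normcM normc_cis mul1r mulrC normc_real_ge0 ?expR_ge0//.
  - by apply: rintZl; exact: rint_exp_abs.
  - by move=> u; rewrite RintegralZl//; [rewrite [leLHS]mulrC|exact: cint_normc].
  transitivity (cintegral mu (fun u => cintegral mu (fun y => F (u, y)))).
    apply: eq_cintegral => u; rewrite /K -mulrA /fhat -cintegralZr; last first.
      apply: (cint_le _ (cint_normc fi)).
        by apply: cmeasM => //; apply: cmeas_cis; exact: measurable_funM.
      by move=> y; rewrite normcM normc_cis mulr1.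
    apply: eq_cintegral => y; rewrite /F /= -!mulrA; congr (_ * _); rewrite mulrA -cisD.
    by rewrite mulrBr.
  rewrite -q1 q2.
  pose G (y : R) : C := f y * (2 * e n / (e n ^+ 2 + (y - x) ^+ 2))%:C.
  transitivity (cintegral mu G).
    apply: eq_cintegral => y; rewrite /F /= cintegralZl ?integral_poisson_kernel//.
    apply: (cint_le _ (rint_exp_abs (e0 n))).
      apply: cmeasM; last exact: cmeas_exp_abs.
      by apply: cmeas_cis; exact: measurable_funM.
    by move=> u; rewrite normcM normc_cis mul1r normc_real_ge0 ?expR_ge0.
  have en0 : e n != 0 by rewrite gt_eqF.
  have iG : cint mu G.
    apply: (cint_le _ (rintZl (2 / e n) (cint_normc fi))).
      apply: cmeasM => //; apply/cmeas_real.
      apply: continuous_measurable_fun => y; apply: cvgM; first exact: cvg_cst.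
      apply: cvgV; first by rewrite gt_eqF// ltr_pwDl ?exprn_gt0 ?sqr_ge0.
      apply: cvgD; first exact: cvg_cst.
      by apply: (@cvgM _ _ _ _ (fun y => y - x) (fun y => y - x)); apply: cvgB => //; exact: cvg_cst.
    move=> y; rewrite /G normcM normc_real_ge0; last first.
      by rewrite divr_ge0 ?addr_ge0 ?sqr_ge0// mulr_ge0// ltW.
    rewrite mulrC ler_wpM2r ?normc_ge0// -mulrA ler_wpM2l//.
    rewrite ler_pdivrMr ?ltr_pwDl ?exprn_gt0 ?sqr_ge0// mulrDr.
    rewrite expr2 mulrA mulVf// mul1r lerDl mulr_ge0 ?sqr_ge0// invr_ge0 ltW//.
  rewrite (cintegral_affine x en0 iG) -cintegralZl; last exact: cint_affine.
  apply: eq_cintegral => s; rewrite /H /G mulrCA [RHS]mulrC; congr (_ * _).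
  rewrite -RealM ger0_norm ?ltW//; congr (_ %:C).
  rewrite addrAC subrr add0r exprMn.
  have s1 : 1 + s ^+ 2 != 0 by rewrite gt_eqF// ltr_pwDl ?sqr_ge0.
  have s2 : e n ^+ 2 + e n ^+ 2 * s ^+ 2 != 0.
    by rewrite -[X in X + _]mulr1 -mulrDr mulf_neq0// expf_neq0.
  by field; rewrite s1 exprMn s2.
(* The weight no longer depends on n, so 2 B / (1 + s^2) dominates and continuity of f at x gives
   the limit. *)
have [_ cvH] : cint mu (fun s => (2 * (1 + s ^+ 2)^-1)%:C * f x) /\
    ccvg (fun n => cintegral mu (H n)) (cintegral mu (fun s => (2 * (1 + s ^+ 2)^-1)%:C * f x)).
  have p1 s : 0 <= 2 * (1 + s ^+ 2)^-1 :> R.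
    by rewrite mulr_ge0// invr_ge0 addr_ge0 ?sqr_ge0.
  refine (@cdct _ T R mu H _ _ _ (rintZl (2 * B) ic.1) _ _).
  - move=> n; apply: cmeasM.
      by apply/cmeas_real/measurable_funM => //; exact: rint_meas ic.1.
    exact: (cmeas_comp mf (measurable_affine x (e n))).
  - move=> n s; rewrite /H normcM normc_real_ge0// mulrAC ler_wpM2r//.
      by rewrite invr_ge0 addr_ge0 ?sqr_ge0.
    by rewrite ler_wpM2l.
  - move=> s; apply: ccvgM; first exact: ccvg_cst.
    have xs : (fun n => x + e n * s) @ \oo --> x.
      rewrite -[X in _ --> X]addr0; apply: cvgD; first exact: cvg_cst.
      rewrite -(mul0r s); apply: cvgM; last exact: cvg_cst.
      exact: cvg_harmonic_real.
    split; [exact: (continuous_cvg _ (cf.1 x) xs)|exact: (continuous_cvg _ (cf.2 x) xs)].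
rewrite (_ : (fun n => cintegral mu (K n)) = (fun n => cintegral mu (H n))) in cvK; last first.
  exact/funext.
rewrite (ccvg_unique cvK cvH).
have ic2 : cint mu (fun s => (2 * (1 + s ^+ 2)^-1)%:C : C).
  by split; [exact: (rintZl 2 ic.1)|exact: rint0].
by rewrite cintegralZr// cintegral_real RintegralZl ?ic.2//; exact: ic.1.
Qed.

End fourier_inversion.

(** * The kernel *)

Section heat_kernel.
Context {R : realType} (N : nat).
Hypotheses (N_gt2 : (2 < N)%N) (N_even : ~~ odd N).
Local Notation mu := (@lebesgue_measure R).
Local Notation T := (measurableTypeR R).
Local Notation C := R[i].
Local Notation kernel := Defs.kernel.

(** The Fourier symbol of the semigroup at time t, see [symbolE]. *)
Definition gexp (t u : R) : R := expR (- (t * u ^+ N)).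

Definition gexp_hat (t xi : R) : C :=
  cintegral mu (fun u => (gexp t u)%:C * cis (xi * u)).

Lemma N_gt0 : (0 < N)%N. Proof. exact: ltn_trans N_gt2. Qed.

Lemma evenX_ge0 (u : R) : 0 <= u ^+ N.
Proof. exact: exprn_even_ge0. Qed.

Lemma gexp_ge0 t u : 0 <= gexp t u. Proof. exact: expR_ge0. Qed.

Lemma gexp_le1 t u : 0 <= t -> gexp t u <= 1.
Proof. by move=> t0; rewrite -expR0 ler_expR oppr_le0 mulr_ge0 ?evenX_ge0. Qed.

Lemma gexpN t u : gexp t (- u) = gexp t u.
Proof. by rewrite /gexp exprNn -signr_odd (negbTE N_even) mul1r. Qed.

Lemma gexpD s t u : gexp (s + t) u = gexp s u * gexp t u.
Proof. by rewrite /gexp mulrDl opprD expRD. Qed.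

Lemma expr_le_1D (a : R) i j : 0 <= a -> (i <= j)%N -> a ^+ i <= 1 + a ^+ j.
Proof.
move=> a0 ij; have [a1|a1] := leP a 1.
  by rewrite (le_trans (exprn_ile1 _ a0 a1))// lerDl exprn_ge0.
by rewrite (le_trans (ler_weXn2l (ltW a1) ij))// lerDr.
Qed.

(** For k > 0 this is the k-th power of y / k <= exp (y / k). *)
Lemma expr_le_expR (y : R) k : 0 <= y -> y ^+ k <= k%:R ^+ k * expR y.
Proof.
move=> y0; case: k => [|k]; first by rewrite !expr0 mul1r -expR0 ler_expR.
have k0 : 0 < k.+1%:R :> R by [].
rewrite -[in leRHS](@mulfVK _ k.+1%:R (lt0r_neq0 k0) y) [X in expR X]mulrC.
rewrite expRM_natl -exprMn lerXn2r ?nnegrE ?mulr_ge0 ?expR_ge0//.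
rewrite -ler_pdivrMl// mulrC (le_trans _ (expR_ge1Dx _))// lerDr//.
Qed.

Lemma gexp_moment_bound t m : 0 < t ->
  exists K, 0 <= K /\ forall u, `|u ^+ m * gexp t u| <= K * (1 + u ^+ 2)^-1.
Proof.
(* With k = m + 2, |u|^m (1 + u^2) <= 2 (1 + |u|^k), and |u|^k <= 1 + (u^N)^k, which [expr_le_expR]
   at y = t u^N compares with the inverse of [gexp t u]. *)
move=> t0; pose k := m.+2.
pose K : R := 2 * (2 + k%:R ^+ k / t ^+ k).
have c0 : 0 <= k%:R ^+ k / t ^+ k :> R by rewrite divr_ge0 ?exprn_ge0// ltW.
have K0 : 0 <= K by rewrite mulr_ge0// addr_ge0.
exists K; split=> // u.
have p : 0 < 1 + u ^+ 2 by rewrite ltr_pwDl ?sqr_ge0.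
rewrite ler_pdivlMr// normrM [`|gexp _ _|]ger0_norm ?gexp_ge0// mulrAC normrX.
have a0 : 0 <= `|u| by [].
have uN : u ^+ N = `|u| ^+ N by rewrite -normrX ger0_norm// evenX_ge0.
have h1 : `|u| ^+ m * (1 + u ^+ 2) <= 2 * (1 + `|u| ^+ k).
  rewrite mulrDr mulr1 -[u ^+ 2]real_normK ?num_real// -exprD addn2 mulrDl mul1r.
  by rewrite addrC lerD ?lerDr// expr_le_1D// (leqW (leqnSn m)).
have h2 : `|u| ^+ k <= 1 + (u ^+ N) ^+ k.
  rewrite uN -exprM; apply: expr_le_1D => //; rewrite leq_pmull//; exact: N_gt0.
have h3 : (u ^+ N) ^+ k <= k%:R ^+ k / t ^+ k * expR (t * u ^+ N).
  have := @expr_le_expR (t * u ^+ N) k; rewrite exprMn => /(_ _)h.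
  rewrite mulrAC ler_pdivlMr ?exprn_gt0// mulrC; apply: h.
  by rewrite mulr_ge0 ?evenX_ge0// ltW.
have e1 : 1 <= expR (t * u ^+ N).
  by rewrite -expR0 ler_expR mulr_ge0 ?evenX_ge0// ltW.
rewrite /gexp expRN ler_pdivrMr ?expR_gt0//.
rewrite (le_trans h1)// /K -mulrA ler_wpM2l// mulrDl.
rewrite (le_trans (lerD (lexx 1) h2))// addrA lerD//.
by rewrite -[leLHS]mulr1 ler_wpM2l.
Qed.

Lemma is_derive_expr n (x : R) : is_derive x 1 (fun t : R => t ^+ n) (n%:R * x ^+ n.-1).
Proof.
split; first exact: exprn_derivable.
by rewrite exp_derive /GRing.scale /= mulr1.
Qed.

Lemma is_derive_gexp (t x : R) :
  is_derive x 1 (gexp t) (- (t * (N%:R * x ^+ N.-1)) * gexp t x).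
Proof.
rewrite mulrC; apply: is_derive_comp (is_derive_expR _) _.
apply: is_deriveN; apply: is_derive_eqr (is_deriveMr (is_derive_cst _ _ _) (is_derive_expr N x)) _.
by rewrite mul0r add0r.
Qed.

Lemma continuous_gexp t : continuous (gexp t).
Proof. exact: is_derive_continuous (is_derive_gexp t). Qed.

Lemma measurable_gexp t : measurable_fun setT (gexp t : T -> R).
Proof. by apply: continuous_measurable_fun; exact: continuous_gexp. Qed.

Lemma rint_gexp_moment t m : 0 < t -> rint mu (fun u => u ^+ m * gexp t u).
Proof.
move=> t0; have [K [K0 hK]] := gexp_moment_bound m t0.
apply: (rint_le _ (rintZl K integral_cauchy.1)) => //.
by apply: measurable_funM; [exact: measurable_funX|exact: measurable_gexp].
Qed.

Lemma rint_gexp t : 0 < t -> rint mu (gexp t).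
Proof.
move=> t0; have := rint_gexp_moment 0 t0.
by under eq_fun do rewrite expr0 mul1r.
Qed.

Lemma measurable_scale (xi : R) : measurable_fun setT (fun u : T => xi * u : R).
Proof. by have := measurable_affine 0 xi; under eq_fun do rewrite add0r. Qed.

Lemma cmeas_cis_scale (xi : R) : cmeas ((fun u => cis (xi * u)) : T -> C).
Proof. exact: (cmeas_cis (measurable_scale xi)). Qed.

Lemma cmeas_gexp_cis t xi : cmeas ((fun u => (gexp t u)%:C * cis (xi * u)) : T -> C).
Proof.
apply: cmeasM; first by apply: cmeas_real; exact: measurable_gexp.
exact: cmeas_cis_scale.
Qed.

Lemma normc_gexp_cis t (u y : R) : normc ((gexp t u)%:C * cis y) = gexp t u.
Proof. by rewrite normcM normc_cis mulr1 normc_real_ge0 ?gexp_ge0. Qed.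

Lemma cint_gexp_cis t xi : 0 < t -> cint mu (fun u => (gexp t u)%:C * cis (xi * u)).
Proof.
move=> t0; apply: (cint_le (cmeas_gexp_cis t xi) (rint_gexp t0)) => u.
by rewrite normc_gexp_cis.
Qed.

Lemma gexp_hatN t xi : 0 < t -> gexp_hat t (- xi) = gexp_hat t xi.
Proof.
move=> t0; have n1 : (-1 : R) != 0 by rewrite oppr_eq0 oner_eq0.
rewrite /gexp_hat (cintegral_affine 0 n1 (cint_gexp_cis _ t0)).
rewrite normrN1 Real1 mul1r; apply: eq_cintegral => u.
by rewrite add0r mulN1r gexpN mulrNN.
Qed.

(** As N is even, (- i)^N = (-1)^(N/2), and [kappa] is chosen so that the product of the two signs
    is -1. *)
Lemma symbolE t (u : R) :
  kappa N * t%:C * (- 'i%C * u%:C) ^+ N = (- (t * u ^+ N))%:C :> C.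
Proof.
have Nh : N = (N./2 * 2)%N by rewrite muln2 -[LHS]odd_double_half (negbTE N_even).
have h : (- 'i%C * u%:C) ^+ N = (-1) ^+ N./2 * (u ^+ N)%:C :> C.
  rewrite exprMn -RealX; congr (_ * _).
  by rewrite {1}Nh mulnC exprM sqrrN sqr_i.
have ss : (-1) ^+ N./2 * (-1) ^+ N./2 = 1 :> C by rewrite -exprMn mulrNN mulr1 expr1n.
rewrite h /kappa exprD expr1 RealN RealM; move: ss; set s := (-1) ^+ _ => ss.
transitivity (- (s * s * (t%:C * (u ^+ N)%:C))); first ring.
by rewrite ss mul1r.
Qed.

Lemma kernelE (t xi : R) : 0 < t -> kernel N t xi = ((2 * pi)^-1)%:C * gexp_hat t xi.
Proof.
move=> t0; rewrite -gexp_hatN// /Defs.kernel; congr (_ * _); apply: eq_cintegral => u.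
rewrite cexpD symbolE cexp_real mulrC; congr (_ * _).
by rewrite cisE [in RHS]mulNr RealN mulrN mulNr.
Qed.

Lemma kernelN (t xi : R) : 0 < t -> kernel N t (- xi) = kernel N t xi.
Proof. by move=> t0; rewrite !kernelE// gexp_hatN. Qed.

Definition gexp_poly (P : {poly R}) (u : R) : R := P.[u] * gexp 1 u.

(* The derivative of gexp_poly P is gexp_poly (deriv_poly P). *)
Definition deriv_poly (P : {poly R}) : {poly R} := P^`() - N%:R *: (P * 'X^(N.-1)).

Lemma gexp_poly_bound P :
  exists K, 0 <= K /\ forall u, `|gexp_poly P u| <= K * (1 + u ^+ 2)^-1.
Proof.
(* The extra monomial u^m carries the induction: peeling P * 'X + c off trades the factor 'X for one
   more power of u. *)
suff h m : exists K, 0 <= K /\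
    forall u, `|u ^+ m * gexp_poly P u| <= K * (1 + u ^+ 2)^-1.
  have [K [K0 hK]] := h 0%N.
  by exists K; split => // u; have := hK u; rewrite expr0 mul1r.
elim/poly_ind: P m => [|P c IH] m.
  exists 0; split => // u.
  by rewrite /gexp_poly horner0 mul0r mulr0 normr0 mul0r.
have [K [K0 hK]] := IH m.+1.
have [K' [K'0 hK']] := gexp_moment_bound m (@ltr01 R).
exists (K + `|c| * K'); split => [|u]; first by rewrite addr_ge0// mulr_ge0.
have -> : u ^+ m * gexp_poly (P * 'X + c%:P) u =
    u ^+ m.+1 * gexp_poly P u + c * (u ^+ m * gexp 1 u).
  by rewrite /gexp_poly hornerMXaddC exprS; ring.
rewrite (le_trans (ler_normD _ _))// mulrDl; apply: lerD; first exact: hK.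
by rewrite normrM -mulrA ler_wpM2l.
Qed.

Lemma is_derive_gexp_poly P (u : R) :
  is_derive u 1 (gexp_poly P) (gexp_poly (deriv_poly P) u).
Proof.
have dP : is_derive u 1 (fun u => P.[u]) P^`().[u].
  by split; [exact: derivable_horner|rewrite -derive1E derivE].
apply: is_derive_eqr (is_deriveMr dP (is_derive_gexp 1 u)) _.
by rewrite /gexp_poly /deriv_poly hornerD hornerN hornerZ hornerM hornerXn; ring.
Qed.

Lemma continuous_gexp_poly P : continuous (gexp_poly P).
Proof. exact: is_derive_continuous (is_derive_gexp_poly P). Qed.

Lemma rint_gexp_poly P : rint mu (gexp_poly P).
Proof.
have [K [K0 hK]] := gexp_poly_bound P.
apply: (rint_le _ (rintZl K integral_cauchy.1)) => //.
by apply: continuous_measurable_fun; exact: continuous_gexp_poly.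
Qed.

Lemma cmeas_gexp_poly_cis P xi :
  cmeas ((fun u => (gexp_poly P u)%:C * cis (xi * u)) : T -> C).
Proof.
apply: cmeasM; last exact: cmeas_cis_scale.
by apply: cmeas_real; exact: (rint_meas (rint_gexp_poly P)).
Qed.

Lemma normc_gexp_poly_cis P (u y : R) :
  normc ((gexp_poly P u)%:C * cis y) = `|gexp_poly P u|.
Proof. by rewrite normcM normc_cis mulr1 normc_real. Qed.

Lemma cint_gexp_poly_cis P xi :
  cint mu (fun u => (gexp_poly P u)%:C * cis (xi * u)).
Proof.
apply: (cint_le (cmeas_gexp_poly_cis P xi) (integrable_norm (rint_gexp_poly P))) => u.
by rewrite normc_gexp_poly_cis.
Qed.

Lemma cderive_cis (xi u : R) : cderive (fun u => cis (xi * u)) u ('i%C * xi%:C * cis (xi * u)).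
Proof.
have e (v : R) : cis (xi * v) = cexp ('i%C * xi%:C * v%:C) by rewrite cisE RealM mulrA.
by under eq_fun do rewrite e; rewrite e; exact: cderive_exp_line.
Qed.

(** Integration by parts: the derivative of [gexp_poly P u] times [cis (xi * u)] integrates to 0
    because this product vanishes at both ends. *)
Lemma gexp_poly_hat_deriv P (xi : R) :
  cintegral mu (fun u => (gexp_poly (deriv_poly P) u)%:C * cis (xi * u)) =
  - ('i%C * xi%:C) * cintegral mu (fun u => (gexp_poly P u)%:C * cis (xi * u)).
Proof.
pose F u : C := (gexp_poly P u)%:C * cis (xi * u).
pose f u : C := (gexp_poly (deriv_poly P) u)%:C * cis (xi * u) +
  'i%C * xi%:C * ((gexp_poly P u)%:C * cis (xi * u)).
have dF u : cderive F u (f u).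
  apply: cderive_eqr (cderiveM (cderive_real (is_derive_gexp_poly P u)) (cderive_cis xi u)) _.
  by rewrite /f mulrCA.
have i0 := cint_gexp_poly_cis P xi.
have i1 := cint_gexp_poly_cis (deriv_poly P) xi.
have fi : cint mu f := cintD i1 (cintZl _ i0).
have cc : ccont (fun u => cis (xi * u)) := cderive_ccont (cderive_cis xi).
have cg Q : ccont (fun u => (gexp_poly Q u)%:C * cis (xi * u)).
  by apply: ccontM => //; apply: ccont_real; exact: continuous_gexp_poly.
have cf : ccont f by apply: ccontD => //; apply: ccontM => //; exact: ccont_cst.
have [K [K0 hK]] := gexp_poly_bound P.
have FK (n : nat) (u : R) : u ^+ 2 = n.+1%:R ^+ 2 -> normc (F u) <= K * n.+1%:R^-1.
  move=> un; rewrite normc_gexp_poly_cis (le_trans (hK u))// un.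
  rewrite ler_wpM2l// lef_pV2 ?posrE ?ltr_pwDl ?sqr_ge0// expr2.
  by rewrite (@le_trans _ _ (n.+1%:R * n.+1%:R)) ?lerDr// ler_peMl// ler1n.
have K_cvg : (fun n => K * n.+1%:R^-1) @ \oo --> 0.
  by rewrite -(mulr0 K); apply: cvgM; [exact: cvg_cst|exact: cvg_harmonic_real].
have := @cftc_line _ f F 0 0 cf dF fi.
rewrite subr0 /f (cintegralD i1 (cintZl _ i0)) (cintegralZl _ i0) => h.
apply/eqP; rewrite mulNr -addr_eq0; apply/eqP; apply: h.
- by apply: (ccvg_bound _ K_cvg) => n; rewrite subr0; exact: FK.
- by apply: (ccvg_bound _ K_cvg) => n; rewrite subr0; apply: FK; rewrite sqrrN.
Qed.

Definition moment_const k : R := 2 * \int[mu]_u `|gexp_poly (iter k deriv_poly 1) u|.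

Lemma gexp_hat_decay_pow k xi : `|xi| ^+ k * normc (gexp_hat 1 xi) <= moment_const k.
Proof.
have -> : `|xi| ^+ k * normc (gexp_hat 1 xi) = normc (cintegral mu
    (fun u => (gexp_poly (iter k deriv_poly 1) u)%:C * cis (xi * u))).
  elim: k => [|k IH].
    rewrite expr0 mul1r; congr normc; apply: eq_cintegral => u.
    by rewrite /gexp_poly /= hornerC mul1r.
  rewrite iterS gexp_poly_hat_deriv normcM -IH exprS -mulrA.
  by rewrite normcN normcM normc_i mul1r normc_real.
apply: cintegral_norm; first exact: cmeas_gexp_poly_cis.
  exact: (integrable_norm (rint_gexp_poly _)).
by move=> u; rewrite normc_gexp_poly_cis.
Qed.

(** Orders 0 and 2 control (1 + xi^2) times the transform; orders 1 and 3 do the same for |xi| times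
    the transform. *)
Definition decay_const : R :=
  moment_const 0 + moment_const 1 + moment_const 2 + moment_const 3.

Lemma moment_const_ge0 k : 0 <= moment_const k.
Proof. by rewrite mulr_ge0// Rintegral_ge0. Qed.

Lemma decay_const_ge0 : 0 <= decay_const.
Proof. by rewrite !addr_ge0// moment_const_ge0. Qed.

Lemma gexp_hat_decay xi : normc (gexp_hat 1 xi) <= decay_const * (1 + xi ^+ 2)^-1 /\
  `|xi| * normc (gexp_hat 1 xi) <= decay_const * (1 + xi ^+ 2)^-1.
Proof.
have p : 0 < 1 + xi ^+ 2 by rewrite ltr_pwDl ?sqr_ge0.
have h0 := gexp_hat_decay_pow 0 xi; have h1 := gexp_hat_decay_pow 1 xi.
have h2 := gexp_hat_decay_pow 2 xi; have h3 := gexp_hat_decay_pow 3 xi.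
have m0 := moment_const_ge0 0; have m1 := moment_const_ge0 1.
have m2 := moment_const_ge0 2; have m3 := moment_const_ge0 3.
rewrite expr0 mul1r in h0; rewrite expr1 in h1.
rewrite !ler_pdivlMr// -[xi ^+ 2]real_normK ?num_real// /decay_const.
move: h0 h1 h2 h3; set a := `|xi|; set b := normc _ => h0 h1 h2 h3.
have e2 : b * (1 + a ^+ 2) = b + a ^+ 2 * b by ring.
have e3 : a * b * (1 + a ^+ 2) = a * b + a ^+ 3 * b by ring.
by rewrite e2 e3; split; lra.
Qed.

(** Self-similarity, by the substitution u -> s u. Writing time as s^-N keeps N-th roots out of the
    estimates. *)
Lemma gexp_hat_scale s xi : 0 < s -> gexp_hat (s ^- N) xi = s%:C * gexp_hat 1 (s * xi).
Proof.
move=> s0; have sN0 : 0 < s ^- N by rewrite invr_gt0 exprn_gt0.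
have e u : gexp (s ^- N) (0 + s * u) = gexp 1 u.
  by rewrite /gexp add0r exprMn mulrA mulVf ?mul1r// expf_neq0// lt0r_neq0.
rewrite /gexp_hat (cintegral_affine 0 (lt0r_neq0 s0) (cint_gexp_cis xi sN0)).
rewrite (gtr0_norm s0); apply: (congr1 (fun z : C => s%:C * z)).
by apply: eq_cintegral => u; rewrite e add0r mulrCA mulrA.
Qed.

(** A multiple of the Cauchy density of scale 1/s, so its integral does not depend on s. *)
Definition kernel_bound (s y : R) : R :=
  (2 * pi)^-1 * (s * (decay_const * (1 + (s * y) ^+ 2)^-1)).

Lemma kernel_le (s xi : R) : 0 < s -> normc (kernel N (s ^- N) xi) <= kernel_bound s xi.
Proof.
move=> s0; have sN0 : 0 < s ^- N by rewrite invr_gt0 exprn_gt0.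
have p0 : 0 <= (2 * pi)^-1 :> R by rewrite invr_ge0 mulr_ge0// pi_ge0.
rewrite kernelE// normcM normc_real_ge0// ler_wpM2l//.
by rewrite gexp_hat_scale// normcM (normc_real_ge0 (ltW s0)) ler_wpM2l ?(gexp_hat_decay _).1// ltW.
Qed.

(** At time t = s^-N the factor s^-1 is t^(1/N); it is the source of the rate in [psi_sub1]. *)
Lemma kernel_moment_le (s xi : R) : 0 < s ->
  `|xi| * normc (kernel N (s ^- N) xi) <= s^-1 * kernel_bound s xi.
Proof.
move=> s0; have sN0 : 0 < s ^- N by rewrite invr_gt0 exprn_gt0.
have p0 : 0 <= (2 * pi)^-1 :> R by rewrite invr_ge0 mulr_ge0// pi_ge0.
rewrite kernelE// normcM normc_real_ge0// gexp_hat_scale// normcM (normc_real_ge0 (ltW s0)).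
have [_ h] := gexp_hat_decay (s * xi).
rewrite normrM (gtr0_norm s0) in h.
rewrite /kernel_bound mulrCA [leRHS]mulrCA (ler_wpM2l p0)// mulKf ?lt0r_neq0//.
by rewrite mulrCA mulrA.
Qed.

Lemma integral_kernel_bound s : 0 < s ->
  rint mu (kernel_bound s) /\ \int[mu]_y kernel_bound s y = decay_const / 2.
Proof.
move=> s0; have sn := lt0r_neq0 s0; have [ic ec] := @integral_cauchy R.
have ia : rint mu (fun y => (1 + (s * y) ^+ 2)^-1).
  by have := rint_affine 0 sn ic; under eq_fun do rewrite add0r.
split; first by do 3 apply: rintZl.
rewrite /kernel_bound RintegralZl//; last by do 2 apply: rintZl.
rewrite RintegralZl//; last exact: rintZl.
rewrite RintegralZl//.
have := Rintegral_affine 0 sn ic; rewrite ec gtr0_norm//.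
under eq_Rintegral do rewrite add0r.
move=> e; have pn : pi != 0 :> R by rewrite gt_eqF// pi_gt0.
transitivity ((2 * pi)^-1 * decay_const * (s * \int[mu]_x (1 + (s * x) ^+ 2)^-1)); first ring.
by rewrite -e; move: (pi : R) pn => p pn; field.
Qed.

Definition root_scale (t : R) : R := t `^ (- N%:R^-1).

Lemma root_scale_gt0 t : 0 < t -> 0 < root_scale t.
Proof. exact: powR_gt0. Qed.

Lemma root_scaleK t : 0 < t -> root_scale t ^- N = t.
Proof.
move=> t0; rewrite -powR_mulrn ?powR_ge0// -powRrM mulNr mulVf ?pnatr_eq0 -?lt0n ?N_gt0//.
by rewrite powR_inv1 ?invrK// ltW.
Qed.

Lemma cmeas_kernel_param : cmeas ((fun z => ((2 * pi)^-1)%:C * gexp_hat z.1 z.2) : T * T -> C).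
Proof.
apply: cmeasM; first exact: cmeas_cst.
apply: (@cmeas_cintegral_param _ _ _ T R mu
  (fun w : T * T * T => (gexp w.1.1 w.2)%:C * cis (w.1.2 * w.2))).
apply: cmeasM.
  apply/cmeas_real/(measurableT_comp (@measurable_expR R))/measurableT_comp => //.
  apply: measurable_funM; first exact: measurableT_comp.
  by apply: measurable_funX; exact: measurable_snd.
apply: cmeas_cis; apply: measurable_funM; last exact: measurable_snd.
exact: measurableT_comp.
Qed.

Lemma cmeas_kernel (t : R) : 0 < t -> cmeas (kernel N t : T -> C).
Proof.
move=> t0; have := cmeas_comp cmeas_kernel_param (pair1_measurable (t : T)).
by congr cmeas; apply/funext => y; rewrite /= kernelE.
Qed.

Lemma cint_kernel (t : R) : 0 < t -> cint mu (kernel N t).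
Proof.
move=> t0; have s0 := root_scale_gt0 t0.
apply: (cint_le (cmeas_kernel t0) (integral_kernel_bound s0).1) => y.
by rewrite -{1}(root_scaleK t0) kernel_le.
Qed.

(** The kernel is the transform of [gexp t] divided by 2 pi, so this is Fourier inversion at - x
    followed by evenness of [gexp t]. *)
Lemma kernel_inversion (t x : R) : 0 < t ->
  cintegral mu (fun y => kernel N t y * cis (x * y)) = (gexp t x)%:C.
Proof.
move=> t0; have s0 := root_scale_gt0 t0.
have p0 : 0 < 2 * pi :> R by rewrite mulr_gt0// pi_gt0.
have pC : (2 * pi)%:C != 0 :> C by rewrite Real_eq0 gt_eqF.
have inv := @fourier_inversion R (fun u => (gexp t u)%:C)
  (fun y => 2 * pi * kernel_bound (root_scale t) y) 1 (- x).
have gh u : cintegral mu (fun y => (gexp t y)%:C * cis (u * y)) = (2 * pi)%:C * kernel N t u.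
  by rewrite kernelE// mulrA -RealM mulfV ?gt_eqF// Real1 mul1r.
have i1 : cint mu (fun y => kernel N t y * cis (x * y)).
  apply: (cint_le _ (cint_normc (cint_kernel t0))) => [|y].
    by apply: cmeasM; [exact: cmeas_kernel|exact: cmeas_cis_scale].
  by rewrite normcM normc_cis mulr1.
apply: (mulfI pC); rewrite -cintegralZl// -gexpN -inv.
- by apply: eq_cintegral => u; rewrite gh mulrN opprK mulrA [u * x]mulrC.
- by split; [exact: continuous_gexp|move=> u; exact: cvg_cst].
- by split; [exact: rint_gexp|exact: rint0].
- by move=> y; rewrite normc_real_ge0 ?gexp_ge0// gexp_le1// ltW.
- by apply: rintZl; exact: (integral_kernel_bound s0).1.
- move=> u; rewrite gh normcM (normc_real_ge0 (ltW p0)) (ler_wpM2l (ltW p0))//.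
  by rewrite -{1}(root_scaleK t0) kernel_le.
Qed.

(** Expand the second kernel as a Fourier integral and exchange: the integral over y is given by
    [kernel_inversion], and the symbols multiply by [gexpD]. *)
Lemma kernel_semigroup (s t x : R) : 0 < s -> 0 < t ->
  cintegral mu (fun y => kernel N s y * kernel N t (x - y)) = kernel N (s + t) x.
Proof.
move=> s0 t0; have st0 : 0 < s + t by rewrite addr_gt0.
have ks := cint_kernel s0.
pose F (z : T * T) : C := kernel N s z.1 * ((gexp t z.2)%:C * cis ((x - z.1) * z.2)).
have [|||||_ q1 q2 i4] := @cfubini _ _ T T _ mu mu F
    (fun y u => normc (kernel N s y) * gexp t u)
    (fun y => (\int[mu]_u gexp t u) * normc (kernel N s y)) _ _ _ _ _.
- apply: cmeasM; first exact: (cmeas_comp (cmeas_kernel s0)).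
  apply: cmeasM.
    by apply/cmeas_real; exact: (measurableT_comp (measurable_gexp t)).
  by apply: cmeas_cis; apply: measurable_funM => //; exact: measurable_funB.
- by move=> y; apply: rintZl; exact: rint_gexp.
- by move=> y u; rewrite /F /= normcM normc_gexp_cis.
- by apply: rintZl; exact: cint_normc.
- by move=> y; rewrite RintegralZl//; [rewrite [leLHS]mulrC|exact: rint_gexp].
have ck (y u : R) : 0 < u -> cint mu (fun v => (gexp u v)%:C * cis (y * v)).
  by move=> u0; exact: cint_gexp_cis.
transitivity (((2 * pi)^-1)%:C * cintegral mu (fun y => cintegral mu (fun u => F (y, u)))).
  rewrite -cintegralZl//; apply: eq_cintegral => y.
  by rewrite (kernelE (x - y) t0) mulrCA; congr (_ * _); rewrite /F /= cintegralZl//; exact: ck.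
rewrite (kernelE x st0) -q1 q2; congr (_ * _); apply: eq_cintegral => u; rewrite /F /=.
transitivity (((gexp t u)%:C * cis (x * u)) * cintegral mu (fun y => kernel N s y * cis (- u * y))).
  rewrite -cintegralZl; last first.
    apply: (cint_le _ (cint_normc ks)) => [|y].
      by apply: cmeasM; [exact: cmeas_kernel|exact: cmeas_cis_scale].
    by rewrite normcM normc_cis mulr1.
  apply: eq_cintegral => y.
  by rewrite mulrBl cisD mulNr [u * y]mulrC; ring.
by rewrite kernel_inversion// gexpN gexpD RealM; ring.
Qed.

End heat_kernel.

(** * Spitzer's identity for complex densities *)

Section spitzer.
Context {R : realType}.
Local Notation mu := (@lebesgue_measure R).
Local Notation T := (measurableTypeR R).
Local Notation C := R[i].

Lemma cint_mul_bounded (a f : T -> C) (B : R) : cint mu a -> cmeas f ->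
  (forall x, normc (f x) <= B) -> cint mu (fun x => a x * f x).
Proof.
move=> ia mf fB; apply: (cint_le _ (rintZl B (cint_normc ia))).
  by apply: cmeasM => //; exact: cint_cmeas ia.
by move=> x; rewrite normcM mulrC ler_wpM2r// normc_ge0.
Qed.

Lemma cintegral_mul_bound (a f : T -> C) (B : R) : cint mu a -> cmeas f ->
  (forall x, normc (f x) <= B) ->
  normc (cintegral mu (fun x => a x * f x)) <= 2 * (\int[mu]_x normc (a x)) * B.
Proof.
move=> ia mf fB; have ina := cint_normc ia.
rewrite -mulrA [X in _ <= 2 * X]mulrC -RintegralZl//; apply: cintegral_norm.
- by apply: cmeasM => //; exact: cint_cmeas ia.
- exact: rintZl.
- by move=> x; rewrite normcM mulrC ler_wpM2r// normc_ge0.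
Qed.

Lemma cfubini_weighted (a b : T -> C) (f : T * T -> C) (B : R) :
  cint mu a -> cint mu b -> cmeas f -> (forall z, normc (f z) <= B) ->
  cintegral mu (fun y => a y * cintegral mu (fun w => b w * f (y, w))) =
  cintegral mu (fun w => b w * cintegral mu (fun y => a y * f (y, w))).
Proof.
move=> ia ib mf fB; have B0 : 0 <= B := le_trans (normc_ge0 _) (fB (0, 0)).
pose F (z : T * T) : C := a z.1 * (b z.2 * f z).
have [|||||_ q1 q2 _] := @cfubini _ _ T T _ mu mu F
    (fun y w => B * normc (a y) * normc (b w))
    (fun y => B * (\int[mu]_w normc (b w)) * normc (a y)) _ _ _ _ _.
- apply: cmeasM; first exact: (cmeas_comp (cint_cmeas ia)).
  by apply: cmeasM => //; exact: (cmeas_comp (cint_cmeas ib)).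
- by move=> y; apply: rintZl; exact: cint_normc.
- move=> y w; rewrite /F /= 2!normcM mulrA [leLHS]mulrC -mulrA.
  by rewrite ler_wpM2r// mulr_ge0// normc_ge0.
- by apply: rintZl; exact: cint_normc.
- by move=> y; rewrite RintegralZl//; [rewrite [leRHS]mulrAC|exact: cint_normc].
have sec1 y : cmeas (fun w => f (y, w)) by exact: (cmeas_comp mf (pair1_measurable y)).
have sec2 w : cmeas (fun y => f (y, w)) by exact: (cmeas_comp mf (pair2_measurable w)).
transitivity (cintegral mu (fun y => cintegral mu (fun w => F (y, w)))).
  apply: eq_cintegral => y; rewrite /F /= cintegralZl//.
  by apply: (cint_mul_bounded (B := B)).
rewrite -q1 q2; apply: eq_cintegral => w; rewrite /F /= -cintegralZl//.
  by apply: eq_cintegral => y; rewrite mulrCA.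
by apply: (cint_mul_bounded (B := B)).
Qed.

Definition pos (y : R) : R := Num.max 0 y.

Lemma pos_ge0 y : 0 <= pos y.
Proof. by rewrite /pos le_max lexx. Qed.

Lemma pos_id y : 0 <= y -> pos y = y.
Proof. by move=> y0; rewrite /pos max_r. Qed.

Lemma pos_eq0 y : y <= 0 -> pos y = 0.
Proof. by move=> y0; rewrite /pos max_l. Qed.

Lemma measurable_pos d (S : measurableType d) (h : S -> R) : measurable_fun setT h ->
  measurable_fun setT (fun x => pos (h x)).
Proof. by move=> mh; apply: measurable_maxr. Qed.

(* The algebraic core of Spitzer's identity: taking positive parts is a
   Rota-Baxter operator on the convolution algebra. *)
Lemma pos_rota_baxter (g : R -> C) y v :
  g (pos y + pos v) = g (pos (y + pos v)) + g (pos (pos y + v)) - g (pos (y + v)).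
Proof.
have [y0|y0] := leP 0 y.
  rewrite (pos_id y0) [pos (y + pos v)]pos_id ?addr_ge0 ?pos_ge0//.
  by rewrite addrK.
rewrite [pos y]pos_eq0 ?(ltW y0)// !add0r.
suff -> : pos (y + pos v) = pos (y + v) by rewrite addrAC subrr add0r.
have [v0|v0] := leP 0 v; first by rewrite (pos_id v0).
rewrite [pos v]pos_eq0 ?(ltW v0)// addr0 pos_eq0 ?(ltW y0)// pos_eq0//.
by rewrite ltW// -[0]addr0 ltrD.
Qed.

(* q j is the density of the walk after j + 1 steps, with respect to a
   possibly complex weight; run_max k is the weighted law of the maximum
   of 0 and the first k positions, as a linear form. *)
Variable q : nat -> R -> C.
Hypothesis cint_q : forall j, cint mu (q j).
Variable Q : R.
Hypothesis q0_bound : forall x, normc (q 0 x) <= Q.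
Hypothesis q_semigroup : forall j x,
  cintegral mu (fun y => q j y * q 0 (x - y)) = q j.+1 x.

(** First-step decomposition: if w is the first step and z the maximum of 0 and the later positions
    counted from w, then the whole maximum is [pos (w + z)]. *)
Fixpoint run_max (k : nat) (g : R -> C) : C :=
  match k with
  | 0%N => g 0
  | k'.+1 => cintegral mu (fun w => q 0 w * run_max k' (fun z => g (pos (w + z))))
  end.

Definition step_norm : R := 2 * \int[mu]_x normc (q 0 x).

Lemma eq_run_max k (g g' : R -> C) : (forall z, 0 <= z -> g z = g' z) ->
  run_max k g = run_max k g'.
Proof.
case: k => [|k] gg /=; first exact: gg.
apply: eq_cintegral => w; congr (_ * run_max _ _).
by apply/funext => z; rewrite gg ?pos_ge0.
Qed.

(** The parameter space must be arbitrary, since each step of the induction adjoins one real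
    coordinate to it. *)
Lemma run_max_param k : forall d (S : measurableType d) (G : S * T -> C) B,
  cmeas G -> (forall z, normc (G z) <= B) ->
  cmeas (fun s => run_max k (fun z => G (s, z))) /\
  forall s, normc (run_max k (fun z => G (s, z))) <= step_norm ^+ k * B.
Proof.
elim: k => [|k IH] d S G B mG GB.
  split; first exact: (cmeas_comp mG (pair2_measurable (0 : T))).
  by move=> s; rewrite expr0 mul1r; exact: GB.
pose G' (z : S * T * T) : C := G (z.1.1, pos (z.1.2 + z.2)).
have mG' : cmeas G'.
  apply: (cmeas_comp mG); apply: measurable_fun_pair.
    by apply: measurableT_comp; [exact: measurable_fst|exact: measurable_fst].
  apply: measurable_pos; apply: measurable_funD; last exact: measurable_snd.
  by apply: measurableT_comp; [exact: measurable_snd|exact: measurable_fst].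
have [mI bI] := IH _ _ G' B mG' (fun z => GB _).
split.
  apply: (@cmeas_cintegral_param _ _ S T R mu (fun z => q 0 z.2 *
    run_max k (fun t => G' (z, t)))).
  by apply: cmeasM => //; exact: (cmeas_comp (cint_cmeas (cint_q 0))).
move=> s; rewrite exprS -mulrA [run_max _ _]/=.
have := @cintegral_mul_bound (q 0) (fun w => run_max k (fun t => G' ((s, w), t))) (step_norm ^+ k * B).
apply => //.
exact: (cmeas_comp mI (pair1_measurable s)).
Qed.

Definition bounded_by (B : R) (g : R -> C) :=
  cmeas (g : T -> C) /\ forall x, normc (g x) <= B.

Lemma bounded_by_shift B g w : bounded_by B g -> bounded_by B (fun z => g (pos (w + z))).
Proof.
move=> [mg gB]; split=> //; apply: (cmeas_comp mg).
by apply: measurable_pos; exact: measurable_funD.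
Qed.

Lemma run_max_kernel k B g : bounded_by B g ->
  cmeas (fun w : T => run_max k (fun z => g (pos (w + z)))) /\
  forall w, normc (run_max k (fun z => g (pos (w + z)))) <= step_norm ^+ k * B.
Proof.
move=> [mg gB].
apply: (run_max_param k (G := fun z : T * T => g (pos (z.1 + z.2))) (B := B)) => //.
by apply: (cmeas_comp mg); apply: measurable_pos; exact: measurable_funD.
Qed.

Lemma cint_run_max j k B g : bounded_by B g ->
  cint mu (fun w => q j w * run_max k (fun z => g (pos (w + z)))).
Proof.
by move=> /(run_max_kernel k)[m b]; exact: (cint_mul_bounded (cint_q j) m b).
Qed.

Lemma run_maxD k : forall B g B' g', bounded_by B g -> bounded_by B' g' ->
  run_max k (fun z => g z + g' z) = run_max k g + run_max k g'.
Proof.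
elim: k => [//|k IH] B g B' g' bg bg' /=.
rewrite -cintegralD; [|exact: cint_run_max bg|exact: cint_run_max bg'].
apply: eq_cintegral => w; rewrite -mulrDr; congr (_ * _).
exact: (IH B _ B' _ (bounded_by_shift w bg) (bounded_by_shift w bg')).
Qed.

Lemma run_maxZ k (c : C) : forall B g, bounded_by B g ->
  run_max k (fun z => c * g z) = c * run_max k g.
Proof.
elim: k => [//|k IH] B g bg /=.
rewrite -cintegralZl; last exact: cint_run_max bg.
apply: eq_cintegral => w; rewrite mulrCA; congr (_ * _).
exact: (IH B _ (bounded_by_shift w bg)).
Qed.

(** The weighted law of pos Y + Z, where Y has density [q j] and Z is an independent maximum over i
    steps; [pos_conv] is that of pos (Y + Z). *)
Definition conv (j i : nat) (g : R -> C) : C :=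
  cintegral mu (fun y => q j y * run_max i (fun z => g (pos y + z))).

Definition pos_conv (j i : nat) (g : R -> C) : C :=
  cintegral mu (fun y => q j y * run_max i (fun z => g (pos (y + z)))).

(** Substitute x = y + w and exchange the integrals; the inner one is then [q_semigroup]. *)
Lemma integral_convolution j (m : T -> C) B : cmeas m -> (forall x, normc (m x) <= B) ->
  cintegral mu (fun y => q j y * cintegral mu (fun w => q 0 w * m (y + w))) =
  cintegral mu (fun x => q j.+1 x * m x).
Proof.
move=> mm mB; have B0 : 0 <= B := le_trans (normc_ge0 _) (mB 0).
have n1 : (1 : R) != 0 := oner_neq0 R.
have q0m := cint_mul_bounded (cint_q 0).
have shift y : cint mu (fun x => q 0 (x - y)).
  have := cint_affine (- y) n1 (cint_q 0).
  by under eq_fun do rewrite mul1r addrC.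
pose F (z : T * T) : C := q j z.1 * (q 0 (z.2 - z.1) * m z.2).
have [|||||_ p1 p2 _] := @cfubini _ _ T T _ mu mu F
    (fun y x => B * normc (q j y) * normc (q 0 (x - y)))
    (fun y => B * (\int[mu]_w normc (q 0 w)) * normc (q j y)) _ _ _ _ _.
- apply: cmeasM; first exact: (cmeas_comp (cint_cmeas (cint_q j))).
  apply: cmeasM; last exact: (cmeas_comp mm).
  by apply: (cmeas_comp (cint_cmeas (cint_q 0))); exact: measurable_funB.
- by move=> y; apply: rintZl; exact: (cint_normc (shift y)).
- move=> y x; rewrite /F /= 2!normcM mulrA [leLHS]mulrC -mulrA.
  by rewrite ler_wpM2r// mulr_ge0// normc_ge0.
- by apply: rintZl; exact: cint_normc.
- move=> y; rewrite RintegralZl//; last exact: (cint_normc (shift y)).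
  rewrite (Rintegral_affine y n1 (cint_normc (shift y))) normr1 mul1r.
  under eq_Rintegral do rewrite mul1r addrAC subrr add0r.
  by rewrite [leRHS]mulrAC.
transitivity (cintegral mu (fun y => cintegral mu (fun x => F (y, x)))).
  have iF y : cint mu (fun x => q 0 (x - y) * m x).
    exact: (cint_mul_bounded (shift y) mm mB).
  apply: eq_cintegral => y; rewrite /F /= cintegralZl//; congr (_ * _).
  rewrite (cintegral_affine y n1 (iF y)) normr1 Real1 mul1r.
  by apply: eq_cintegral => w; rewrite mul1r addrAC subrr add0r.
rewrite -p1 p2; apply: eq_cintegral => x; rewrite /F /= -q_semigroup.
have iq : cint mu (fun y => q j y * q 0 (x - y)).
  apply: (cint_mul_bounded (cint_q j) _ (fun y => q0_bound (x - y))).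
  by apply: (cmeas_comp (cint_cmeas (cint_q 0))); exact: measurable_funB.
by rewrite -cintegralZr//; apply: eq_cintegral => y; rewrite mulrA.
Qed.

Lemma conv0 j g : conv j 0 g = pos_conv j 0 g.
Proof. by apply: eq_cintegral => y /=; rewrite !addr0. Qed.

(** Peeling the first step w off the maximum gives the integrand g (pos y + pos (w + t));
    [pos_rota_baxter] with v = w + t splits it into three terms, each again an integral of the same
    type. *)
Lemma conv_rota_baxter j i B g : bounded_by B g ->
  conv j i.+1 g = pos_conv j i.+1 g - pos_conv j.+1 i g +
    cintegral mu (fun w => q 0 w * conv j i (fun z => g (pos (w + z)))).
Proof.
move=> bg; have [mg gB] := bg.
pose M (h : R -> R -> R -> R) (z : T * T) : C := run_max i (fun t => g (h z.1 z.2 t)).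
have MP (h : R -> R -> R -> R) :
    measurable_fun setT (fun z : T * T * T => h z.1.1 z.1.2 z.2) ->
    cmeas (M h) /\ forall z, normc (M h z) <= step_norm ^+ i * B.
  move=> mh; apply: (run_max_param i (G := fun z : T * T * T => g (h z.1.1 z.1.2 z.2))) => //.
  exact: (cmeas_comp mg).
have m11 : measurable_fun setT (fun z : T * T * T => z.1.1).
  by apply: measurableT_comp; [exact: measurable_fst|exact: measurable_fst].
have m12 : measurable_fun setT (fun z : T * T * T => z.1.2).
  by apply: measurableT_comp; [exact: measurable_snd|exact: measurable_fst].
have m2 : measurable_fun setT (fun z : T * T * T => z.2) by exact: measurable_snd.
pose h0 (y w t : R) := pos y + pos (w + t).
pose h1 (y w t : R) := pos (y + pos (w + t)).
pose h2 (y w t : R) := pos (pos y + (w + t)).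
pose h3 (y w t : R) := pos (y + (w + t)).
have mwt : measurable_fun setT (fun z : T * T * T => z.1.2 + z.2) by exact: measurable_funD.
have [n0 b0] := MP h0 (measurable_funD (measurable_pos m11) (measurable_pos mwt)).
have [n1 b1] := MP h1 (measurable_pos (measurable_funD m11 (measurable_pos mwt))).
have [n2 b2] := MP h2 (measurable_pos (measurable_funD (measurable_pos m11) mwt)).
have [n3 b3] := MP h3 (measurable_pos (measurable_funD m11 mwt)).
have bh (h : R -> R -> R -> R) (y w : R) :
    measurable_fun setT (fun z : T * T * T => h z.1.1 z.1.2 z.2) ->
    bounded_by B (fun t => g (h y w t)).
  move=> mh; split=> //; apply: (cmeas_comp mg).
  exact: (measurableT_comp mh (pair1_measurable ((y, w) : T * T))).
have split_M y w : M h0 (y, w) = M h1 (y, w) + M h2 (y, w) - M h3 (y, w).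
  rewrite /M /= -[- run_max _ _]mulN1r.
  have bb1 := bh h1 y w (measurable_pos (measurable_funD m11 (measurable_pos mwt))).
  have bb2 := bh h2 y w (measurable_pos (measurable_funD (measurable_pos m11) mwt)).
  have bb3 := bh h3 y w (measurable_pos (measurable_funD m11 mwt)).
  rewrite -(run_maxZ i (-1) bb3) -(run_maxD i bb1 bb2).
  have bb12 : bounded_by (B + B) (fun t => g (h1 y w t) + g (h2 y w t)).
    split; first by apply: cmeasD; [exact: bb1.1|exact: bb2.1].
    by move=> x; rewrite (le_trans (le_normcD _ _))// lerD.
  have bb3' : bounded_by B (fun t => -1 * g (h3 y w t)).
    split; first by apply: cmeasM; [exact: cmeas_cst|exact: bb3.1].
    by move=> x; rewrite normcM normcN normc1 mul1r.
  rewrite -(run_maxD i bb12 bb3'); apply: eq_run_max => t _.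
  by rewrite mulN1r; exact: pos_rota_baxter.
pose I h := cintegral mu (fun y => q j y * cintegral mu (fun w => q 0 w * M h (y, w))).
have sec h y : cmeas (M h) -> cmeas (fun w => M h (y, w)).
  by move=> mh; exact: (cmeas_comp mh (pair1_measurable (y : T))).
have in_int h y : cmeas (M h) -> (forall z, normc (M h z) <= step_norm ^+ i * B) ->
    cint mu (fun w => q 0 w * M h (y, w)).
  by move=> mh hb; exact: (cint_mul_bounded (cint_q 0) (sec h y mh) (fun w => hb (y, w))).
have out_int h : cmeas (M h) -> (forall z, normc (M h z) <= step_norm ^+ i * B) ->
    cint mu (fun y => q j y * cintegral mu (fun w => q 0 w * M h (y, w))).
  move=> mh hb.
  apply: (cint_mul_bounded (B := step_norm * (step_norm ^+ i * B)) (cint_q j)).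
    apply: (@cmeas_cintegral_param _ _ T T R mu (fun z => q 0 z.2 * M h z)).
    by apply: cmeasM => //; exact: (cmeas_comp (cint_cmeas (cint_q 0))).
  by move=> y; exact: (cintegral_mul_bound (cint_q 0) (sec h y mh) (fun w => hb (y, w))).
have eI : conv j i.+1 g = I h1 + I h2 - I h3.
  have [e1 e2 e3] := And3 (out_int _ n1 b1) (out_int _ n2 b2) (out_int _ n3 b3).
  rewrite /I -(cintegralD e1 e2) -(cintegralB (cintD e1 e2) e3).
  apply: eq_cintegral => y; rewrite -mulrDr -mulrBr; congr (_ * _).
  have [i1 i2 i3] := And3 (in_int _ y n1 b1) (in_int _ y n2 b2) (in_int _ y n3 b3).
  rewrite -(cintegralD i1 i2) -(cintegralB (cintD i1 i2) i3).
  apply: eq_cintegral => w; rewrite -mulrDr -mulrBr; congr (_ * _).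
  by rewrite -split_M.
have I1 : I h1 = pos_conv j i.+1 g by [].
(* The argument is w + (pos y + t), so once Fubini has moved w outside, the y-integral is a [conv]
   of the shifted function. *)
have I2 : I h2 = cintegral mu (fun w => q 0 w * conv j i (fun z => g (pos (w + z)))).
  rewrite /I (cfubini_weighted (cint_q j) (cint_q 0) n2 b2).
  apply: eq_cintegral => w; apply: (congr1 (fun z : C => q 0 w * z)).
  apply: eq_cintegral => y; apply: (congr1 (fun z : C => q j y * z)).
  by apply: eq_run_max => t _; rewrite /h2 /= addrCA.
(* Here y and w occur only through y + w, whose density is [q j.+1]: one step has moved from the
   maximum to Y. *)
have I3 : I h3 = pos_conv j.+1 i g.
  have [mm mb] := run_max_kernel i bg.
  rewrite /I /pos_conv -(integral_convolution j mm mb).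
  apply: eq_cintegral => y; apply: (congr1 (fun z : C => q j y * z)).
  apply: eq_cintegral => w; apply: (congr1 (fun z : C => q 0 w * z)).
  by apply: eq_run_max => t _; rewrite /h3 /= addrA.
by rewrite eI I1 I2 I3 addrAC.
Qed.

Lemma cint_conv_shift j i B g : bounded_by B g ->
  cint mu (fun w => q 0 w * conv j i (fun z => g (pos (w + z)))).
Proof.
move=> [mg gB].
have [] := @run_max_param i _ (T * T)%type
  (fun z : T * T * T => g (pos (z.1.1 + (pos z.1.2 + z.2)))) B.
- apply: (cmeas_comp mg); apply: measurable_pos; apply: measurable_funD.
    by apply: measurableT_comp; [exact: measurable_fst|exact: measurable_fst].
  apply: measurable_funD; last exact: measurable_snd.
  apply: measurable_pos.
  by apply: measurableT_comp; [exact: measurable_snd|exact: measurable_fst].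
- by move=> z; exact: gB.
move=> mI bI.
apply: (cint_mul_bounded (B := 2 * (\int[mu]_x normc (q j x)) * (step_norm ^+ i * B)) (cint_q 0)).
  apply: (@cmeas_cintegral_param _ _ T T R mu (fun z => q j z.2 *
    run_max i (fun t => g (pos (z.1 + (pos z.2 + t)))))).
  by apply: cmeasM => //; exact: (cmeas_comp (cint_cmeas (cint_q j))).
move=> w; apply: (@cintegral_mul_bound (q j)
  (fun y => run_max i (fun t => g (pos (w + (pos y + t)))))) => //.
  exact: (cmeas_comp mI (pair1_measurable (w : T))).
by move=> y; exact: (bI (w, y)).
Qed.

(** Apply [conv_rota_baxter] to all summands but the last. The [pos_conv] terms telescope: one end
    is [run_max k.+2 g], the other cancels the last summand. What remains is the induction
    hypothesis for the shifted functions g (pos (w + z)), which is why g is quantified inside the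
    induction. *)
Theorem spitzer_identity k : forall B g, bounded_by B g ->
  k.+1%:R * run_max k.+1 g = \sum_(j < k.+1) conv j (k - j) g.
Proof.
elim: k => [|k IH] B g bg; first by rewrite big_ord1 subnn mul1r conv0.
have bs w := bounded_by_shift w bg.
have eB : \sum_(j < k.+1) cintegral mu (fun w => q 0 w * conv j (k - j) (fun z => g (pos (w + z))))
    = k.+1%:R * run_max k.+2 g.
  rewrite -cintegral_sum; last by move=> j; exact: cint_conv_shift bg.
  transitivity (k.+1%:R * cintegral mu (fun w => q 0 w * run_max k.+1 (fun z => g (pos (w + z))))).
    rewrite -cintegralZl; last exact: (cint_run_max 0 k.+1 bg).
    by apply: eq_cintegral => w; rewrite -mulr_sumr -(IH _ _ (bs w)) mulrCA.
  by [].
have tele : \sum_(j < k.+1) (pos_conv j (k - j).+1 g - pos_conv j.+1 (k - j) g) =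
    pos_conv 0 k.+1 g - pos_conv k.+1 0 g.
  pose u i := - pos_conv i (k.+1 - i) g.
  rewrite (eq_bigr (fun j : 'I_k.+1 => u j.+1 - u j)); last first.
    by move=> j _; rewrite /u subSS opprK addrC subSn// -ltnS.
  rewrite -(big_mkord xpredT (fun i => u i.+1 - u i)) telescope_sumr// /u subnn subn0.
  by rewrite opprK addrC.
rewrite big_ord_recr [X in _ = X]/= subnn conv0.
rewrite (eq_bigr (fun j : 'I_k.+1 => (pos_conv j (k - j).+1 g - pos_conv j.+1 (k - j) g) +
    cintegral mu (fun w => q 0 w * conv j (k - j) (fun z => g (pos (w + z)))))); last first.
  move=> j _; have jk : (j <= k)%N by rewrite -ltnS.
  by rewrite (subSn jk) -(conv_rota_baxter _ _ bg).
rewrite big_split [X in _ = X]/= eB tele addrAC subrK.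
by rewrite -natr1 mulrDl mul1r addrC.
Qed.

End spitzer.

(** * Integration over tuples and running maxima *)

Section tuple_integral.
Context {R : realType}.
Local Notation mu := (@lebesgue_measure R).
Local Notation T := (measurableTypeR R).
Local Notation C := R[i].

Lemma Rintegral_cons k (f : k.+1.-tuple T -> R) : measurable_fun setT f ->
  rint (mu \x lebesgue_tuple k)%E (f \o @Defs.cons_tuple R k) ->
  rint (lebesgue_tuple k.+1) f /\
  \int[lebesgue_tuple k.+1]_w f w = \int[(mu \x lebesgue_tuple k)%E]_z f (Defs.cons_tuple z).
Proof.
move=> mf fi; have mfE : measurable_fun setT (EFin \o f) by exact/measurable_EFinP.
have mc := @measurable_cons_tuple R k.
pose nu := measure_function_pushforward__canonical__measure_function_Measure
  (mu \x lebesgue_tuple k)%E mc.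
have inu : nu.-integrable setT (EFin \o f) by exact: (integrable_pushforward mc mfE fi).
have e (g : k.+1.-tuple T -> \bar R) :
    (\int[lebesgue_tuple k.+1]_w g w = \int[nu]_w g w)%E by exact: eq_measure_integral.
split.
  apply/integrableP; split => //; rewrite e.
  by have /integrableP[] := inu.
by rewrite /Rintegral e (integral_pushforward mc mfE fi).
Qed.

Lemma cintegral_cons k (f : k.+1.-tuple T -> C) : cmeas f ->
  cint (mu \x lebesgue_tuple k)%E (f \o @Defs.cons_tuple R k) ->
  cint (lebesgue_tuple k.+1) f /\
  cintegral (lebesgue_tuple k.+1) f = cintegral (mu \x lebesgue_tuple k)%E (f \o @Defs.cons_tuple R k).
Proof.
move=> [mr mi] [ir ii].
have [r1 r2] := Rintegral_cons mr ir; have [i1 i2] := Rintegral_cons mi ii.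
by split; [split|apply: complexP].
Qed.

Lemma measurable_bigmax d (S : measurableType d) (I : Type) (s : seq I) (a : R)
    (f : I -> S -> R) : (forall i, measurable_fun setT (f i)) ->
  measurable_fun setT (fun x => \big[Num.max/a]_(i <- s) f i x).
Proof.
move=> mf; elim: s => [|i s IH].
  by under eq_fun do rewrite big_nil; exact: measurable_cst.
by under eq_fun do rewrite big_cons; exact: measurable_maxr.
Qed.

Lemma measurable_last k (x : R) : measurable_fun setT (fun w : k.-tuple T => last x w : R).
Proof.
case: k => [|k].
  rewrite (_ : (fun w => _) = fun=> x); first exact: measurable_cst.
  by apply/funext => w; rewrite tuple0.
rewrite (_ : (fun w => _) = fun w : k.+1.-tuple T => tnth w ord_max).
  exact: measurable_tnth.
apply/funext => w; rewrite (tnth_nth x) (last_nth x) size_tuple /=.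
by case: w => -[|a s].
Qed.

(** The first entry goes into the seed, so that the seed records the maximum over the past in the
    induction of [walk_extremum]. *)
Lemma bigmax_cons (a y : R) (f : R -> R) (s : seq R) :
  \big[Num.max/a]_(z <- y :: s) f z = \big[Num.max/Num.max a (f y)]_(z <- s) f z.
Proof.
rewrite big_cons; elim: s => [|b s IH]; first by rewrite !big_nil maxC.
by rewrite !big_cons maxCA IH.
Qed.

Lemma bigmax_ge_init (a : R) (f : R -> R) (s : seq R) : a <= \big[Num.max/a]_(z <- s) f z.
Proof.
elim: s => [|b s IH]; first by rewrite big_nil.
by rewrite big_cons le_max IH orbT.
Qed.

End tuple_integral.

(** * Path measures of walks with an even step density *)

Section random_walk.
Context {R : realType}.
Local Notation mu := (@lebesgue_measure R).
Local Notation T := (measurableTypeR R).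
Local Notation C := R[i].

Variable p : R -> C.
Hypothesis cint_p : cint mu p.
Hypothesis p_even : forall y, p (- y) = p y.

Definition path_density k (x : R) (w : k.-tuple R) : C :=
  \prod_(i < k) p (nth 0 (x :: w) i - tnth w i).

Definition walk_mean k (x : R) (F : k.-tuple R -> C) : C :=
  cintegral (lebesgue_tuple k) (fun w : k.-tuple T => F w * path_density x w).

Lemma path_density_cons k x (z : T * k.-tuple T) :
  path_density x (Defs.cons_tuple z) = p (x - z.1) * path_density z.1 z.2.
Proof.
rewrite /path_density big_ord_recl; congr (_ * _).
apply: eq_bigr => i _; congr (p (_ - _)).
by rewrite !(tnth_nth 0).
Qed.

Lemma cmeas_path_density k :
  cmeas (fun z : T * k.-tuple T => path_density z.1 z.2).
Proof.
apply: cmeas_prod => i; apply: (cmeas_comp (cint_cmeas cint_p)).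
apply: measurable_funB.
  case: i => -[|i] ik /=; first exact: measurable_fst.
  have ik' : (i < k)%N by exact: ltnW.
  rewrite (_ : (fun z => _) = (fun z : T * k.-tuple T => tnth z.2 (Ordinal ik'))).
    by apply: (measurableT_comp (measurable_tnth _)); exact: measurable_snd.
  by apply/funext => z; rewrite (tnth_nth 0).
by apply: (measurableT_comp (measurable_tnth _)); exact: measurable_snd.
Qed.

Lemma cmeas_path_density_from k x : cmeas (path_density x : k.-tuple T -> C).
Proof. exact: (cmeas_comp (cmeas_path_density k) (pair1_measurable (x : T))). Qed.

Lemma cint_p_from x : cint mu (fun y => p (x - y)).
Proof.
have n1 : (-1 : R) != 0 by rewrite oppr_eq0 oner_neq0.
by have := cint_affine x n1 cint_p; under eq_fun do rewrite mulN1r.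
Qed.

(** Substitute y = x + s w; evenness of p absorbs both the sign s and the order of the difference x
    - y. *)
Lemma cintegral_p_from x (f : R -> C) (s : R) : s = 1 \/ s = -1 ->
  cint mu (fun y => p (x - y) * f y) ->
  cintegral mu (fun y => p (x - y) * f y) = cintegral mu (fun w => p w * f (x + s * w)) /\
  cint mu (fun w => p w * f (x + s * w)).
Proof.
move=> s1 ci.
have s0 : s != 0 by case: s1 => ->; rewrite ?oppr_eq0 oner_neq0.
have n1 : `|s| = 1 by case: s1 => ->; rewrite ?normrN1 ?normr1.
have e w : p (x - (x + s * w)) * f (x + s * w) = p w * f (x + s * w).
  rewrite opprD addrA subrr add0r p_even; congr (_ * _).
  by case: s1 => ->; rewrite ?mul1r// mulN1r p_even.
have ci' := cint_affine x s0 ci.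
rewrite (cintegral_affine x s0 ci) n1 Real1 mul1r.
split; first exact: eq_cintegral.
by move: ci'; congr cint; apply/funext.
Qed.

Definition p_norm : R := \int[mu]_y normc (p y).

Lemma p_norm_from x : \int[mu]_y normc (p (x - y)) = p_norm.
Proof.
have n1 : (-1 : R) != 0 by rewrite oppr_eq0 oner_neq0.
rewrite /p_norm (Rintegral_affine x n1 (cint_normc cint_p)) normrN1 mul1r.
by apply: eq_Rintegral => y _; rewrite mulN1r.
Qed.

(** The total variation of the k-step law is at most the k-th power of that of one step; this makes
    bounded path functionals integrable. *)
Lemma rint_path_density k x :
  rint (lebesgue_tuple k) (fun w : k.-tuple T => normc (path_density x w)) /\
  \int[lebesgue_tuple k]_w normc (path_density x w) <= p_norm ^+ k.
Proof.
elim: k x => [|k IH] x.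
  have e (w : 0.-tuple T) : normc (path_density x w) = 1 by rewrite /path_density big_ord0 normc1.
  split.
    under eq_fun do rewrite e.
    apply/integrableP; split; first exact: measurable_cst.
    by rewrite /= integral_dirac// diracT mul1e normr1 ltry.
  under eq_Rintegral do rewrite e.
  by rewrite /Rintegral integral_dirac// diracT mul1e expr0.
have mD := cmeas_normc (cmeas_path_density_from k.+1 x).
have pn0 : 0 <= p_norm by apply: Rintegral_ge0 => y _; exact: normc_ge0.
have ip := cint_normc (cint_p_from x).
have [|||||r1 r2 r3 r4] := @rfubini _ _ T _ R mu (lebesgue_tuple k)
  (fun z => normc (path_density x (Defs.cons_tuple z)))
  (fun y w => normc (p (x - y)) * normc (path_density y w))
  (fun y => p_norm ^+ k * normc (p (x - y))) _ _ _ _ _.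
- exact: (measurableT_comp mD (@measurable_cons_tuple R k)).
- by move=> y; apply: rintZl; exact: (IH y).1.
- by move=> y w; rewrite path_density_cons normcM ger0_norm ?mulr_ge0 ?normc_ge0.
- exact: rintZl.
- move=> y; rewrite RintegralZl//; last exact: (IH y).1.
  by rewrite mulrC ler_wpM2r ?normc_ge0//; exact: (IH y).2.
have [i1 i2] := Rintegral_cons mD r1.
split=> //; rewrite i2 r2 exprSr -(p_norm_from x) -RintegralZl//.
apply: le_Rintegral => //; first exact: rintZl.
move=> y _; have -> : \int[lebesgue_tuple k]_w normc (path_density x (Defs.cons_tuple (y, w))) =
    \int[lebesgue_tuple k]_w (normc (p (x - y)) * normc (path_density y w)).
  by apply: eq_Rintegral => w _; rewrite path_density_cons normcM.
rewrite RintegralZl//; last exact: (IH y).1.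
by rewrite mulrC p_norm_from ler_wpM2r ?normc_ge0//; exact: (IH y).2.
Qed.

(** The Markov property at the first step. *)
Lemma walk_mean_cons k x (F : k.+1.-tuple T -> C) B : cmeas F ->
  (forall w, normc (F w) <= B) ->
  walk_mean x F = cintegral mu (fun y => p (x - y) * walk_mean y (fun w : k.-tuple R => F (Defs.cons_tuple (y, w)))) /\
  cint mu (fun y => p (x - y) * walk_mean y (fun w : k.-tuple R => F (Defs.cons_tuple (y, w)))).
Proof.
move=> mF FB; have B0 : 0 <= B := le_trans (normc_ge0 _) (FB [tuple of nseq k.+1 0]).
have mFD : cmeas (fun w : k.+1.-tuple T => F w * path_density x w).
  by apply: cmeasM => //; exact: cmeas_path_density_from.
have ip := cint_normc (cint_p_from x).
have dn y := rint_path_density k y.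
have [|||||q0 q1 q2 q3] := @cfubini _ _ T _ R mu (lebesgue_tuple k)
  (fun z => F (Defs.cons_tuple z) * path_density x (Defs.cons_tuple z))
  (fun y w => B * normc (p (x - y)) * normc (path_density y w))
  (fun y => B * p_norm ^+ k * normc (p (x - y))) _ _ _ _ _.
- exact: (cmeas_comp mFD (@measurable_cons_tuple R k)).
- by move=> y; apply: rintZl; exact: (dn y).1.
- move=> y w; rewrite normcM path_density_cons normcM -mulrA ler_wpM2r//.
  by rewrite mulr_ge0// normc_ge0.
- exact: rintZl.
- move=> y; rewrite RintegralZl//; last exact: (dn y).1.
  rewrite mulrAC -mulrA -[leRHS]mulrA ler_wpM2l// ler_wpM2r ?normc_ge0//.
  exact: (dn y).2.
have [_ e] := cintegral_cons mFD q0.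
have e' y : cintegral (lebesgue_tuple k) (fun w => F (Defs.cons_tuple (y, w)) * path_density x (Defs.cons_tuple (y, w))) =
    p (x - y) * walk_mean y (fun w : k.-tuple R => F (Defs.cons_tuple (y, w))).
  rewrite -cintegralZl; last first.
    apply: (cint_le _ (rintZl B (dn y).1)).
      apply: cmeasM; last exact: cmeas_path_density_from.
      apply: (cmeas_comp mF); apply: (measurableT_comp (@measurable_cons_tuple R k)).
      exact: pair1_measurable.
    by move=> w; rewrite normcM ler_wpM2r ?normc_ge0.
  by apply: eq_cintegral => w; rewrite path_density_cons mulrCA.
split; first by rewrite /walk_mean e q1; exact: eq_cintegral e'.
by move: q3; congr cint; apply/funext => y; exact: e'.
Qed.

(* The case s = -1 turns the running minimum into a running maximum. *)
Lemma walk_extremum (q : nat -> R -> C) (s m nu x : R) :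
  s = 1 \/ s = -1 -> 0 <= nu -> (forall w, q 0 w = cis (m * (s * w)) * p w) ->
  forall k (a : R), s * x <= a ->
  walk_mean x (fun w : k.-tuple R => cexp ('i%C * (m * last x w)%:C -
      (nu * \big[Num.max/a]_(y <- w) (s * y))%:C)) =
  cis (m * x) * run_max q k (fun z => (expR (- (nu * Num.max a (s * x + z))))%:C).
Proof.
move=> s1 nu0 q0 k; elim: k x => [|k IH] x a xa.
  rewrite /walk_mean /=.
  have e (f : 0.-tuple T -> C) : cintegral (lebesgue_tuple 0) f = f [tuple].
    have -> : f = fun=> f [tuple] by apply/funext => w; rewrite tuple0.
    by apply: complexP; rewrite /= /Rintegral integral_dirac// diracT mul1e.
  rewrite e /path_density big_ord0 mulr1 /= big_nil addr0 max_l//.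
  by rewrite cexpD cisE -RealN cexp_real.
have ss : s * s = 1 by case: s1 => ->; rewrite ?mulrNN mulr1.
pose F (w : k.+1.-tuple T) : C := cexp ('i%C * (m * last x w)%:C -
      (nu * \big[Num.max/a]_(y <- w) (s * y))%:C).
have mF : cmeas F.
  apply: cmeas_cexp; apply: cmeasB.
    apply: cmeasM; first exact: cmeas_cst.
    apply: cmeas_real; apply: measurable_funM; first exact: measurable_cst.
    exact: measurable_last.
  apply: cmeas_real; apply: measurable_funM; first exact: measurable_cst.
  under eq_fun do rewrite big_tuple.
  apply: measurable_bigmax => i.
  by apply: measurable_funM; [exact: measurable_cst|exact: measurable_tnth].
have FB w : normc (F w) <= expR (- (nu * a)).
  rewrite /F normc_cexp cReB cRe_iM /= oppr0 sub0r ler_expR lerN2.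
  by rewrite ler_wpM2l// bigmax_ge_init.
have [-> iw] := walk_mean_cons x mF FB.
pose W (y : R) : C := cis (m * y) * run_max q k
  (fun z => (expR (- (nu * Num.max (Num.max a (s * y)) (s * y + z))))%:C).
have eW : (fun y => p (x - y) * walk_mean y (fun w : k.-tuple R => F (Defs.cons_tuple (y, w)))) =
    (fun y => p (x - y) * W y).
  apply/funext => y; apply: (congr1 (fun z : C => p (x - y) * z)).
  have ya : s * y <= Num.max a (s * y) by rewrite le_max lexx orbT.
  apply: etrans (IH y _ ya); apply: eq_cintegral => w.
  by rewrite /F /= bigmax_cons.
rewrite eW in iw *.
have [-> iw'] := cintegral_p_from s1 iw.
pose f w := q 0 w * run_max q k (fun z => (expR (- (nu * Num.max a (s * x + pos (w + z)))))%:C).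
have ef w : p w * W (x + s * w) = cis (m * x) * f w.
  suff e : run_max q k (fun z => (expR (- (nu * Num.max (Num.max a (s * (x + s * w)))
        (s * (x + s * w) + z))))%:C) =
      run_max q k (fun z => (expR (- (nu * Num.max a (s * x + pos (w + z)))))%:C).
    by rewrite /W /f q0 e [m * (x + _)]mulrDr cisD; ring.
  apply: eq_run_max => z z0.
  (* If w + z < 0 both sides equal a, because z >= 0 and s x <= a; otherwise z >= 0 makes s x + w +
     z the larger of the two positions. *)
  suff -> : Num.max (Num.max a (s * (x + s * w))) (s * (x + s * w) + z) =
      Num.max a (s * x + pos (w + z)) by [].
  have -> : s * (x + s * w) = s * x + w by rewrite mulrDr mulrA ss mul1r.
  have [wz|wz] := leP 0 (w + z).
    rewrite (pos_id wz) addrA -maxA; congr (Num.max a _).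
    by rewrite max_r// lerDl.
  rewrite (pos_eq0 (ltW wz)) addr0 -maxA max_l; last first.
    rewrite ge_max; apply/andP; split; first by lra.
    lra.
  rewrite max_l//; lra.
have if_ : cint mu f.
  have := cintZl (cis (- (m * x))) iw'.
  congr cint; apply/funext => w; rewrite ef mulrA -cisD addNr cis0 mul1r//.
transitivity (cintegral mu (fun w => cis (m * x) * f w)); first exact: eq_cintegral.
exact: cintegralZl if_.
Qed.

End random_walk.

(** * The walk of the step-process *)

Section mean_value.
Context {R : realType}.
Local Notation C := R[i].

Lemma derive_bound (h dh : R -> R) (M a b : R) : a <= b ->
  (forall x, x \in `[a, b] -> is_derive x 1 h (dh x)) ->
  (forall x, x \in `[a, b] -> `|dh x| <= M) ->
  `|h b - h a| <= M * (b - a).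
Proof.
rewrite le_eqVlt => /predU1P[<- _ _|ab hd hM].
  by rewrite !subrr normr0 mulr0.
have hd' x : x \in `]a, b[ -> is_derive x 1 h (dh x).
  by move=> xab; apply: hd; exact: subset_itv_oo_cc.
have hc : {within `[a, b], continuous h}.
  by apply: derivable_within_continuous => x xab; have [] := hd x xab.
have [c cab ->] := MVT ab hd' hc.
rewrite normrM [`|b - a|]gtr0_norm ?subr_gt0//; apply: ler_wpM2r.
  by rewrite subr_ge0 ltW.
by apply: hM; exact: subset_itv_oo_cc.
Qed.

(** The mean value theorem for each coordinate, at possibly different points, hence the factor 2. *)
Lemma cderive_bound (F dF : R -> C) (M a b : R) : a <= b ->
  (forall x, x \in `[a, b] -> cderive F x (dF x)) ->
  (forall x, x \in `[a, b] -> normc (dF x) <= M) ->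
  normc (F b - F a) <= 2 * M * (b - a).
Proof.
move=> ab Fd FM; rewrite (le_trans (normc_le_ReIm _))// cReB cImB.
rewrite -mulrA mulrDl mul1r; apply: lerD.
- apply: (@derive_bound (fun x => complex.Re (F x)) (fun x => complex.Re (dF x)) M a b ab) => x xab.
    by have [] := Fd x xab.
  exact: le_trans (Re_le_normc _) (FM x xab).
- apply: (@derive_bound (fun x => complex.Im (F x)) (fun x => complex.Im (dF x)) M a b ab) => x xab.
    by have [] := Fd x xab.
  exact: le_trans (Im_le_normc _) (FM x xab).
Qed.

Lemma cisN_conj (t : R) : cis (- t) * cis t = 1.
Proof. by rewrite -cisD addNr cis0. Qed.

Lemma normc_cis_sub1 (t : R) : normc (cis t - 1) <= 2 * `|t|.
Proof.
wlog t0 : t / 0 <= t => [H|].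
  have [/H//|t0] := leP 0 t.
  have := H (- t); rewrite oppr_ge0 normrN => /(_ (ltW t0)).
  apply: le_trans; rewrite -[normc (cis t - 1)]mulr1 -(normc_cis (- t)) -normcM.
  by rewrite mulrBl mul1r mulrC cisN_conj normcBC.
have := @cderive_bound (fun u => cis (1 * u)) (fun u => 'i%C * 1%:C * cis (1 * u)) 1 0 t t0.
rewrite mulr0 cis0 mul1r subr0 mulr1 ger0_norm//; apply => x _.
  exact: cderive_cis.
by rewrite Real1 mulr1 normcM normc_i normc_cis mulr1.
Qed.

End mean_value.

(** * The function psi: bounds and behaviour at small times *)

Section heat_walk.
Context {R : realType} (N : nat).
Hypotheses (N_gt2 : (2 < N)%N) (N_even : ~~ odd N).
Local Notation mu := (@lebesgue_measure R).
Local Notation T := (measurableTypeR R).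
Local Notation C := R[i].
Local Notation kernel := Defs.kernel.
Variables (m nu : R).
Hypothesis nu_ge0 : 0 <= nu.

Definition damp (z : R) : C := (expR (- (nu * pos z)))%:C.

Definition test_fun (y : R) : C := cis (m * y) * damp y.

(* psi t is the expectation of exp (i m X(t) - nu max (X(t), 0)) from 0; it is
   written with gexp_hat so as to be measurable in t on the whole line. *)
Definition psi (t : R) : C :=
  cintegral mu (fun y => ((2 * pi)^-1)%:C * gexp_hat N t y * test_fun y).

Lemma bounded_by_damp : bounded_by 1 damp.
Proof.
split=> [|z].
  apply: cmeas_real; apply: (measurableT_comp (@measurable_expR R)).
  apply: measurableT_comp => //; apply: measurable_funM => //.
  exact: measurable_pos.
have h : 0 <= nu * pos z by rewrite mulr_ge0// pos_ge0.
by rewrite /damp normc_real_ge0 ?expR_ge0// -expR0 ler_expR oppr_le0.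
Qed.

Lemma cmeas_test_fun : cmeas (test_fun : T -> C).
Proof. by apply: cmeasM; [exact: cmeas_cis_scale|exact: bounded_by_damp.1]. Qed.

Lemma normc_test_fun y : normc (test_fun y) <= 1.
Proof. by rewrite normcM normc_cis mul1r; exact: bounded_by_damp.2. Qed.

Lemma dampD y z : 0 <= z -> damp (pos y + z) = damp y * damp z.
Proof.
move=> z0; rewrite /damp -RealM -expRD pos_id ?addr_ge0 ?pos_ge0// (pos_id z0).
by rewrite mulrDr opprD.
Qed.

Lemma psiE (t : R) : 0 < t -> psi t = cintegral mu (fun y => kernel N t y * test_fun y).
Proof. by move=> t0; apply: eq_cintegral => y; rewrite kernelE. Qed.

Lemma cint_psi (t : R) : 0 < t -> cint mu (fun y => kernel N t y * test_fun y).
Proof.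
by move=> t0; exact: (cint_mul_bounded (cint_kernel N_gt2 N_even t0) cmeas_test_fun normc_test_fun).
Qed.

Lemma cmeas_psi : cmeas (psi : T -> C).
Proof.
apply: (@cmeas_cintegral_param _ _ T T R mu
  (fun z => ((2 * pi)^-1)%:C * gexp_hat N z.1 z.2 * test_fun z.2)).
apply: cmeasM; first exact: cmeas_kernel_param.
exact: (cmeas_comp cmeas_test_fun).
Qed.

Lemma normc_kernel_le (t y : R) : 0 < t ->
  normc (kernel N t y) <= kernel_bound N (root_scale N t) y.
Proof.
move=> t0; rewrite -{1}(root_scaleK N_gt2 t0); apply: kernel_le => //.
exact: root_scale_gt0.
Qed.

(** The bound is uniform in t because the integral of [kernel_bound] is independent of the scale;
    this lets the Dirichlet series of the exponent converge on the whole right half-plane. *)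
Lemma psi_bound (t : R) : 0 < t -> normc (psi t) <= decay_const (R := R) N.
Proof.
move=> t0; rewrite psiE//.
have [ib eb] := integral_kernel_bound N (root_scale_gt0 N t0).
have -> : decay_const N = 2 * \int[mu]_y kernel_bound N (root_scale N t) y.
  by rewrite eb mulrC divfK.
apply: cintegral_norm => //; first exact: cint_cmeas (cint_psi t0).
move=> y; rewrite normcM (le_trans _ (normc_kernel_le y t0))//.
by rewrite ler_piMr ?normc_ge0// normc_test_fun.
Qed.

Lemma test_fun_sub1 y : normc (test_fun y - 1) <= (2 * `|m| + nu) * `|y|.
Proof.
have -> : test_fun y - 1 = (cis (m * y) - 1) * damp y + (damp y - 1).
  by rewrite /test_fun; ring.
rewrite (le_trans (le_normcD _ _))// [leRHS]mulrDl; apply: lerD.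
  rewrite normcM (@le_trans _ _ (normc (cis (m * y) - 1)))//.
    by rewrite ler_piMr ?normc_ge0//; exact: bounded_by_damp.2.
  by rewrite (le_trans (normc_cis_sub1 _))// normrM mulrA.
have np0 : 0 <= nu * pos y by rewrite mulr_ge0// pos_ge0.
have py : pos y <= `|y| by rewrite ge_max normr_ge0 ler_norm.
rewrite /damp -Real1 -RealB normc_real distrC ger0_norm; last first.
  by rewrite subr_ge0 -expR0 ler_expR oppr_le0.
have := expR_ge1Dx (- (nu * pos y)).
have : nu * pos y <= nu * `|y| by rewrite ler_wpM2l.
lra.
Qed.

(** The kernel has integral 1, by [kernel_inversion] at 0, so psi t - 1 integrates [test_fun - 1]
    against it. This function is bounded by a multiple of |y|, and the first absolute moment of the
    kernel is O(t^(1/N)). *)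
Lemma psi_sub1 (t : R) : 0 < t ->
  normc (psi t - 1) <= (2 * `|m| + nu) * decay_const N * (root_scale N t)^-1.
Proof.
move=> t0; have s0 := root_scale_gt0 N t0.
have [ib eb] := integral_kernel_bound N s0.
have ik := cint_kernel N_gt2 N_even t0.
have e1 : cintegral mu (kernel N t) = 1.
  have := kernel_inversion N_gt2 N_even 0 t0.
  rewrite /gexp expr0n eqn0Ngt (N_gt0 N_gt2) mulr0 oppr0 expR0 Real1 => <-.
  by apply: eq_cintegral => y; rewrite mul0r cis0 mulr1.
rewrite psiE// -e1 -cintegralB//; last exact: cint_psi.
pose K : R := 2 * `|m| + nu.
have K0 : 0 <= K by rewrite addr_ge0// mulr_ge0.
have -> : (2 * `|m| + nu) * decay_const N * (root_scale N t)^-1 =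
    2 * \int[mu]_y (K * (root_scale N t)^-1 * kernel_bound N (root_scale N t) y).
  by rewrite RintegralZl// eb /K; field; rewrite gt_eqF.
apply: cintegral_norm.
- exact: (cint_cmeas (cintB (cint_psi t0) ik)).
- exact: rintZl.
move=> y; have -> : kernel N t y * test_fun y - kernel N t y = (test_fun y - 1) * kernel N t y.
  by rewrite mulrBl mul1r [test_fun y * _]mulrC.
rewrite normcM -/K (le_trans (ler_wpM2r (normc_ge0 _) (test_fun_sub1 y)))//.
rewrite -!mulrA; apply: ler_wpM2l => //.
have := kernel_moment_le N_gt2 N_even y s0.
by rewrite (root_scaleK N_gt2 t0).
Qed.

End heat_walk.

(** * Continuity of psi and the recursion for the means on a grid *)

Section discretisation.
Context {R : realType} (N : nat).
Hypotheses (N_gt2 : (2 < N)%N) (N_even : ~~ odd N).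
Local Notation mu := (@lebesgue_measure R).
Local Notation T := (measurableTypeR R).
Local Notation C := R[i].
Local Notation kernel := Defs.kernel.
Variables (m nu : R).
Hypothesis nu_ge0 : 0 <= nu.

Lemma ccont_test_fun : ccont (test_fun m nu).
Proof.
apply: ccontM; first exact: cderive_ccont (cderive_cis m).
apply: ccont_real => y; apply: continuous_cvg; first exact: continuous_expR.
apply: cvgN; apply: cvgM; first exact: cvg_cst.
by apply: continuous_max; [exact: cvg_cst|exact: cvg_id].
Qed.

(** Self-similarity moves t from the kernel into the test function, so that in [psi_cvg] the fixed
    function |kernel N 1| dominates. *)
Lemma psi_scale (t : R) : 0 < t ->
  psi N m nu t = cintegral mu (fun y => kernel N 1 y * test_fun m nu ((root_scale N t)^-1 * y)).
Proof.
move=> t0; have s0 := root_scale_gt0 N t0; have sn := lt0r_neq0 s0.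
have is0 : (root_scale N t)^-1 != 0 by rewrite invr_neq0.
apply: etrans (psiE N_gt2 N_even m nu t0) _.
apply: etrans (cintegral_affine 0 is0 (cint_psi N_gt2 N_even m nu_ge0 t0)) _.
have isp : 0 < (root_scale N t)^-1 by rewrite invr_gt0.
rewrite (gtr0_norm isp).
have ks y : kernel N t ((root_scale N t)^-1 * y) = (root_scale N t)%:C * kernel N 1 y.
  have t1 : 0 < 1 :> R by [].
  rewrite (kernelE N_gt2 N_even _ t0) (kernelE N_gt2 N_even _ t1) mulrCA.
  apply: (congr1 (fun z : C => ((2 * pi)^-1)%:C * z)).
  have e := gexp_hat_scale N_gt2 N_even ((root_scale N t)^-1 * y) s0.
  by rewrite (root_scaleK N_gt2 t0) mulVKf// in e.
have i1 : cint mu (fun y => kernel N 1 y * test_fun m nu ((root_scale N t)^-1 * y)).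
  apply: (cint_mul_bounded (B := 1) (cint_kernel N_gt2 N_even ltr01)).
    exact: (cmeas_comp (cmeas_test_fun m nu_ge0) (measurable_scale _)).
  by move=> y; exact: (normc_test_fun m nu_ge0).
rewrite -(cintegralZl _ (cint_affine 0 is0 (cint_psi N_gt2 N_even m nu_ge0 t0))).
apply: eq_cintegral => y; rewrite add0r ks mulrA mulrA -RealM mulVf// Real1 mul1r.
by [].
Qed.

Lemma psi_cvg (u : nat -> R) (t : R) : 0 < t -> (forall n, 0 < u n) ->
  u @ \oo --> t -> ccvg (fun n => psi N m nu (u n)) (psi N m nu t).
Proof.
move=> t0 u0 ut; rewrite (psi_scale t0).
have -> : (fun n => psi N m nu (u n)) = (fun n => cintegral mu
    (fun y => kernel N 1 y * test_fun m nu ((root_scale N (u n))^-1 * y))).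
  by apply/funext => n; exact: psi_scale.
have ik := cint_normc (cint_kernel N_gt2 N_even (@ltr01 R)).
have su : (fun n => (root_scale N (u n))^-1) @ \oo --> (root_scale N t)^-1.
  apply: cvgV; first by rewrite gt_eqF// root_scale_gt0.
  have e (v : R) : 0 < v -> root_scale N v = expR (- N%:R^-1 * ln v).
    by move=> v0; rewrite /root_scale /powR gt_eqF.
  rewrite e//; under eq_fun do rewrite e//.
  apply: continuous_cvg; first exact: continuous_expR.
  apply: cvgM; first exact: cvg_cst.
  by apply: continuous_cvg => //; exact: continuous_ln.
have [] := @cdct _ T R mu (fun n y => kernel N 1 y * test_fun m nu ((root_scale N (u n))^-1 * y))
  (fun y => kernel N 1 y * test_fun m nu ((root_scale N t)^-1 * y)) (fun y => normc (kernel N 1 y)) _ ik _ _ => //.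
- move=> n; apply: cmeasM; first exact: (cmeas_kernel N_gt2 N_even ltr01).
  exact: (cmeas_comp (cmeas_test_fun m nu_ge0) (measurable_scale _)).
- by move=> n y; rewrite normcM ler_piMr ?normc_ge0//; exact: (normc_test_fun m nu_ge0).
- move=> y; apply: ccvgM; first exact: ccvg_cst.
  have sy : (fun n => (root_scale N (u n))^-1 * y) @ \oo --> (root_scale N t)^-1 * y.
    by apply: cvgM => //; exact: cvg_cst.
  have [cr ci] := ccont_test_fun.
  by split; [exact: (continuous_cvg _ (cr _) sy)|exact: (continuous_cvg _ (ci _) sy)].
Qed.

Section step.
Variable h : R.
Hypothesis h0 : 0 < h.

Definition step_density (j : nat) (w : R) : C := cis (m * w) * kernel N (j.+1%:R * h) w.

Let jh0 j : 0 < j.+1%:R * h. Proof. by rewrite mulr_gt0. Qed.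

Lemma cint_step_density j : cint mu (step_density j).
Proof.
apply: (cint_le _ (cint_normc (cint_kernel N_gt2 N_even (jh0 j)))).
  by apply: cmeasM; [exact: cmeas_cis_scale|exact: (cmeas_kernel N_gt2 N_even (jh0 j))].
by move=> w; rewrite normcM normc_cis mul1r.
Qed.

Lemma step_density_bound : exists Q, forall w, normc (step_density 0 w) <= Q.
Proof.
pose s := root_scale N (1%:R * h).
have s0 : 0 < s by apply: root_scale_gt0; exact: (jh0 0).
have p0 : 0 <= (2 * pi)^-1 :> R by rewrite invr_ge0 mulr_ge0// pi_ge0.
exists ((2 * pi)^-1 * (s * decay_const N)) => w.
rewrite normcM normc_cis mul1r (le_trans (normc_kernel_le N_gt2 N_even w (jh0 0)))//.
rewrite /kernel_bound -/s; apply: ler_wpM2l => //; apply: ler_wpM2l; first exact: ltW.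
rewrite ler_piMr ?decay_const_ge0// invf_le1 ?lerDl ?sqr_ge0//.
by rewrite ltr_pwDl ?sqr_ge0.
Qed.

Lemma step_density_semigroup j x :
  cintegral mu (fun y => step_density j y * step_density 0 (x - y)) = step_density j.+1 x.
Proof.
have ik : cint mu (fun y => kernel N (j.+1%:R * h) y * kernel N (1%:R * h) (x - y)).
  have [Q hQ] := step_density_bound.
  apply: (cint_mul_bounded (B := Q) (cint_kernel N_gt2 N_even (jh0 j))).
    apply: (cmeas_comp (cmeas_kernel N_gt2 N_even (jh0 0))).
    by apply: measurable_funB.
  by move=> y; have := hQ (x - y); rewrite normcM normc_cis mul1r.
rewrite /step_density -[j.+2]addn1 natrD mulrDl.
rewrite -(kernel_semigroup N_gt2 N_even x (jh0 j) (jh0 0)) -(cintegralZl _ ik).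
apply: eq_cintegral => y.
have -> : cis (m * x) = cis (m * y) * cis (m * (x - y)) by rewrite -cisD mulrBr addrC subrK.
by ring.
Qed.

Definition max_mean (k : nat) : C := run_max step_density k (damp nu).

Lemma max_mean0 : max_mean 0 = 1.
Proof. by rewrite /max_mean /= /damp (pos_id (lexx 0)) mulr0 oppr0 expR0. Qed.

(** [damp] turns the sum of the nonnegative numbers pos y and z into a product, so every [conv] in
    Spitzer's identity factors into a value of psi and an earlier mean. *)
Lemma max_mean_rec k :
  k.+1%:R * max_mean k.+1 = \sum_(j < k.+1) psi N m nu (j.+1%:R * h) * max_mean (k - j).
Proof.
have [Q hQ] := step_density_bound.
apply: etrans (spitzer_identity cint_step_density hQ step_density_semigroup k
  (bounded_by_damp nu_ge0)) _.
apply: eq_bigr => j _; rewrite (psiE N_gt2 N_even m nu (jh0 j)).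
rewrite -(cintegralZr _ (cint_psi N_gt2 N_even m nu_ge0 (jh0 j))).
apply: eq_cintegral => y.
have -> : run_max step_density (k - j) (fun z => damp nu (pos y + z)) =
    damp nu y * run_max step_density (k - j) (damp nu).
  rewrite -(run_maxZ cint_step_density (k - j) (damp nu y) (bounded_by_damp nu_ge0)).
  by apply: eq_run_max => z z0; exact: dampD.
rewrite /max_mean /test_fun /step_density; set r := run_max _ _ _.
by ring.
Qed.

End step.
End discretisation.

(** * Expectations of the step-process as means of the walk *)

Section step_process.
Context {R : realType} (N : nat).
Hypotheses (N_gt2 : (2 < N)%N) (N_even : ~~ odd N).
Local Notation T := (measurableTypeR R).
Local Notation C := R[i].
Local Notation kernel := Defs.kernel.
Variables (m nu x : R).
Hypothesis nu_ge0 : 0 <= nu.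

Definition dyadic (n : nat) : R := (2 ^+ n)^-1.

Lemma dyadic_gt0 n : 0 < dyadic n.
Proof. by rewrite invr_gt0 exprn_gt0. Qed.

Lemma Estep_walk (phi : R -> R -> R -> C) n k :
  Estep N x phi n k = walk_mean (kernel N (dyadic n)) x (fun w : k.-tuple R =>
    phi (last x w) (\big[Num.max/x]_(y <- w) y) (\big[Num.min/x]_(y <- w) y)).
Proof.
rewrite /Estep /Efd /walk_mean; apply: eq_cintegral => w.
apply: (congr1 (fun z : C => _ * z)); apply: eq_bigr => i _.
rewrite (_ : _ - _ = dyadic n)// tnth_mktuple.
have -> : nth 0 (0 :: [tuple (i.+1)%:R / 2 ^+ n | i < k]) i = i%:R / 2 ^+ n :> R.
  case: i => -[|j] jk /=; first by rewrite mul0r.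
  have jk' : (j < k)%N by exact: ltnW.
  have := tnth_mktuple (fun i : 'I_k => (i.+1)%:R / 2 ^+ n : R) (Ordinal jk').
  by rewrite (tnth_nth 0).
by rewrite -mulrBl -natr1 addrAC subrr add0r mul1r.
Qed.

(** The sign s = 1 serves the maximum and s = -1 the minimum, a minimum being minus the maximum of
    the negated path. Negating the path changes the sign of m, hence [s * m] in the mean. *)
Lemma Estep_extremum (phi : R -> R -> R -> C) n k (s : R) : s = 1 \/ s = -1 ->
  (forall w : seq R, phi (last x w) (\big[Num.max/x]_(y <- w) y) (\big[Num.min/x]_(y <- w) y) =
    cexp ('i%C * (m * last x w)%:C - (nu * \big[Num.max/s * x]_(y <- w) (s * y))%:C)) ->
  Estep N x phi n k = cexp (('i%C * m%:C - (s * nu)%:C) * x%:C) *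
    max_mean N (s * m) nu (dyadic n) k.
Proof.
move=> s1 hphi; rewrite Estep_walk.
have h0 := dyadic_gt0 n.
have q0 w : step_density N (s * m) (dyadic n) 0 w = cis (m * (s * w)) * kernel N (dyadic n) w.
  by rewrite /step_density mulr1n mul1r (_ : s * m * w = m * (s * w))//; ring.
have ke y : kernel N (dyadic n) (- y) = kernel N (dyadic n) y by exact: kernelN.
have ex := walk_extremum (cint_kernel N_gt2 N_even h0) ke s1 nu_ge0 q0 k (lexx (s * x)).
transitivity (walk_mean (kernel N (dyadic n)) x (fun w : k.-tuple R =>
    cexp ('i%C * (m * last x w)%:C - (nu * \big[Num.max/s * x]_(y <- w) (s * y))%:C))).
  apply: eq_cintegral => w; apply: (congr1 (fun z : C => z * _)); exact: hphi.
apply: etrans ex _.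
pose q := step_density N (s * m) (dyadic n).
have cq : forall j, cint (@lebesgue_measure R) (q j) := cint_step_density N_gt2 N_even (s * m) h0.
have -> : run_max q k (fun z => (expR (- (nu * Num.max (s * x) (s * x + z))))%:C) =
    (expR (- (nu * (s * x))))%:C * run_max q k (damp nu).
  rewrite -(run_maxZ cq k _ (bounded_by_damp nu_ge0)); apply: eq_run_max => z z0.
  rewrite /damp -RealM -expRD (pos_id z0) max_r ?lerDl//.
  by rewrite mulrDr opprD.
rewrite mulrA /max_mean; apply: (congr1 (fun z : C => z * _)).
rewrite cisE -cexp_real -cexpD; apply: (congr1 (@cexp R)).
by rewrite !RealE; ring.
Qed.

Lemma bigmin_max (a : R) (w : seq R) :
  \big[Num.min/a]_(y <- w) y = - \big[Num.max/-1 * a]_(y <- w) (-1 * y).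
Proof.
elim: w => [|b w IH]; first by rewrite !big_nil mulN1r opprK.
by rewrite !big_cons IH; move: (\big[_/_]_(_ <- _) _) => X; rewrite mulN1r oppr_max opprK.
Qed.

End step_process.

(** * Series and the exponential formula *)

Section complex_series.
Context {R : realType}.
Local Notation C := R[i].
Local Notation Re := (@complex.Re R).
Local Notation Im := (@complex.Im R).

Definition cser (u : nat -> C) : C :=
  limn (series (fun k => Re (u k))) +i* limn (series (fun k => Im (u k))).

Lemma Re_series (u : nat -> C) n : Re (series u n) = series (fun k => Re (u k)) n.
Proof.
rewrite /series /=; elim: n => [|n IH]; first by rewrite !big_geq.
by rewrite !big_nat_recr//= cReD IH.
Qed.

Lemma Im_series (u : nat -> C) n : Im (series u n) = series (fun k => Im (u k)) n.
Proof.
rewrite /series /=; elim: n => [|n IH]; first by rewrite !big_geq.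
by rewrite !big_nat_recr//= cImD IH.
Qed.

Lemma cvg_series_dominated (r v : nat -> R) : (forall k, `|r k| <= v k) ->
  cvgn (series v) -> cvgn (series r).
Proof.
move=> rv cv; apply: normed_cvg; apply: (series_le_cvg _ _ rv cv) => // k.
exact: le_trans (normr_ge0 _) (rv k).
Qed.

Lemma ccvg_series (u : nat -> C) (v : nat -> R) : (forall k, normc (u k) <= v k) ->
  cvgn (series v) -> ccvg (series u) (cser u).
Proof.
move=> uv cv; split.
- under eq_fun do rewrite Re_series; apply: cvg_series_dominated cv => k.
  exact: le_trans (Re_le_normc _) (uv k).
- under eq_fun do rewrite Im_series; apply: cvg_series_dominated cv => k.
  exact: le_trans (Im_le_normc _) (uv k).
Qed.

Lemma normc_series (u : nat -> C) n : normc (series u n) <= series (fun k => normc (u k)) n.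
Proof. exact: normc_sum. Qed.

Lemma ccvg_normc_le (u : nat -> C) l M : ccvg u l -> (forall n, normc (u n) <= M) ->
  normc l <= M.
Proof.
move=> ul uM; have := ccvg_normc0 ul => c0.
apply/ler_addgt0Pr => e e0.
have /cvgrPdist_lt/(_ e e0)[n _ /(_ n (leqnn n))] := c0.
rewrite sub0r normrN ger0_norm ?normc_ge0// => h.
have -> : l = u n - (u n - l) by rewrite opprB addrC subrK.
by rewrite (le_trans (normcB _ _))// lerD// ltW.
Qed.

Lemma normc_cser (u : nat -> C) (v : nat -> R) : (forall k, normc (u k) <= v k) ->
  cvgn (series v) -> normc (cser u) <= limn (series v).
Proof.
move=> uv cv; apply: (ccvg_normc_le (ccvg_series uv cv)) => n.
have v0 k : 0 <= v k := le_trans (normc_ge0 _) (uv k).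
rewrite (le_trans (normc_series _ _))// (@le_trans _ _ (series v n))//.
  by rewrite /series /=; apply: ler_sum => k _; exact: uv.
apply: nondecreasing_cvgn_le => //; apply/nondecreasing_seqP => k.
by rewrite /series /= big_nat_recr//= lerDl.
Qed.

Lemma cser_unique (u : nat -> C) l : ccvg (series u) l -> cser u = l.
Proof.
move=> [lr li]; apply: complexP => /=; apply: cvg_lim => //.
- by move: lr; under eq_fun do rewrite Re_series.
- by move: li; under eq_fun do rewrite Im_series.
Qed.

Lemma ccvg_shiftS (u : nat -> C) l : ccvg (fun n => u n.+1) l -> ccvg u l.
Proof.
move=> [ur ui]; split.
- by rewrite -(cvg_shiftS (fun n => Re (u n))).
- by rewrite -(cvg_shiftS (fun n => Im (u n))).
Qed.

Lemma seriesD (u v : nat -> C) n :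
  series (fun k => u k + v k) n = series u n + series v n.
Proof. by rewrite /series /= big_split. Qed.

Lemma seriesZ (c : C) (u : nat -> C) n : series (fun k => c * u k) n = c * series u n.
Proof. by rewrite /series /= mulr_sumr. Qed.

Lemma cserD (u u' : nat -> C) l l' : ccvg (series u) l -> ccvg (series u') l' ->
  ccvg (series (fun k => u k + u' k)) (l + l').
Proof.
move=> cu cu'; have -> : series (fun k => u k + u' k) = (fun n => series u n + series u' n).
  by apply/funext => n; exact: seriesD.
exact: ccvgD.
Qed.

Lemma cserZ (c : C) (u : nat -> C) l : ccvg (series u) l ->
  ccvg (series (fun k => c * u k)) (c * l).
Proof.
move=> cu; have -> : series (fun k => c * u k) = (fun n => c * series u n).
  by apply/funext => n; exact: seriesZ.
by apply: ccvgM => //; exact: ccvg_cst.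
Qed.

Lemma cvg_series_geometric (M r : R) : 0 <= r < 1 -> cvgn (series (fun k => M * r ^+ k)).
Proof.
by move=> /andP[r0 r1]; apply: is_cvg_geometric_series; rewrite ger0_norm.
Qed.

End complex_series.

Section exponential_estimates.
Context {R : realType}.
Local Notation C := R[i].

Lemma normc_cexp_le (z : C) : normc (cexp z) <= expR (normc z).
Proof.
by rewrite normc_cexp ler_expR (le_trans (ler_norm _))// Re_le_normc.
Qed.

Lemma normc_cexp_sub1 (z : C) : normc (cexp z - 1) <= 2 * normc z * expR (normc z).
Proof.
have := @cderive_bound _ (fun s : R => cexp (z * s%:C)) (fun s => z * cexp (z * s%:C))
  (normc z * expR (normc z)) 0 1 ler01.
rewrite mulr0 cexp0 mulr1 subr0 mulr1 mulrA; apply => s.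
  by move=> _; exact: cderive_exp_line.
rewrite in_itv /= => /andP[s0 s1]; rewrite normcM ler_wpM2l ?normc_ge0//.
rewrite (le_trans (normc_cexp_le _))// ler_expR normcM normc_real_ge0//.
by rewrite ler_piMr ?normc_ge0.
Qed.

Lemma normc_cexp_sub1D (z : C) :
  normc (cexp z - 1 - z) <= 4 * normc z ^+ 2 * expR (normc z).
Proof.
have := @cderive_bound _ (fun s : R => cexp (z * s%:C) - 1 - z * s%:C)
  (fun s => z * cexp (z * s%:C) - 0 - z * 1)
  (2 * normc z ^+ 2 * expR (normc z)) 0 1 ler01.
rewrite !mulr0 cexp0 subrr !subr0 !mulr1 !mulrA -natrM; apply => s.
  move=> _; apply: cderiveB; last exact: (cderive_eqr (cderiveZl z (cderive_id s)) (mulr1 z)).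
  by apply: cderiveB; [exact: cderive_exp_line|exact: cderive_cst].
rewrite in_itv /= => /andP[s0 s1].
have -> : z * cexp (z * s%:C) - 0 - z = z * (cexp (z * s%:C) - 1) by ring.
rewrite normcM -!mulrA [leRHS]mulrCA ler_wpM2l ?normc_ge0//.
have zs : normc (z * s%:C) <= normc z.
  by rewrite normcM normc_real_ge0// ler_piMr ?normc_ge0.
rewrite (le_trans (normc_cexp_sub1 _))// -mulrA ler_wpM2l//.
by rewrite ler_pM ?normc_ge0 ?expR_ge0// ler_expR.
Qed.

End exponential_estimates.

(** * The exponential formula by polynomial truncation *)

Section exponential_recursion.
Context {R : realType}.
Local Notation C := R[i].
Variables (c f : nat -> C) (A : R).
Hypothesis A1 : 1 <= A.
Hypothesis f_bound : forall j, normc (f j) <= A.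
Hypothesis c0 : c 0 = 1.
Hypothesis c_rec : forall k, k.+1%:R * c k.+1 = \sum_(j < k.+1) f j * c (k - j)%N.

(** The factor k + 1 on the left averages k + 1 terms, each at most A * A^(k - j) <= A^(k+1) because
    1 <= A. *)
Lemma coef_bound k : normc (c k) <= A ^+ k.
Proof.
have A0 : 0 <= A by exact: le_trans ler01 A1.
have [n] := ubnP k; elim: n k => // n IH [|k] kn; first by rewrite c0 normc1 expr0.
have kp : 0 < k.+1%:R :> R by [].
have := congr1 (@normc R) (c_rec k); rewrite normcM -Real_nat normc_real_ge0// => h.
rewrite -(ler_pM2l kp) h (le_trans (normc_sum _ _ _))//.
have -> : k.+1%:R * A ^+ k.+1 = \sum_(j < k.+1) A ^+ k.+1.
  by rewrite sumr_const card_ord mulr_natl.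
apply: ler_sum => j _; rewrite normcM exprS ler_pM ?normc_ge0//.
have jk : (k - j <= k)%N by exact: leq_subr.
apply: (@le_trans _ _ (A ^+ (k - j))); last exact: ler_weXn2l.
by apply: IH; exact: leq_ltn_trans jk _.
Qed.

Lemma cderive_poly (p : {poly C}) (s : R) : cderive (fun t : R => p.[t%:C]) s p^`().[s%:C].
Proof.
elim/poly_ind: p => [|p a IH].
  by under eq_fun do rewrite horner0; rewrite deriv0 horner0; exact: cderive_cst.
under eq_fun do rewrite hornerMXaddC.
rewrite derivMXaddC hornerD hornerMX addrC -[X in cderive _ _ X]addr0 -[X in _ * X + _ + _]mulr1.
apply: cderiveD; last exact: cderive_cst.
by apply: cderive_eqr (cderiveM IH (cderive_id s)) _; rewrite !mulr1.
Qed.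

Variable w : C.
(** The value 1/8 leaves room twice: one factor 2 per degree absorbs the k + 1 terms of a product
    coefficient, another the 2 K + 1 coefficients of the residual. *)
Hypothesis Aw : A * normc w <= 8^-1.

Let r := A * normc w.

Let r0 : 0 <= r. Proof. by rewrite mulr_ge0 ?normc_ge0// (le_trans ler01). Qed.

Let rX n : r ^+ n <= 8^-1 ^+ n.
Proof. by rewrite lerXn2r ?nnegrE. Qed.

Let fw j : normc (f j * w ^+ j.+1) <= r ^+ j.+1.
Proof.
rewrite normcM normcX /r exprMn ler_pM ?exprn_ge0 ?normc_ge0//.
by rewrite (le_trans (f_bound j))// ler_eXnr.
Qed.

Let cw k : normc (c k * w ^+ k) <= r ^+ k.
Proof.
by rewrite normcM normcX /r exprMn ler_wpM2r ?exprn_ge0 ?normc_ge0// coef_bound.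
Qed.

Let term j : C := f j * w ^+ j.+1 / j.+1%:R.

Let term_bound j : normc (term j) <= 2^-1 * 2^-1 ^+ j.
Proof.
rewrite /term normcM normcV -Real_nat normc_real_ge0// -exprS.
rewrite ler_pdivrMr// (le_trans (fw j))// (le_trans (rX _))//.
rewrite (@le_trans _ _ (2^-1 ^+ j.+1))//; last by rewrite ler_peMr ?exprn_ge0// ler1n.
by rewrite lerXn2r ?nnegrE// lef_pV2 ?posrE// ler_nat.
Qed.

(** Polynomials in s for the argument s w, the powers of w being part of the coefficients. For the
    full series Q' = P Q and Phi' = P. The constant coefficient of [Phi] is 0 because 0^-1 = 0. *)
Let P K : {poly C} := \poly_(j < K) (f j * w ^+ j.+1).
Let Q K : {poly C} := \poly_(k < K.+1) (c k * w ^+ k).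
Let Phi K : {poly C} := \poly_(j < K.+1) (f j.-1 * w ^+ j / j%:R).

Lemma deriv_exponent K : (Phi K)^`() = P K.
Proof.
apply/polyP => i; rewrite coef_deriv !coef_poly ltnS; case: ifP => // _; last by rewrite mul0rn.
by rewrite -[LHS]mulr_natr divfK// pnatr_eq0.
Qed.

(** Below degree K the coefficient is exactly the recursion. From K on, Q' contributes nothing, and
    k + 1 products of size 8^-(k+1) sum to at most 4^-(k+1), as k + 1 <= 2^(k+1). *)
Lemma residual_coef K k : normc ((P K * Q K - (Q K)^`())`_k) <=
  (if (k < K)%N then 0 else 4^-1 ^+ k.+1).
Proof.
rewrite coefB coef_deriv coefM [(Q K)`_k.+1]coef_poly ltnS.
have [kK|Kk] := ltnP k K.
  rewrite [X in normc X](_ : _ = 0) ?normc0//; apply/eqP; rewrite subr_eq0; apply/eqP.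
  rewrite -mulr_natl mulrA c_rec mulr_suml; apply: eq_bigr => j _.
  have jk : (j <= k)%N by rewrite -ltnS.
  rewrite !coef_poly (leq_ltn_trans jk kK) ltnS (leq_trans (leq_subr _ _) (ltnW kK)).
  have -> : w ^+ k.+1 = w ^+ j.+1 * w ^+ (k - j) by rewrite -exprD addSn subnKC.
  by ring.
rewrite mul0rn subr0 (le_trans (normc_sum _ _ _))//.
have h (j : 'I_k.+1) : normc ((P K)`_j * (Q K)`_(k - j)) <= 8^-1 ^+ k.+1.
  rewrite normcM !coef_poly; case: ifP => _; last by rewrite normc0 mul0r exprn_ge0.
  case: ifP => _; last by rewrite normc0 mulr0 exprn_ge0.
  have ek : (j.+1 + (k - j))%N = k.+1 by rewrite addSn subnKC// -ltnS.
  rewrite (@le_trans _ _ (r ^+ j.+1 * r ^+ (k - j)))//.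
    by rewrite ler_pM ?normc_ge0.
  by rewrite -exprD ek.
rewrite (le_trans (ler_sum _ (fun j _ => h j)))// sumr_const card_ord -[leLHS]mulr_natl.
have -> : 8^-1 = 2^-1 * 4^-1 :> R by field.
rewrite exprMn mulrA ler_piMl ?exprn_ge0// exprVn ler_pdivrMr ?exprn_gt0// mul1r.
by rewrite -natrX ler_nat ltnW// ltn_expl.
Qed.

Lemma residual_bound K (s : R) : 0 <= s <= 1 ->
  normc (((P K * Q K - (Q K)^`())).[s%:C]) <= 2^-1 ^+ K.
Proof.
move=> /andP[s0 s1].
have DK k := residual_coef K k; move: DK; set D := _ - _ => DK.
(* At most 2 K + 1 coefficients occur, each at most 4^-(K+1), and 2 K + 1 <= 2^(K+1). *)
have sD : (size D <= (K + K).+1)%N.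
  rewrite (leq_trans (size_polyD _ _))// geq_max size_polyN; apply/andP; split.
    rewrite (leq_trans (size_polyMleq _ _))// (leq_trans (leq_pred _))//.
    by rewrite -addnS leq_add ?size_poly.
  apply: (leq_trans (size_poly _ _)); apply: (leq_trans (leq_pred _)).
  by rewrite (leq_trans (size_poly _ _))// ltnS leq_addr.
rewrite (horner_coef_wide _ sD) (le_trans (normc_sum _ _ _))//.
have h (k : 'I_(K + K).+1) : normc (D`_k * s%:C ^+ k) <= 4^-1 ^+ K.+1.
  rewrite normcM normcX normc_real_ge0// (@le_trans _ _ (normc D`_k))//.
    by rewrite ler_piMr ?normc_ge0// exprn_ile1.
  rewrite (le_trans (DK k))//; case: ifPn => [_|]; first by rewrite exprn_ge0.
  by rewrite -leqNgt => Kk; rewrite ler_wiXn2l// invf_le1// ler1n.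
rewrite (le_trans (ler_sum _ (fun k _ => h k)))// sumr_const card_ord -[leLHS]mulr_natl.
have -> : 4^-1 = 2^-1 * 2^-1 :> R by field.
rewrite exprMn mulrA (@le_trans _ _ (2^-1 ^+ K.+1))//; last first.
  by rewrite exprS ler_piMl ?exprn_ge0// invf_le1// ler1n.
rewrite ler_piMl ?exprn_ge0// exprVn ler_pdivrMr ?exprn_gt0// mul1r.
rewrite -natrX ler_nat expnS mul2n addnn ltnW// -doubleS leq_double.
exact: ltn_expl.
Qed.

Lemma Phi_horner K (s : R) :
  (Phi K).[s%:C] = \sum_(j < K) term j * (s ^+ j.+1)%:C.
Proof.
rewrite horner_poly big_ord_recl /= invr0 mulr0 mul0r add0r.
by apply: eq_bigr => j _; rewrite RealX.
Qed.

Lemma Phi_bound K (s : R) : 0 <= s <= 1 -> normc (Phi K).[s%:C] <= 1.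
Proof.
move=> /andP[s0 s1]; rewrite Phi_horner (le_trans (normc_sum _ _ _))//.
apply: (@le_trans _ _ (\sum_(j < K) 2^-1 * 2^-1 ^+ j)).
  apply: ler_sum => j _; rewrite normcM normc_real_ge0 ?exprn_ge0//.
  by rewrite (le_trans _ (term_bound j))// ler_piMr ?normc_ge0// exprn_ile1.
elim: K => [|K IH]; first by rewrite big_ord0.
suff -> : \sum_(j < K.+1) 2^-1 * 2^-1 ^+ j = 1 - 2^-1 ^+ K.+1 :> R by rewrite gerBl exprn_ge0.
elim: K {IH} => [|K IH]; first by rewrite big_ord1 expr0 expr1; field.
by rewrite big_ord_recr IH [_ ^+ K.+2]exprS /=; field.
Qed.

(* The exponential formula is obtained from the truncated sums, which are
   polynomials: along [0, w] the product of the truncated series with the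
   exponential of minus the truncated exponent is almost constant. *)
Lemma exponential_formula :
  ccvg (series (fun k => c k * w ^+ k)) (cexp (cser term)).
Proof.
pose Z K (s : R) : C := (Q K).[s%:C] * cexp (- (Phi K).[s%:C]).
pose dZ K (s : R) : C := - ((P K * Q K - (Q K)^`()).[s%:C] * cexp (- (Phi K).[s%:C])).
have Zd K s : cderive (Z K) s (dZ K s).
  apply: cderive_eqr (cderiveM (cderive_poly (Q K) s)
    (cderive_cexp (cderiveN (cderive_poly (Phi K) s)))) _.
  by rewrite deriv_exponent /dZ hornerD hornerN hornerM; ring.
have exp_le (v : C) : normc v <= 1 -> normc (cexp v) <= expR 1.
  by move=> v1; rewrite (le_trans (normc_cexp_le _))// ler_expR.
have dZ_bound K s : s \in `[0, 1] -> normc (dZ K s) <= 2^-1 ^+ K * expR 1.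
  rewrite in_itv /= => s01; rewrite /dZ normcN normcM ler_pM ?normc_ge0//.
    exact: residual_bound.
  by apply: exp_le; rewrite normcN; exact: Phi_bound.
have Z1 K : normc (Z K 1 - 1) <= 2 * (2^-1 ^+ K * expR 1).
  have := cderive_bound ler01 (fun s _ => Zd K s) (dZ_bound K).
  suff -> : Z K 0 = 1 by rewrite subr0 mulr1.
  have -> : Z K 0 = (Q K).[0] * cexp (- (Phi K).[0]) by [].
  rewrite !horner_coef0 !coef_poly /= !expr0 c0 !mulr1 invr0 mulr0 oppr0 cexp0 mulr1.
  by [].
have PhiE K : (Phi K).[1] = series term K.
  have := Phi_horner K 1; rewrite Real1 => ->; rewrite /series /= big_mkord.
  by apply: eq_bigr => j _; rewrite expr1n Real1 mulr1.
have QE K : (Q K).[1] = series (fun k => c k * w ^+ k) K.+1.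
  rewrite horner_poly /series /= big_mkord; apply: eq_bigr => k _.
  by rewrite expr1n mulr1.
have cs : cvgn (series (fun j => 2^-1 * 2^-1 ^+ j : R)).
  by apply: cvg_series_geometric; rewrite invr_ge0 ler0n /= invf_lt1// ltr1n.
have cE := ccvg_cexp (ccvg_series term_bound cs).
have cD : ccvg (fun K => series (fun k => c k * w ^+ k) K.+1 - cexp (series term K)) 0.
  apply: (@ccvg_bound _ _ _ (fun K => 2 * expR 1 * expR 1 * 2^-1 ^+ K)) => [K|].
    rewrite subr0 -QE -PhiE.
    have -> : (Q K).[1] - cexp (Phi K).[1] = (Z K 1 - 1) * cexp (Phi K).[1].
      have -> : Z K 1 = (Q K).[1] * cexp (- (Phi K).[1]) by [].
      by rewrite mulrBl -mulrA cexpNM mulr1 mul1r.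
    rewrite normcM (@le_trans _ _ (2 * (2^-1 ^+ K * expR 1) * expR 1))//; last first.
      by rewrite le_eqVlt; apply/orP; left; apply/eqP; ring.
    rewrite ler_pM ?normc_ge0//; apply: exp_le.
    by have := @Phi_bound K 1; rewrite Real1; apply; rewrite ler01 lexx.
  rewrite -[X in _ --> X](mulr0 (2 * expR 1 * expR 1)).
  apply: cvgM; first exact: cvg_cst.
  by apply: cvg_expr; rewrite ger0_norm// invf_lt1// ltr1n.
have := ccvgD cD cE; rewrite add0r.
have -> : (fun K => series (fun k => c k * w ^+ k) K.+1 - cexp (series term K) + cexp (series term K))
    = (fun K => series (fun k => c k * w ^+ k) K.+1).
  by apply/funext => K; rewrite subrK.
exact: (ccvg_shiftS (u := series (fun k => c k * w ^+ k))).
Qed.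

End exponential_recursion.

(** * Complex limits and complex differentiability *)

Section complex_differentiability.
Context {R : realType}.
Local Notation C := R[i].
Local Notation Re := (@complex.Re R).

Lemma ccvg_cvg (u : nat -> C) (l : C) : ccvg u l -> (u : (C^o)^nat) @ \oo --> (l : C^o).
Proof.
move=> /ccvg_normc0 c0; apply/cvgrPdist_lt => e e0.
(* A positive element of R[i] is real. *)
have er : e = (Re e)%:C by case: e e0 => a b; rewrite ltcE /= => /andP[/eqP -> _].
have re0 : 0 < Re e by move: e0; rewrite er ltcR.
have /cvgrPdist_lt/(_ _ re0) := c0; apply: filterS => n.
rewrite sub0r normrN ger0_norm ?normc_ge0// => h.
by rewrite er normr_complex ltcR normcBC.
Qed.

(** Complex differentiability with a quadratic remainder, an estimate that can be summed or
    integrated term by term. *)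
Definition cdiff (f : C -> C) (z d : C) := exists K r, [/\ 0 <= K, 0 < r &
  forall t, normc t < r -> normc (f (z + t) - f z - d * t) <= K * normc t ^+ 2].

Lemma cdiff_derivable (f : C^o -> C^o) (z d : C) : cdiff f z d -> derivable f z 1.
Proof.
move=> [K [r [K0 r0 fK]]]; apply/cvg_ex; exists d; apply/cvgrPdist_lt => e e0.
have er : e = (Re e)%:C by case: e e0 => a b; rewrite ltcE /= => /andP[/eqP -> _].
have re0 : 0 < Re e by move: e0; rewrite er ltcR.
pose s := Num.min r (Re e / (K + 1)).
have K1 : 0 < K + 1 by rewrite ltr_wpDl.
have s0 : 0 < s by rewrite lt_min r0 divr_gt0.
apply/nbhs_ballP; exists s%:C; first by rewrite /= ltcR.
move=> t /=; rewrite -ball_normE /= sub0r normrN normr_complex ltcR lt_min => /andP[tr te] t0.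
have nt : 0 < normc t by rewrite normc_gt0.
rewrite er normr_complex ltcR.
have -> : d - t^-1 *: (f (t *: 1 + z) - f z) = - t^-1 * (f (z + t) - f z - d * t).
  have -> : t *: 1 + z = z + t :> C by rewrite /GRing.scale /= mulr1 addrC.
  rewrite /GRing.scale /=; move: (f (z + t) - f z) => X.
  by rewrite mulrBr !mulNr opprK [d * t]mulrC mulKf// addrC.
rewrite normcM normcN normcV (@le_lt_trans _ _ (K * normc t))//.
  by rewrite ler_pdivrMl// mulrCA -expr2; exact: fK.
by rewrite (@le_lt_trans _ _ ((K + 1) * normc t))// ?ler_wpM2r ?normc_ge0 ?lerDl// mulrC -ltr_pdivlMr.
Qed.

Lemma cdiff_cexp (f : C -> C) (z d : C) : cdiff f z d ->
  cdiff (fun t => cexp (f t)) z (d * cexp (f z)).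
Proof.
move=> [K [r [K0 r0 fK]]].
pose L := normc d + K.
have L0 : 0 <= L by rewrite addr_ge0// normc_ge0.
exists (normc (cexp (f z)) * (4 * L ^+ 2 * expR L + K)), (Num.min r 1).
split=> [||t]; first by rewrite mulr_ge0 ?normc_ge0// addr_ge0// !mulr_ge0 ?expR_ge0 ?sqr_ge0.
  by rewrite lt_min r0 ltr01.
rewrite lt_min => /andP[tr t1]; have h := fK t tr.
pose D := f (z + t) - f z.
have DL : normc D <= L * normc t.
  have -> : D = (D - d * t) + d * t by ring.
  rewrite (le_trans (le_normcD _ _))// /L mulrDl addrC; apply: lerD; first by rewrite normcM.
  rewrite (le_trans h)// ler_wpM2l// expr2 ler_piMl ?normc_ge0// ltW//.
have -> : cexp (f (z + t)) - cexp (f z) - d * cexp (f z) * t =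
    cexp (f z) * ((cexp D - 1 - D) + (D - d * t)).
  have -> : f (z + t) = f z + D by rewrite /D; ring.
  by rewrite cexpD; ring.
rewrite normcM -mulrA ler_wpM2l ?normc_ge0// (le_trans (le_normcD _ _))// mulrDl.
apply: lerD => //; rewrite (le_trans (normc_cexp_sub1D _))//.
have D1 : normc D <= L.
  by rewrite (le_trans DL)// ler_piMr// ltW.
have -> : 4 * L ^+ 2 * expR L * normc t ^+ 2 = 4 * ((L * normc t) ^+ 2 * expR L) by ring.
rewrite -mulrA ler_wpM2l//.
by rewrite ler_pM ?sqr_ge0 ?expR_ge0// ?ler_expR// lerXn2r ?nnegrE ?normc_ge0// mulr_ge0 ?normc_ge0.
Qed.

End complex_differentiability.

(** * Dirichlet series on the right half-plane *)

Section dirichlet_series.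
Context {R : realType}.
Local Notation C := R[i].
Local Notation Re := (@complex.Re R).
Variables (a : nat -> C) (A h : R).
Hypothesis h0 : 0 < h.
Hypothesis a_bound : forall k, normc (a k) <= A.

Definition dirichlet_term (z : C) (k : nat) : C := a k * cexp (- (z * (k.+1%:R * h)%:C)).

Definition dirichlet (z : C) : C := cser (dirichlet_term z).

Let A0 : 0 <= A := le_trans (normc_ge0 _) (a_bound 0).

Lemma cvg_series_exp (M x : R) : 0 < x ->
  cvgn (series (fun k => M * expR (- (x * (k.+1%:R * h))))).
Proof.
move=> x0; have -> : (fun k => M * expR (- (x * (k.+1%:R * h)))) =
    (fun k => M * expR (- (x * h)) * expR (- (x * h)) ^+ k).
  apply/funext => k; rewrite -mulrA -exprS -expRM_natl; congr (_ * expR _).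
  by ring.
apply: cvg_series_geometric; rewrite expR_ge0 /= expR_lt1 oppr_lt0 mulr_gt0//.
Qed.

Lemma dirichlet_term_bound z k :
  normc (dirichlet_term z k) <= A * expR (- (Re z * (k.+1%:R * h))).
Proof.
rewrite normcM normc_cexp cReN cReM /= mulr0 subr0 ler_wpM2r ?expR_ge0//.
Qed.

Lemma dirichlet_cvg z : 0 < Re z -> ccvg (series (dirichlet_term z)) (dirichlet z).
Proof.
move=> z0; have := @ccvg_series R (dirichlet_term z) _ (dirichlet_term_bound z).
by apply; exact: cvg_series_exp.
Qed.

(** Termwise the error is a multiple of exp (- v t) - 1 + v t, quadratic in v. With x = Re z and |v|
    < x / 2, the decay exp (- x t) pays for exp (|v| t) and for t^2, and leaves the summable exp (-
    x t / 4). *)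
Lemma dirichlet_cdiff z : 0 < Re z -> exists d, cdiff dirichlet z d.
Proof.
move=> z0; pose x := Re z; pose t k : R := k.+1%:R * h.
have t0 k : 0 <= t k by rewrite mulr_ge0// ltW.
pose d_term k : C := - (t k)%:C * dirichlet_term z k.
have d_bound k : normc (d_term k) <= A * (2 / x) * expR (- (x / 2 * t k)).
  rewrite /d_term normcM normcN normc_real_ge0// (@le_trans _ _ (t k * (A * expR (- (x * t k)))))//.
    by rewrite ler_wpM2l// dirichlet_term_bound.
  have y0 : 0 <= x / 2 * t k by rewrite mulr_ge0// divr_ge0// ltW.
  have := expr_le_expR 1 y0; rewrite !expr1 mul1r => y1.
  have -> : expR (- (x * t k)) = expR (- (x / 2 * t k)) * expR (- (x / 2 * t k)).
    by rewrite -expRD; congr expR; field.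
  have xn : x != 0 by rewrite gt_eqF.
  have E1 : x / 2 * t k * expR (- (x / 2 * t k)) <= 1.
    by rewrite expRN ler_pdivrMr ?expR_gt0// mul1r.
  move: E1; set E := expR _ => E1.
  have -> : t k * (A * (E * E)) = A * (2 / x) * E * (x / 2 * t k * E) by field.
  by rewrite ler_piMr// mulr_ge0 ?expR_ge0// mulr_ge0// divr_ge0// ltW.
have x20 : 0 < x / 2 by rewrite divr_gt0.
have x40 : 0 < x / 4 by rewrite divr_gt0.
have cd : ccvg (series d_term) (cser d_term).
  have := @ccvg_series R d_term _ d_bound.
  by apply; exact: cvg_series_exp.
exists (cser d_term).
(* The constant 64 is 16 * 2^2: x^2 t^2 = 16 (x t / 4)^2, and y^2 <= 2^2 exp y at y = x t / 4. *)
pose K0 := 4 * A * (64 / x ^+ 2).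
have K00 : 0 <= K0 by rewrite !mulr_ge0// invr_ge0 sqr_ge0.
have cK := cvg_series_exp (M := 1) x40.
pose S := limn (series (fun k => 1 * expR (- (x / 4 * (k.+1%:R * h))))).
have S0 : 0 <= S.
  apply: limr_ge => //; apply: nearW => n; rewrite /series /=.
  by apply: sumr_ge0 => k _; rewrite mul1r expR_ge0.
exists (K0 * S), (x / 2); split=> //; first exact: mulr_ge0.
move=> v vx.
have zv : 0 < Re (z + v).
  have := Re_le_normc v; rewrite cReD -/x ler_norml => /andP[h1 _].
  by move: h1 vx; lra.
have e : ccvg (series (fun k => dirichlet_term (z + v) k + (-1 * dirichlet_term z k + - v * d_term k)))
    (dirichlet (z + v) + (-1 * dirichlet z + - v * cser d_term)).
  by apply: cserD; [exact: dirichlet_cvg|apply: cserD; apply: cserZ => //; exact: dirichlet_cvg].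
have -> : dirichlet (z + v) - dirichlet z - cser d_term * v =
    dirichlet (z + v) + (-1 * dirichlet z + - v * cser d_term) by ring.
rewrite -(cser_unique e).
pose w k := normc v ^+ 2 * K0 * expR (- (x / 4 * (k.+1%:R * h))).
have -> : K0 * S * normc v ^+ 2 = limn (series w).
  apply/esym/cvg_lim => //.
  have -> : series w = (fun n => normc v ^+ 2 * K0 * series (fun k => 1 * expR (- (x / 4 * (k.+1%:R * h)))) n).
    apply/funext => n; rewrite /series /= mulr_sumr; apply: eq_bigr => k _.
    by rewrite mul1r.
  have -> : K0 * S * normc v ^+ 2 = normc v ^+ 2 * K0 * S by ring.
  by apply: cvgM => //; exact: cvg_cst.
apply: normc_cser; last exact: cvg_series_exp.
move=> k; rewrite -/(t k) -/(t k).
have -> : dirichlet_term (z + v) k + (-1 * dirichlet_term z k + - v * d_term k) =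
    dirichlet_term z k * (cexp (- (v * (t k)%:C)) - 1 - (- (v * (t k)%:C))).
  by rewrite /d_term /dirichlet_term -/(t k) mulrDl opprD cexpD; ring.
rewrite normcM (@le_trans _ _ (A * expR (- (x * t k)) * (4 * (normc v * t k) ^+ 2 * expR (normc v * t k))))//.
  rewrite ler_pM ?normc_ge0//; first exact: dirichlet_term_bound.
  have := normc_cexp_sub1D (- (v * (t k)%:C)).
  by rewrite normcN normcM normc_real_ge0.
have y0 : 0 <= x / 4 * t k by rewrite mulr_ge0// ltW.
have := expr_le_expR 2 y0 => y2.
have xn : x != 0 by rewrite gt_eqF.
have e1 : expR (normc v * t k) <= expR (x / 2 * t k) by rewrite ler_expR ler_wpM2r// ltW.
have e2 : t k ^+ 2 <= 64 / x ^+ 2 * expR (x / 4 * t k).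
  rewrite mulrAC ler_pdivlMr ?exprn_gt0//.
  have -> : t k ^+ 2 * x ^+ 2 = 16 * (x / 4 * t k) ^+ 2 by field.
  rewrite (le_trans (ler_wpM2l _ y2))// le_eqVlt; apply/orP; left; apply/eqP; ring.
have -> : A * expR (- (x * t k)) * (4 * (normc v * t k) ^+ 2 * expR (normc v * t k)) =
    (4 * A * normc v ^+ 2 * expR (- (x * t k))) * (t k ^+ 2 * expR (normc v * t k)) by ring.
have -> : w k = (4 * A * normc v ^+ 2 * expR (- (x * t k))) *
    (64 / x ^+ 2 * expR (x / 4 * t k) * expR (x / 2 * t k)).
  rewrite /w -/(t k) /K0.
  have -> : expR (- (x / 4 * t k)) = expR (- (x * t k)) * expR (x / 4 * t k) * expR (x / 2 * t k).
    by rewrite -!expRD; congr expR; field.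
  by ring.
apply: ler_wpM2l; last by apply: ler_pM; rewrite ?sqr_ge0 ?mulr_ge0 ?expR_ge0.
apply: mulr_ge0; last exact: expR_ge0.
by apply: mulr_ge0; [exact: mulr_ge0|exact: sqr_ge0].
Qed.

End dirichlet_series.

(** * Limit of the step-processes *)

Section riemann_sums.
Context {R : realType}.
Local Notation mu := (@lebesgue_measure R).
Local Notation T := (measurableTypeR R).
Local Notation C := R[i].
Implicit Types (phi : R -> C) (g : R -> R) (h t : R).

Lemma rint_indic_itv (a b : R) (c d : bool) :
  rint mu (fun t => \1_[set` Interval (BSide c a) (BSide d b)] t) /\
  (a <= b -> \int[mu]_t (\1_[set` Interval (BSide c a) (BSide d b)] t) = b - a).
Proof.
have me := lebesgue_measure_itv (Interval (BSide c a) (BSide d b)).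
split; first exact: integrable_indic_itv.
rewrite le_eqVlt => ab.
have e : (\int[mu]_t (\1_[set` Interval (BSide c a) (BSide d b)] t)%:E)%E =
    (if (a%:E < b%:E)%E then b%:E - a%:E else 0)%E.
  apply: etrans (@integral_indic _ T R mu setT measurableT _ (measurable_itv (Interval (BSide c a) (BSide d b)))) _.
  by rewrite setIT; exact: me.
rewrite /Rintegral e lte_fin; case: ltP => ab' //.
by move: ab; rewrite ltNge ab' orbF => /eqP ->; rewrite subrr.
Qed.

(* The cells are [k h, (k+1) h), except that the first one excludes 0, where
   phi may be unbounded. *)
Definition cell h (k : nat) : set R :=
  [set` Interval (BSide (0 < k)%N (k%:R * h)) (BLeft (k.+1%:R * h))].

(** The value of phi at the right end of the cell of t; evaluating to the right of t is what
    [step_fun_bound] exploits. *)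
Definition step_fun phi h t : C :=
  if 0 < t then phi ((Num.truncn (t / h)).+1%:R * h) else 0.

Definition trunc_step phi h (K : nat) t : C :=
  \sum_(k < K) phi (k.+1%:R * h) * (\1_(cell h k) t)%:C.

Lemma cellP h k t : 0 < h ->
  reflect [/\ 0 < t, k%:R * h <= t & t < k.+1%:R * h] (t \in cell h k).
Proof.
move=> h0; rewrite mem_setE in_itv /=; case: k => [|k].
  by rewrite mul0r; apply: (iffP andP) => [[a b]|[a _ b]]; split => //; exact: ltW.
apply: (iffP andP) => [[a b]|[_ a b]]; split => //.
by rewrite (lt_le_trans _ a)// mulr_gt0.
Qed.

Lemma trunc_stepE phi h K t : 0 < h ->
  trunc_step phi h K t = if t < K%:R * h then step_fun phi h t else 0.
Proof.
move=> h0; rewrite /step_fun; elim: K => [|K IH].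
  by rewrite /trunc_step big_ord0 mul0r; case: ltgtP.
rewrite /trunc_step big_ord_recr /= -/(trunc_step phi h K t) IH indicE.
have KS : K%:R * h < K.+1%:R * h by rewrite ltr_pM2r// ltr_nat.
case: (cellP K t h0) => [[t0 tK tS]|tc].
  rewrite ltNge tK add0r mulr1n mulr1 tS t0.
  by rewrite (@truncn_def _ _ K)// ler_pdivlMr// ltr_pdivrMr// tK tS.
rewrite mulr0n mulr0 addr0; have [tK|tK] := ltP t (K%:R * h).
  by rewrite (lt_trans tK KS).
case: ltP => // tS; case: ltP => // t0; by case: tc.
Qed.

Lemma cint_cell h k : cint mu (fun t => (\1_(cell h k) t)%:C).
Proof. by split; [exact: (rint_indic_itv _ _ _ _).1|exact: rint0]. Qed.

Lemma cint_trunc_step phi h K : cint mu (trunc_step phi h K).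
Proof. by apply: cint_sum => i; apply: cintZl; exact: cint_cell. Qed.

Lemma cintegral_trunc_step phi h K : 0 < h ->
  cintegral mu (trunc_step phi h K) = series (fun k => h%:C * phi (k.+1%:R * h)) K.
Proof.
move=> h0; rewrite /trunc_step cintegral_sum; last first.
  by move=> i; apply: cintZl; exact: cint_cell.
rewrite /series /= big_mkord; apply: eq_bigr => i _.
rewrite cintegralZl; last exact: cint_cell.
rewrite mulrC; apply: (congr1 (fun z : C => z * _)).
rewrite cintegral_real /cell (rint_indic_itv _ _ _ _).2; last by rewrite ler_wpM2r ?(ltW h0)// ler_nat.
by rewrite -mulrBl -natr1 addrAC subrr add0r mul1r.
Qed.

(** The partial sums of the series are integrals of the truncations of one step function, so
    dominated convergence in the number of cells applies. *)
Lemma riemann_series phi g h : 0 < h -> rint mu g -> (forall t, normc (step_fun phi h t) <= g t) ->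
  cint mu (step_fun phi h) /\
  ccvg (series (fun k => h%:C * phi (k.+1%:R * h))) (cintegral mu (step_fun phi h)).
Proof.
move=> h0 ig phig.
have -> : series (fun k => h%:C * phi (k.+1%:R * h)) =
    (fun K => cintegral mu (trunc_step phi h K)).
  by apply/funext => K; rewrite cintegral_trunc_step.
refine (@cdct _ T R mu (trunc_step phi h) (step_fun phi h) g _ ig _ _).
- by move=> K; exact: cint_cmeas (cint_trunc_step phi h K).
- move=> K t; rewrite trunc_stepE//; case: ifP => _ //.
  by rewrite normc0 (le_trans _ (phig t))// normc_ge0.
- move=> t; apply: ccvg_near_cst; have := near_nat_ge (t / h + 1).
  apply: filterS => K tK; rewrite trunc_stepE// ifT// -ltr_pdivrMr//.
  by rewrite (lt_le_trans _ tK)// ltrDl.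
Qed.

(** A second dominated convergence, now as the mesh tends to 0: g dominates all the step functions
    at once, and the evaluation point is within h n of t. *)
Lemma riemann_cvg phi g (h : nat -> R) (u : nat -> C) : (forall n, 0 < h n) -> h @ \oo --> 0 -> rint mu g ->
  (forall n t, normc (step_fun phi (h n) t) <= g t) ->
  (forall t (s : nat -> R), 0 < t -> (forall n, 0 < s n) -> s @ \oo --> t ->
    ccvg (fun n => phi (s n)) (phi t)) ->
  (forall n, ccvg (series (fun k => (h n)%:C * phi (k.+1%:R * h n))) (u n)) ->
  cint mu (fun t => if 0 < t then phi t else 0) /\
  ccvg u (cintegral mu (fun t => if 0 < t then phi t else 0)).
Proof.
move=> h0 hc ig phig phic us.
have -> : u = (fun n => cintegral mu (step_fun phi (h n))).
  apply/funext => n; have [_ cs] := riemann_series (h0 n) ig (phig n).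
  exact: ccvg_unique (us n) cs.
refine (@cdct _ T R mu _ _ g _ ig phig _).
  by move=> n; have [/cint_cmeas] := riemann_series (h0 n) ig (phig n).
move=> t; rewrite /step_fun; case: ltP => [t0|_]; last exact: ccvg_cst.
apply: phic => // [n|]; first by rewrite mulr_gt0.
apply: (@squeeze_cvgr _ _ _ _ (fun n => t) (fun n => t + h n)); last 2 first.
- exact: cvg_cst.
- by rewrite -[X in _ --> X]addr0; apply: cvgD => //; exact: cvg_cst.
apply: nearW => n; have th : 0 <= t / h n by rewrite divr_ge0// ltW.
have /andP[a1 a2] := truncn_itv th.
rewrite -ler_pdivrMr// (ltW a2) /= -natr1 mulrDl mul1r lerD2r.
by rewrite -ler_pdivlMr.
Qed.

Lemma step_fun_bound phi g h : 0 < h -> (forall t, 0 <= g t) ->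
  (forall s t, 0 < t -> t < s -> normc (phi s) <= g t) ->
  forall t, normc (step_fun phi h t) <= g t.
Proof.
move=> h0 g0 pg t; rewrite /step_fun; case: ltP => [t0|_]; last by rewrite normc0.
apply: pg => //; rewrite -ltr_pdivrMr//; exact: truncnS_gt.
Qed.

End riemann_sums.

(** * Integrability of a power at the origin *)

Section power_singularity.
Context {R : realType}.
Local Notation mu := (@lebesgue_measure R).
Local Notation T := (measurableTypeR R).

(** On intervals away from 0 the antiderivative t^a / a bounds the integral by 1/a; monotone
    convergence then reaches 0. *)
Lemma rint_powR (a : R) : 0 < a ->
  rint mu (fun t => if (0 < t) && (t <= 1) then t `^ (a - 1) else 0).
Proof.
move=> a0; pose f t : R := if (0 < t) && (t <= 1) then t `^ (a - 1) else 0.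
(* The cut-off 1 / (n + 2) is below 1 for every n, so the interval is nondegenerate. *)
pose f_ n t : R := if t \in `[n.+2%:R^-1, 1] then t `^ (a - 1) else 0.
have f0 n t : 0 <= f_ n t by rewrite /f_; case: ifP => // _; exact: powR_ge0.
have mf n : measurable_fun setT (f_ n : T -> R).
  rewrite (_ : f_ n = (fun t => t `^ (a - 1)) \_ `[n.+2%:R^-1, 1]); last first.
    by apply/funext => t; rewrite patchE mem_setE.
  apply/(measurable_restrictT _ _).1 => //; apply: measurable_funTS.
  exact: measurable_powR.
have fc t : (fun n => f_ n t) @ \oo --> f t.
  apply: cvg_near_cst; rewrite /f_ /f; case: (ltP 0 t) => [t0|t0] /=; last first.
    apply: nearW => n; rewrite in_itv /= leNgt (le_lt_trans t0) ?invr_gt0//.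
  have := near_nat_ge t^-1; apply: filterS => n tn; rewrite in_itv /=.
  suff -> : n.+2%:R^-1 <= t by [].
  by rewrite invf_ple ?posrE// (le_trans tn)// ler_nat -addn2 leq_addr.
have If n : (\int[mu]_t (f_ n t)%:E <= (a^-1)%:E)%E.
  have n1 : n.+2%:R^-1 < 1 :> R by rewrite invf_lt1// ltr1n.
  have n0 : 0 < n.+2%:R^-1 :> R by rewrite invr_gt0.
  have dF (t : R) : 0 < t -> is_derive t 1 (fun t => a^-1 * t `^ a) (t `^ (a - 1)).
    move=> t0; apply: is_derive_eqr (is_deriveMr (is_derive_cst _ _ _) (is_derive1_powR a t0)) _.
    by rewrite mul0r add0r mulKf// gt_eqF.
  have dp (t : R) : t \in `[n.+2%:R^-1, 1] -> 0 < t.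
    by rewrite in_itv /= => /andP[h _]; exact: lt_le_trans h.
  have cp (b t : R) : 0 < t -> {for t, continuous (fun t : R => t `^ b)}.
    move=> t0; apply/differentiable_continuous/derivable1_diffP.
    by have [] := is_derive1_powR b t0.
  have := @continuous_FTC2 R (fun t => t `^ (a - 1)) (fun t => a^-1 * t `^ a) _ _ n1.
  rewrite (_ : (\int[mu]_t (f_ n t)%:E)%E = (\int[mu]_(t in `[(n.+2%:R^-1)%R : R, 1%R]) (t `^ (a - 1))%R%:E)%E); last first.
    rewrite [RHS]integral_mkcond; apply: eq_integral => t _.
    by rewrite patchE mem_setE /f_; case: ifP.
  move=> ->.
  - rewrite powR1 mulr1 -EFinB lee_fin gerBl mulr_ge0 ?powR_ge0// invr_ge0 ltW//.
  - apply: continuous_in_subspaceT => t; rewrite mem_setE => /dp; exact: cp.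
  - have cF (t : R) : 0 < t -> (fun t : R => a^-1 * t `^ a) x @[x --> t] --> a^-1 * t `^ a.
      by move=> t0; apply: cvgM; [exact: cvg_cst|exact: cp].
    split.
    + by move=> t /subset_itv_oo_cc /dp /dF [].
    + by apply: cvg_at_right_filter; exact: cF.
    + by apply: cvg_at_left_filter; exact: cF.
  - by move=> t /subset_itv_oo_cc /dp /dF [_ <-]; rewrite derive1E.
have mfl : measurable_fun setT (f : T -> R).
  by apply: (measurable_fun_cvg mf) => t _; exact: fc.
apply/integrableP; split; first exact/measurable_EFinP.
apply: (@le_lt_trans _ _ (a^-1)%:E); last exact: ltry.
rewrite (_ : (fun x => _) = (fun t => limn (fun n => (f_ n t)%:E))); last first.
  apply/funext => t; apply/esym/cvg_lim => //=.
  rewrite ger0_norm; last by case: ifP => // _; exact: powR_ge0.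
  by apply/cvg_EFin; [exact: nearW|exact: fc].
have mc : (\int[mu]_t (f_ n t)%:E)%E @[n --> \oo] --> (\int[mu]_t limn (fun n => (f_ n t)%:E))%E.
  apply: (@cvg_monotone_convergence _ T R mu setT measurableT (fun n t => (f_ n t)%:E)).
  - by move=> n; exact/measurable_EFinP.
  - by move=> n t _; rewrite lee_fin.
  - move=> t _ n m nm; rewrite lee_fin /f_; case: ifP => [|_]; last by case: ifP => // _; exact: powR_ge0.
    rewrite !in_itv /= => /andP[h ->]; rewrite andbT (le_trans _ h)//.
    by rewrite lef_pV2 ?posrE// ler_nat.
by apply: (cvge_le _ mc); apply: nearW => n; exact: If.
Qed.

End power_singularity.

Section complex_chain_rule.
Context {R : realType}.
Local Notation C := R[i].

Lemma normc_cexp_ray (z : C) (t : R) :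
  normc (cexp (- (z * t%:C))) = expR (- (complex.Re z * t)).
Proof. by rewrite normc_cexp cReN cReM /= mulr0 subr0. Qed.

Lemma is_derive_quadratic (f : R -> R) (x d K r : R) : 0 <= K -> 0 < r ->
  (forall t, `|t| < r -> `|f (x + t) - f x - d * t| <= K * t ^+ 2) -> is_derive x 1 f d.
Proof.
move=> K0 r0 fK.
have c : h^-1 *: (f (h *: 1 + x) - f x) @[h --> 0^'] --> d.
  apply/cvgrPdist_lt => e e0.
  have K1 : 0 < K + 1 by rewrite ltr_wpDl.
  have s0 : 0 < Num.min r (e / (K + 1)) by rewrite lt_min r0 divr_gt0.
  apply/nbhs_ballP; exists (Num.min r (e / (K + 1))) => //.
  move=> t /=; rewrite -ball_normE /= sub0r normrN lt_min => /andP[tr te] t0.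
  have nt : 0 < `|t| by rewrite normr_gt0.
  have -> : d - t^-1 *: (f (t *: 1 + x) - f x) = - t^-1 * (f (x + t) - f x - d * t).
    have -> : t *: 1 + x = x + t by rewrite /GRing.scale /= mulr1 addrC.
    rewrite /GRing.scale /=; move: (f (x + t) - f x) => X.
    by rewrite mulrBr !mulNr opprK [d * t]mulrC mulKf// addrC.
  rewrite normrM normrN normfV (@le_lt_trans _ _ (K * `|t|))//.
    by rewrite ler_pdivrMl// mulrCA -expr2 real_normK ?num_real//; exact: fK.
  rewrite (@le_lt_trans _ _ ((K + 1) * `|t|))// ?ler_wpM2r// ?lerDl//.
  by rewrite mulrC -ltr_pdivlMr.
split; first by apply/cvg_ex; exists d.
exact/cvg_lim.
Qed.

Lemma cdiff_cderive (F : C -> C) (z d : C) (r : R) : cdiff F (z * r%:C) d ->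
  cderive (fun s => F (z * s%:C)) r (d * z).
Proof.
move=> [K [e [K0 e0 FK]]].
pose B := K * normc z ^+ 2; pose q := e / (normc z + 1).
have z1 : 0 < normc z + 1 by rewrite ltr_wpDl// normc_ge0.
have B0 : 0 <= B by rewrite mulr_ge0// sqr_ge0.
have q0 : 0 < q by rewrite divr_gt0.
have bd t : `|t| < q -> normc (F (z * (r + t)%:C) - F (z * r%:C) - d * z * t%:C) <= B * t ^+ 2.
  move=> tq; have zt : normc (z * t%:C) < e.
    rewrite normcM normc_real (@le_lt_trans _ _ (`|t| * (normc z + 1)))//.
      by rewrite mulrC ler_wpM2l// lerDl.
    by rewrite -ltr_pdivlMr.
  have := FK _ zt; rewrite -mulrDr -RealD mulrA normcM normc_real exprMn.
  by rewrite real_normK ?num_real// mulrA.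
split; apply: (is_derive_quadratic B0 q0) => t /bd; apply: le_trans.
- have de : complex.Re (d * z * t%:C) = complex.Re (d * z) * t by rewrite mulrC cRe_rM mulrC.
  by rewrite -de -!cReB Re_le_normc.
- have de : complex.Im (d * z * t%:C) = complex.Im (d * z) * t by rewrite mulrC cIm_rM mulrC.
  by rewrite -de -!cImB Im_le_normc.
Qed.

End complex_chain_rule.

(** * The exponent of the limit process *)

Section laplace_exponent.
Context {R : realType} (N : nat).
Hypotheses (N_gt2 : (2 < N)%N) (N_even : ~~ odd N).
Local Notation mu := (@lebesgue_measure R).
Local Notation T := (measurableTypeR R).
Local Notation C := R[i].
Local Notation Re := (@complex.Re R).
Variables (m nu : R).
Hypothesis nu_ge0 : 0 <= nu.

Local Notation psi := (psi N m nu).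

(* [t `^ -1] is [t^-1] for positive t. *)
Definition frullani_term (z : C) (t : R) : C :=
  (psi t - 1) * (t `^ (- 1))%:C * cexp (- (z * t%:C)).

Definition laplace_exponent (z : C) : C :=
  cintegral mu (fun t => if 0 < t then frullani_term z t else 0).

(** Minus the derivative of [laplace_exponent], by [laplace_exponent_cdiff]. *)
Definition laplace_psi1 (z : C) : C :=
  cintegral mu (fun t => if 0 < t then (psi t - 1) * cexp (- (z * t%:C)) else 0).

Let B : R := decay_const N + 1.
Let B0 : 0 <= B.
Proof. by rewrite addr_ge0// decay_const_ge0. Qed.

Lemma psi_sub1_bound t : 0 < t -> normc (psi t - 1) <= B.
Proof.
by move=> t0; rewrite (le_trans (le_normcD _ _))// normcN normc1 lerD2r; exact: psi_bound.
Qed.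

(** On ]0, 1] the power t^(1/N - 1) comes from [psi_sub1] divided by t; beyond 1 that power is at
    most 1 and the exponential remains. The bound at t controls the term at every s >= t, as Riemann
    sums over right end points require. *)
Definition frullani_dom (x t : R) : R :=
  (2 * `|m| + nu) * decay_const N *
  ((if (0 < t) && (t <= 1) then t `^ (N%:R^-1 - 1) else 0) +
   (if 0 <= t then expR (- (x * t)) else 0)).

Lemma frullani_dom_ge0 x t : 0 <= frullani_dom x t.
Proof.
rewrite mulr_ge0//; first by rewrite mulr_ge0 ?decay_const_ge0// addr_ge0// mulr_ge0.
by rewrite addr_ge0//; case: ifP => // _; rewrite ?powR_ge0 ?expR_ge0.
Qed.

Lemma rint_frullani_dom x : 0 < x -> rint mu (frullani_dom x).
Proof.
move=> x0; apply: rintZl; apply: rintD; last exact: (integral_exp_half_line x0).1.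
by apply: rint_powR; rewrite invr_gt0 ltr0n (N_gt0 N_gt2).
Qed.

Lemma frullani_term_bound (x : R) (z : C) (s t : R) : 0 < x -> x <= Re z -> 0 < t -> t <= s ->
  normc (frullani_term z s) <= frullani_dom x t.
Proof.
move=> x0 xz t0 ts; have s0 := lt_le_trans t0 ts.
pose K : R := (2 * `|m| + nu) * decay_const N.
have K0 : 0 <= K by rewrite mulr_ge0 ?decay_const_ge0// addr_ge0// mulr_ge0.
rewrite /frullani_term 2!normcM normc_real_ge0 ?powR_ge0// normc_cexp_ray.
have a1 : N%:R^-1 - 1 <= 0 :> R.
  by rewrite subr_le0 invf_le1 ?ltr0n ?ler1n (N_gt0 N_gt2).
apply: (@le_trans _ _ (K * s `^ (N%:R^-1 - 1) * expR (- (x * s)))).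
  apply: ler_pM; rewrite ?expR_ge0 ?mulr_ge0 ?normc_ge0 ?powR_ge0//; last first.
    by rewrite ler_expR lerN2 ler_wpM2r// ltW.
  rewrite powRD; last by rewrite (gt_eqF s0) implybT.
  rewrite mulrA. rewrite ler_wpM2r ?powR_ge0//.
  by have := psi_sub1 N_gt2 N_even m nu_ge0 s0; rewrite /root_scale powRN invrK.
rewrite -mulrA /frullani_dom -/K ler_wpM2l// t0 (ltW t0) /=.
have e1 : expR (- (x * s)) <= expR (- (x * t)).
  by rewrite ler_expR lerN2 ler_wpM2l// ltW.
have e2 : expR (- (x * t)) <= 1 by rewrite -expR0 ler_expR oppr_le0 mulr_ge0// ltW.
have st : s `^ (N%:R^-1 - 1) <= t `^ (N%:R^-1 - 1).
  rewrite -[_ - _]opprK !(powRN _ (- (N%:R^-1 - 1))) lef_pV2 ?posrE ?powR_gt0//.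
  by rewrite ge0_ler_powR ?nnegrE ?oppr_ge0// ltW.
have [t1|t1] := leP t 1.
  rewrite (@le_trans _ _ (t `^ (N%:R^-1 - 1) * 1))//; last by rewrite mulr1 lerDl expR_ge0.
  by rewrite ler_pM ?powR_ge0 ?expR_ge0// (le_trans e1).
rewrite add0r (@le_trans _ _ (1 * expR (- (x * t))))//; last by rewrite mul1r.
rewrite ler_pM ?powR_ge0 ?expR_ge0//.
by have := ler_powR (le_trans (ltW t1) ts) a1; rewrite powRr0.
Qed.

Lemma measurable_gt0 : measurable_fun setT (fun t : T => 0 < t : bool).
Proof.
apply: (measurable_fun_bool true); rewrite setTI.
rewrite (_ : _ @^-1` _ = `]0, +oo[%classic); first exact: measurable_itv.
by apply/seteqP; split => t /=; rewrite in_itv /= andbT.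
Qed.

Lemma cmeas_positive_part (f : R -> C) : cmeas (f : T -> C) ->
  cmeas ((fun t => if 0 < t then f t else 0) : T -> C).
Proof. by move=> mf; apply: cmeas_if => //; exact: measurable_gt0. Qed.

Lemma cmeas_psi_exp (z : C) : cmeas ((fun t => (psi t - 1) * cexp (- (z * t%:C))) : T -> C).
Proof.
have mp : cmeas ((fun t => psi t - 1) : T -> C).
  exact: (cmeasB (cmeas_psi N m nu_ge0) (cmeas_cst T (1 : C))).
apply: (cmeasM mp); apply: cmeas_cexp; apply: cmeasN; apply: cmeasM; first exact: cmeas_cst.
exact: cmeas_real.
Qed.

Lemma cmeas_frullani_term (z : C) : cmeas (frullani_term z : T -> C).
Proof.
rewrite (_ : frullani_term z = fun t => (t `^ (- 1))%:C * ((psi t - 1) * cexp (- (z * t%:C)))).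
  apply: cmeasM; last exact: cmeas_psi_exp.
  by apply: cmeas_real; exact: measurable_powR.
by apply/funext => t; rewrite /frullani_term mulrAC mulrC.
Qed.

Lemma cint_frullani_term (z : C) : 0 < Re z ->
  cint mu (fun t => if 0 < t then frullani_term z t else 0).
Proof.
move=> z0; apply: (cint_le _ (rint_frullani_dom z0)).
  exact: (cmeas_positive_part (cmeas_frullani_term z)).
move=> t; case: ltP => [t0|_]; last by rewrite normc0 frullani_dom_ge0.
exact: frullani_term_bound.
Qed.

Lemma cint_psi_exp (z : C) : 0 < Re z ->
  cint mu (fun t => if 0 < t then (psi t - 1) * cexp (- (z * t%:C)) else 0).
Proof.
move=> z0; apply: (cint_le _ (rintZl B (integral_exp_half_line z0).1)).
  exact: (cmeas_positive_part (cmeas_psi_exp z)).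
move=> t; case: ltP => [t0|_]; last first.
  by rewrite normc0 mulr_ge0//; case: ifP => // _; exact: expR_ge0.
rewrite (ltW t0) normcM normc_cexp_ray ler_wpM2r ?expR_ge0//.
exact: psi_sub1_bound.
Qed.

Definition psi_coef (h : R) (k : nat) : C := (k.+1%:R^-1)%:C * (psi (k.+1%:R * h) - 1).

Lemma psi_coef_bound h k : 0 < h -> normc (psi_coef h k) <= B.
Proof.
move=> h0; rewrite normcM normc_real_ge0//.
rewrite (@le_trans _ _ (1 * normc (psi (k.+1%:R * h) - 1)))//.
  by rewrite ler_wpM2r ?normc_ge0// invf_le1// ler1n.
by rewrite mul1r; apply: psi_sub1_bound; rewrite mulr_gt0.
Qed.

(** The weight 1 / (k + 1) is h times the value of 1/t at t = (k + 1) h, which makes the Dirichlet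
    series a Riemann sum of [frullani_term]. *)
Lemma dirichlet_psi_cvg (z : C) (h : nat -> R) : 0 < Re z -> (forall n, 0 < h n) -> h @ \oo --> 0 ->
  ccvg (fun n => dirichlet (psi_coef (h n)) (h n) z) (laplace_exponent z).
Proof.
move=> z0 h0 hc.
apply: (@riemann_cvg R (frullani_term z) (frullani_dom (Re z)) h _ h0 hc _ _ _ _).2.
- exact: rint_frullani_dom.
- move=> n t; apply: step_fun_bound => //; first exact: frullani_dom_ge0.
  by move=> s u u0 us; apply: frullani_term_bound => //; exact: ltW.
- move=> t s t0 s0 st; apply: ccvgM; first apply: ccvgM.
  + by apply: ccvgB; [exact: psi_cvg|exact: ccvg_cst].
  + apply: ccvg_real; rewrite powR_inv1 ?(ltW t0)//.
    rewrite (_ : (fun n => _) = fun n => (s n)^-1); first by apply: cvgV => //; rewrite gt_eqF.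
    by apply/funext => n; rewrite powR_inv1// ltW.
  + apply: ccvg_cexp; apply: ccvgN; apply: ccvgM; first exact: ccvg_cst.
    exact: ccvg_real.
- move=> n; have := dirichlet_cvg (h0 n) (fun k => psi_coef_bound k (h0 n)) z0.
  rewrite (_ : dirichlet_term _ _ _ = fun k => (h n)%:C * frullani_term z (k.+1%:R * h n))//.
  apply/funext => k; rewrite /dirichlet_term /frullani_term /psi_coef.
  have kh : 0 < k.+1%:R * h n by rewrite mulr_gt0.
  have -> : k.+1%:R^-1 = h n * (k.+1%:R * h n) `^ (-1).
    by rewrite powR_inv1 ?(ltW kh)// invfM mulrCA divff ?gt_eqF// mulr1.
  rewrite (RealM (h n)); move: (cexp _) (psi _) (h n)%:C (_ `^ _)%:C => e p a b.
  by ring.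
Qed.

End laplace_exponent.

Section laplace_exponent_properties.
Context {R : realType} (N : nat).
Hypotheses (N_gt2 : (2 < N)%N) (N_even : ~~ odd N).
Local Notation mu := (@lebesgue_measure R).
Local Notation T := (measurableTypeR R).
Local Notation C := R[i].
Local Notation Re := (@complex.Re R).
Variables (m nu : R).
Hypothesis nu_ge0 : 0 <= nu.

Local Notation psi := (psi N m nu).
Local Notation fterm := (frullani_term N m nu).
Local Notation lexpo := (laplace_exponent N m nu).
Local Notation lpsi1 := (laplace_psi1 N m nu).

(** The continuous analogue of [dirichlet_cdiff]. The factor 1/t cancels one power of t in the
    quadratic remainder, and the other is paid for by t exp (- x t / 4) <= 4 / x. *)
Lemma laplace_exponent_cdiff (z : C) : 0 < Re z ->
  cdiff lexpo z (- lpsi1 z).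
Proof.
move=> z0; pose x := Re z; pose B : R := decay_const N + 1.
have B0 : 0 <= B by rewrite addr_ge0// decay_const_ge0.
have x4 : 0 < x / 4 by rewrite divr_gt0.
have xn : x != 0 by rewrite gt_eqF.
pose half (t : R) : R := if 0 <= t then expR (- (x / 4 * t)) else 0.
have half_ge0 t : 0 <= half t by rewrite /half; case: ifP => // _; exact: expR_ge0.
have [ih eh] : rint mu half /\ \int[mu]_t half t = (x / 4)^-1 := integral_exp_half_line x4.
pose K : R := 4 * B * (4 / x).
have K0 : 0 <= K by rewrite !mulr_ge0// invr_ge0 ltW.
exists (2 * (K * (x / 4)^-1)), (x / 2); split.
- by rewrite !mulr_ge0// invr_ge0 ltW.
- by rewrite divr_gt0.
move=> v vx.
have zv : 0 < Re (z + v).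
  have := Re_le_normc v; rewrite cReD -/x ler_norml => /andP[h1 _].
  by move: h1 vx; lra.
have c1 := cint_frullani_term N_gt2 N_even m nu_ge0 zv.
have c2 := cint_frullani_term N_gt2 N_even m nu_ge0 z0.
have c3 := cint_psi_exp N_gt2 N_even m nu_ge0 z0.
pose F (t : R) : C := (if 0 < t then fterm (z + v) t else 0) -
  (if 0 < t then fterm z t else 0) +
  v * (if 0 < t then (psi t - 1) * cexp (- (z * t%:C)) else 0).
have c12 := cintB c1 c2.
have cF : cint mu F by exact: (cintD c12 (cintZl v c3)).
have -> : lexpo (z + v) - lexpo z - - lpsi1 z * v = cintegral mu F.
  apply/esym; apply: etrans (cintegralD c12 (cintZl v c3)) _.
  rewrite (cintegralB c1 c2) (cintegralZl v c3) mulNr opprK.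
  by apply: (congr1 (fun w : C => _ + w)); exact: mulrC.
have -> : 2 * (K * (x / 4)^-1) * normc v ^+ 2 = 2 * \int[mu]_t (K * normc v ^+ 2 * half t).
  by rewrite RintegralZl// eh; ring.
apply: cintegral_norm; [exact: cint_cmeas cF|exact: rintZl|].
move=> t; have half0 := half_ge0 t; rewrite /F; case: ltP => [t0|_]; last first.
  rewrite subr0 add0r mulr0 normc0; apply: mulr_ge0 => //.
  by apply: mulr_ge0 => //; exact: sqr_ge0.
rewrite /half (ltW t0).
have -> : fterm (z + v) t - fterm z t + v * ((psi t - 1) * cexp (- (z * t%:C))) =
    (psi t - 1) * (t `^ (- 1))%:C * cexp (- (z * t%:C)) * (cexp (- (v * t%:C)) - 1 - - (v * t%:C)).
  have tt : (t `^ (-1))%:C * t%:C = 1 :> C by rewrite -RealM powR_inv1 ?(ltW t0)// mulVf ?gt_eqF// Real1.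
  rewrite /frullani_term (mulrDl z v) opprD cexpD.
  move: (cexp (- (z * _))) (cexp (- (v * _))) (psi _) => e1 e2 p.
  transitivity ((p - 1) * (t `^ (-1))%:C * (e1 * e2) - (p - 1) * (t `^ (-1))%:C * e1 +
    (p - 1) * e1 * v * ((t `^ (-1))%:C * t%:C)); last by ring.
  by rewrite tt; ring.
have nv := normc_ge0 v.
rewrite 3!normcM normc_cexp_ray normc_real_ge0 ?powR_ge0// powR_inv1 ?(ltW t0)// -/x.
have := normc_cexp_sub1D (- (v * t%:C)); rewrite normcN normcM (normc_real_ge0 (ltW t0)) => hD.
have := psi_sub1_bound N_gt2 N_even m nu_ge0 t0 => hp.
have y0 : 0 <= x / 4 * t by rewrite mulr_ge0// ltW.
have := expr_le_expR 1 y0; rewrite !expr1 mul1r => y1.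
apply: (@le_trans _ _ (B * t^-1 * expR (- (x * t)) * (4 * (normc v * t) ^+ 2 * expR (x / 2 * t)))).
  apply: ler_pM; rewrite ?mulr_ge0 ?normc_ge0 ?expR_ge0 ?invr_ge0 ?(ltW t0)//.
    rewrite ler_wpM2r ?expR_ge0// ler_wpM2r ?invr_ge0 ?(ltW t0)//.
  rewrite (le_trans hD)//; apply: ler_wpM2l; first by apply: mulr_ge0 => //; exact: sqr_ge0.
  by rewrite ler_expR ler_wpM2r// ltW.
have -> : expR (- (x * t)) = expR (- (x / 4 * t)) * (expR (- (x / 4 * t)) * expR (- (x / 2 * t))).
  by rewrite -!expRD; congr expR; field.
have -> : K * normc v ^+ 2 * expR (- (x / 4 * t)) =
    4 * B * normc v ^+ 2 * expR (- (x / 4 * t)) * (4 / x) by rewrite /K; ring.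
set E := expR (- (x / 4 * t)).
have E2 : expR (- (x / 2 * t)) * expR (x / 2 * t) = 1 by rewrite -expRD addNr expR0.
have Ey : x / 4 * t * E <= 1 by rewrite /E expRN ler_pdivrMr ?expR_gt0// mul1r.
have -> : B * t^-1 * (E * (E * expR (- (x / 2 * t)))) * (4 * (normc v * t) ^+ 2 * expR (x / 2 * t)) =
    4 * B * normc v ^+ 2 * E * (4 / x * (x / 4 * t * E)) * (expR (- (x / 2 * t)) * expR (x / 2 * t)).
  move: (expR (x / 2 * t)) (expR (- (x / 2 * t))) => a b.
  by field; rewrite xn gt_eqF.
rewrite E2 mulr1; apply: ler_wpM2l.
  by apply: mulr_ge0; [apply: mulr_ge0; [exact: mulr_ge0|exact: sqr_ge0]|exact: expR_ge0].
by rewrite ler_piMr// divr_ge0// ltW.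
Qed.

(** Since S n >= 1, [frullani_dom] at Re z dominates all the integrands, which tend to 0
    pointwise. *)
Lemma laplace_exponent_cvg0 (z : C) (S : nat -> R) : 0 < Re z -> (forall n, n.+1%:R <= S n) ->
  ccvg (fun n => lexpo (z * (S n)%:C)) 0.
Proof.
move=> z0 Sn; have S1 n : 1 <= S n by rewrite (le_trans _ (Sn n))// ler1n.
rewrite -[X in ccvg _ X](@cintegral0 _ T R mu).
refine (@cdct _ T R mu _ _ (frullani_dom N m nu (Re z)) _ _ _ _).2.
- move=> n; exact: (cmeas_positive_part (cmeas_frullani_term N m nu_ge0 _)).
- exact: rint_frullani_dom.
- move=> n t; case: ltP => [t0|_]; last by rewrite normc0 frullani_dom_ge0.
  apply: frullani_term_bound => //; rewrite cReM /= mulr0 subr0.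
  by rewrite ler_peMr// ltW.
- move=> t; case: ltP => [t0|_]; last exact: ccvg_cst.
  rewrite /frullani_term.
  rewrite -(mulr0 ((psi t - 1) * (t `^ (- 1))%:C)); apply: ccvgM; first exact: ccvg_cst.
  apply: (@ccvg_bound _ _ _ (fun n => expR (- (Re z * t * n%:R)))).
    move=> n; rewrite subr0 normc_cexp_ray ler_expR lerN2 cReM /= mulr0 subr0.
    rewrite mulrAC -!mulrA ler_wpM2l ?(ltW z0)// ler_wpM2r ?(ltW t0)//.
    by rewrite (le_trans _ (Sn n))// ler_nat.
  by apply: cvgn_expR; rewrite mulr_gt0.
Qed.

End laplace_exponent_properties.

(** * The roots of kappa *)

Section roots.
Context {R : realType}.
Local Notation C := R[i].
Local Notation Re := (@complex.Re R).
Local Notation Im := (@complex.Im R).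

Lemma cis_cos_sin (t : R) : cis t = cos t +i* sin t.
Proof. by rewrite cisE cexp_ir. Qed.

Lemma cisX (t : R) n : cis t ^+ n = cis (n%:R * t).
Proof.
elim: n => [|n IH]; first by rewrite expr0 mul0r cis0.
by rewrite exprS IH -cisD -natr1 mulrDl mul1r addrC.
Qed.

Lemma cisV (t : R) : (cis t)^-1 = cis (- t).
Proof.
have e := cisN_conj t; have c0 : cis t != 0 by apply: contra_eqN e => /eqP ->; rewrite mulr0 eq_sym oner_eq0.
by apply: (mulIf c0); rewrite mulVf.
Qed.

Lemma cis_neq0 (t : R) : cis t != 0.
Proof. by apply: contra_eqN (cisN_conj t) => /eqP ->; rewrite mulr0 eq_sym oner_eq0. Qed.

Lemma cispi : cis pi = -1 :> C.
Proof. by rewrite cis_cos_sin cospi sinpi; apply: complexP; rewrite /= ?oppr0. Qed.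

Lemma cis_natpi n : cis (n%:R * pi) = (-1) ^+ n :> C.
Proof. by rewrite -cisX cispi. Qed.

Lemma cis_neq1 (x : R) : 0 < x -> x < 2 * pi -> cis x != 1.
Proof.
move=> x0 x2; have s0 : 0 < sin (x / 2).
  by apply: sin_gt0_pi; apply/andP; split; lra.
apply/negP => /eqP; rewrite cis_cos_sin => -[c1 _].
have : cos (x / 2 + x / 2) = 1 by rewrite -splitr.
rewrite cosD -!expr2 cos2sin2; have : 0 < sin (x / 2) ^+ 2 by rewrite exprn_gt0.
lra.
Qed.

Lemma sum_geometric (q : C) n : q != 1 -> q ^+ n = 1 -> \sum_(l < n) q ^+ l = 0.
Proof.
move=> q1 qn; have := subrX1 q n; rewrite qn subrr => /esym/eqP.
by rewrite mulf_eq0 subr_eq0 (negbTE q1) /= => /eqP.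
Qed.

(** All v q^l have the same n-th power, so each quotient expands through the factorisation of (v
    q^l)^n - a^n. Summing over l, orthogonality of the powers of q leaves only the exponent n. *)
Lemma partial_fractions (n : nat) (v q a : C) : (0 < n)%N -> q ^+ n = 1 ->
  (forall m, (0 < m < n)%N -> q ^+ m != 1) -> v ^+ n != a ^+ n ->
  \sum_(l < n) v * q ^+ l / (v * q ^+ l - a) = n%:R * v ^+ n / (v ^+ n - a ^+ n).
Proof.
move=> n0 qn qm va; have d0 : v ^+ n - a ^+ n != 0 by rewrite subr_eq0.
apply: (mulIf d0); rewrite divfK// mulr_suml.
have vq l : (v * q ^+ l) ^+ n = v ^+ n by rewrite exprMn exprAC qn expr1n mulr1.
transitivity (\sum_(l < n) \sum_(j < n) v ^+ j.+1 * a ^+ (n.-1 - j) * (q ^+ j.+1) ^+ l).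
  apply: eq_bigr => l _; rewrite -[v ^+ n](vq l) subrXX.
  have e0 : v * q ^+ l - a != 0.
    apply: contraNneq d0 => /eqP; rewrite subr_eq0 => /eqP e.
    by rewrite -(vq l) e subrr.
  rewrite mulrA divfK// mulr_sumr (reindex_inj rev_ord_inj) /=.
  apply: eq_bigr => j _; have jn : (j < n)%N := ltn_ord j.
  have e2 : (n - j.+1 = n.-1 - j)%N by rewrite -subn1 -subnDA add1n.
  have e1 : (n.-1 - (n.-1 - j) = j)%N by rewrite subKn// -ltnS prednK.
  rewrite e2 e1 exprMn.
  rewrite exprS -!exprM; have -> : (j.+1 * l = l * j + l)%N by rewrite mulSn mulnC addnC.
  by rewrite exprD; ring.
rewrite exchange_big /=.
transitivity (\sum_(j < n) v ^+ j.+1 * a ^+ (n.-1 - j) * (if j == n.-1 :> nat then n%:R else 0)).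
  apply: eq_bigr => j _; rewrite -mulr_sumr; congr (_ * _).
  case: eqP => [->|jn].
    by rewrite prednK// qn; under eq_bigr do rewrite expr1n; rewrite sumr_const card_ord.
  apply: sum_geometric; last by rewrite exprAC qn expr1n.
  apply: qm; rewrite /= ltn_neqAle ltn_ord andbT; apply/eqP => e; apply: jn.
  exact: (congr1 predn e).
have nn : (n.-1 < n)%N by rewrite prednK.
rewrite (bigD1 (Ordinal nn)) //= eqxx subnn expr0 mulr1 prednK// big1 ?addr0 1?mulrC//.
move=> j; rewrite -val_eqE /= => /negbTE ->; exact: mulr0.
Qed.

End roots.

Section principal_root.
Context {R : realType} (N : nat).
Hypotheses (N_gt2 : (2 < N)%N) (N_even : ~~ odd N).
Local Notation C := R[i].
Local Notation Re := (@complex.Re R).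
Local Notation Im := (@complex.Im R).
Local Notation n := (N./2).

Let Nn : N = (n + n)%N.
Proof. by rewrite addnn -[LHS]odd_double_half (negbTE N_even). Qed.

Let n_gt0 : (0 < n)%N.
Proof. by rewrite half_gt0 ltnW. Qed.

Let nR : N%:R = 2 * n%:R :> R.
Proof. by rewrite {1}Nn natrD mulr_natl mulr2n. Qed.

Let nR0 : n%:R != 0 :> R.
Proof. by rewrite pnatr_eq0 -lt0n. Qed.

(** theta_l has argument pi / 2 + [root_angle l]; for l < N / 2 this lies in the open left
    half-plane. *)
Definition root_angle (l : nat) : R := (2 * l + 1)%:R * pi / N%:R.

Lemma thetaE l : theta N l = cis (pi / 2 + root_angle l).
Proof.
rewrite cisE /theta; apply: (congr1 (fun t : R => cexp ('i%C * t%:C))).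
by rewrite /root_angle nR !natrD; move: (pi : R) nR0 => p n0; field.
Qed.

Lemma thetaD l : theta N (l + n) = - theta N l :> C.
Proof.
rewrite !thetaE (_ : _ + root_angle (l + n) = pi + (pi / 2 + root_angle l)).
  by rewrite cisD cispi mulN1r.
by rewrite /root_angle nR !natrD; move: (pi : R) nR0 => p n0; field.
Qed.

Lemma theta_neq0 l : theta N l != 0 :> C.
Proof. by rewrite thetaE; exact: cis_neq0. Qed.

Lemma thetaX l : theta N l ^+ N = kappa N :> C.
Proof.
rewrite thetaE cisX (_ : _ * _ = (2 * l + (1 + n))%:R * pi).
  by rewrite cis_natpi exprD exprM sqrrN !expr1n mul1r.
by rewrite /root_angle nR !natrD; move: (pi : R) nR0 => p n0; field.
Qed.

(** The margin pi / N exceeds the argument of a principal root of a number in the right half-plane,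
    which is below pi / (2 N). *)
Lemma angle_bounds l : (l < n)%N -> pi / N%:R <= root_angle l /\ root_angle l <= pi - pi / N%:R.
Proof.
move=> ln; have p0 : 0 < pi / N%:R :> R by rewrite divr_gt0 ?pi_gt0// ltr0n (ltn_trans _ N_gt2).
have -> : root_angle l = (2 * l + 1)%:R * (pi / N%:R) by rewrite mulrA.
split; first by rewrite ler_peMl ?(ltW p0)// ler1n addn1.
have h : (2 * l + 1)%:R + 1 <= N%:R :> R.
  by rewrite natr1 ler_nat Nn addnn -mul2n addn1 -[(2 * l).+2]add2n -mulnS leq_mul2l.
have := ler_wpM2r (ltW p0) h.
have e : N%:R * (pi / N%:R) = pi :> R by rewrite mulrCA divff ?mulr1// nR mulf_neq0.
by rewrite e mulrDl mul1r lerBrDr.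
Qed.

Lemma Re_theta l : Re (theta N l) = - sin (root_angle l).
Proof. by rewrite thetaE cis_cos_sin /= cosD cos_pihalf sin_pihalf mul0r mul1r sub0r. Qed.

Lemma sin_angle_gt0 l : (l < n)%N -> 0 < sin (root_angle l).
Proof.
move=> /angle_bounds[h1 h2].
have p0 : 0 < pi / N%:R :> R by rewrite divr_gt0 ?pi_gt0// ltr0n (ltn_trans _ N_gt2).
by apply: sin_gt0_pi; apply/andP; split; lra.
Qed.

End principal_root.

(** * Polar form with the principal argument *)

Section polar_form.
Context {R : realType}.
Local Notation C := R[i].
Local Notation Re := (@complex.Re R).
Local Notation Im := (@complex.Im R).

Lemma carg_polar (z : C) : z != 0 -> z = (normc z)%:C * cis (carg z).
Proof.
move=> z0; have r0 : 0 < normc z by rewrite normc_gt0.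
have rn : normc z != 0 by rewrite gt_eqF.
have r2 : normc z ^+ 2 = Re z ^+ 2 + Im z ^+ 2.
  by case: z {z0 r0 rn} => a b /=; rewrite sqr_sqrtr// addr_ge0 ?sqr_ge0.
pose q := Re z / normc z.
have q1 : -1 <= q <= 1.
  by rewrite -ler_norml /q normrM normfV (ger0_norm (ltW r0)) ler_pdivrMr// mul1r Re_le_normc.
have ca : cos (acos q) = q by rewrite acosK.
have sa : sin (acos q) = `|Im z| / normc z.
  rewrite sin_acos//; apply/eqP; rewrite -(@eqrXn2 _ 2)// ?sqrtr_ge0 ?divr_ge0 ?(ltW r0)//.
  rewrite sqr_sqrtr; last by rewrite subr_ge0 -[1](expr1n _ 2) -real_normK ?num_real// lerXn2r ?nnegrE// ler_norml.
  rewrite /q !exprMn exprVn real_normK ?num_real//; apply/eqP.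
  have r2n : normc z ^+ 2 != 0 by rewrite sqrf_eq0.
  by apply: (mulIf r2n); rewrite mulrBl !divfK// mul1r r2 addrC addKr.
have zE : z = Re z +i* Im z by case: (z).
rewrite cis_cos_sin /carg -/q {1}zE; case: ifP => im0.
  rewrite ca sa ger0_norm// /q; apply: complexP; rewrite ?cRe_rM ?cIm_rM /= mulrC divfK//.
rewrite cosN sinN ca sa ltr0_norm; last by rewrite ltNge im0.
by apply: complexP; rewrite ?cRe_rM ?cIm_rM /= /q ?mulNr ?opprK mulrC divfK.
Qed.

Lemma carg_bound (z : C) : 0 < Re z -> `|carg z| < pi / 2.
Proof.
move=> z0; have zn : z != 0 by apply: contraTneq z0 => ->; rewrite ltxx.
have r0 : 0 < normc z by rewrite normc_gt0.
pose q := Re z / normc z.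
have q0 : 0 < q by rewrite divr_gt0.
have q1 : -1 <= q <= 1.
  by rewrite -ler_norml /q normrM normfV (ger0_norm (ltW r0)) ler_pdivrMr// mul1r Re_le_normc.
have -> : `|carg z| = acos q.
  rewrite /carg -/q; case: ifP => _; rewrite ?normrN ger0_norm// acos_ge0//.
rewrite ltNge; apply/negP => h.
have s0 : 0 <= sin (acos q - pi / 2).
  apply: sin_ge0_pi; have := acos_lepi q1; have := pi_ge0 R.
  by move=> p0 ap; apply/andP; split; lra.
have : sin (acos q - pi / 2) = - q.
  by rewrite sinB cos_pihalf sin_pihalf mulr0 mulr1 sub0r acosK.
by move: s0 => /[swap] ->; rewrite oppr_ge0 leNgt q0.
Qed.

End polar_form.

Section principal_root_quotients.
Context {R : realType} (N : nat).
Hypotheses (N_gt2 : (2 < N)%N) (N_even : ~~ odd N).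
Local Notation C := R[i].
Local Notation Re := (@complex.Re R).
Local Notation Im := (@complex.Im R).
Local Notation n := (N./2).

Lemma crootE (z : C) : croot N z = (normc z `^ N%:R^-1)%:C * cis (carg z / N%:R).
Proof. by rewrite cisE. Qed.

Lemma crootX (z : C) : z != 0 -> croot N z ^+ N = z.
Proof.
move=> z0; have N0 : N%:R != 0 :> R by rewrite pnatr_eq0 -lt0n (ltn_trans _ N_gt2).
rewrite crootE exprMn cisX.
have -> : N%:R * (carg z / N%:R) = carg z by rewrite mulrCA divff// mulr1.
rewrite -RealX -powR_mulrn ?powR_ge0// -powRrM mulVf// powRr1 ?normc_ge0//.
by rewrite -carg_polar.
Qed.

(* For z a root of lambda in the sector |arg| < pi / (2 N), the quotients
   z / theta_l are [- wroot z l] for l in K and [wroot z l] for [l + N / 2] in J. *)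
Definition wroot (z : C) (l : nat) : C := - (z / theta N l).

(** The real part is a positive multiple of the sine of root_angle l - carg z / N, an angle that
    [angle_bounds] and [carg_bound] keep inside ]0, pi[. *)
Lemma wroot_croot_gt0 (z : C) l : 0 < Re z -> (l < n)%N -> 0 < Re (wroot (croot N z) l).
Proof.
move=> z0 ln; have zn : z != 0 by apply: contraTneq z0 => ->; rewrite ltxx.
have [h1 h2] := @angle_bounds R N N_gt2 N_even l ln.
have cb := carg_bound z0.
have N0 : 0 < N%:R :> R by rewrite ltr0n (ltn_trans _ N_gt2).
have p0 : 0 < pi / N%:R :> R by rewrite divr_gt0 ?pi_gt0.
pose a : R := root_angle N l.
have ab : `|carg z / N%:R| < pi / N%:R / 2.
  by rewrite normrM normfV [`|N%:R|]gtr0_norm// mulrAC ltr_pM2r// invr_gt0.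
rewrite /wroot crootE thetaE// cisV -mulrA -cisD -mulrN cRe_rM mulr_gt0//.
  by rewrite powR_gt0// normc_gt0.
rewrite cis_cos_sin /= -/a.
have -> : carg z / N%:R - (pi / 2 + a) = - (pi / 2 + (a - carg z / N%:R)) by ring.
rewrite cosN cosD cos_pihalf sin_pihalf mul0r mul1r sub0r opprK.
move: ab; rewrite ltr_norml => /andP[b1 b2].
by move: h1 h2; rewrite -/a => h1 h2; apply: sin_gt0_pi; apply/andP; split; lra.
Qed.

Lemma wroot_scale (z : C) (s : R) l : wroot (z * s%:C) l = wroot z l * s%:C.
Proof. by rewrite /wroot mulNr mulrAC. Qed.

Let Nn : N = (n + n)%N.
Proof. by rewrite addnn -[LHS]odd_double_half (negbTE N_even). Qed.

Let n_gt0 : (0 < n)%N.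
Proof. by rewrite half_gt0 ltnW. Qed.

Let nR : N%:R = 2 * n%:R :> R.
Proof. by rewrite {1}Nn natrD mulr_natl mulr2n. Qed.

(** The squares of the [wroot z l], l < N / 2, form a geometric progression running through the
    (N/2)-th roots of kappa z^N, so [partial_fractions] applies with degree N / 2 and a = - u^2. *)
Lemma wroot_partial_fractions (z : C) (u : R) : 0 < Re (z ^+ N) ->
  \sum_(l < n) 2 * wroot z l ^+ 2 / (wroot z l ^+ 2 + (u ^+ 2)%:C) =
  N%:R * z ^+ N / (z ^+ N + (u ^+ N)%:C).
Proof.
move=> zN; have nr0 : n%:R != 0 :> R by rewrite pnatr_eq0 -lt0n.
pose q : C := cis (- (2 * pi / n%:R)).
have wq l : wroot z l ^+ 2 = wroot z 0 ^+ 2 * q ^+ l.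
  rewrite /wroot /q !thetaE// !cisV !sqrrN !exprMn !cisX -(mulrA (z ^+ 2)) -cisD.
  apply: (congr1 (fun t : R => _ * cis t)).
  by rewrite /root_angle nR !natrD; move: (pi : R) nr0 => p n0; field.
have k2 : kappa N * kappa N = 1 :> C by rewrite -expr2 -exprM mulnC exprM sqrrN !expr1n.
have kE : (- (u ^+ 2)%:C) ^+ n = - (kappa N * (u ^+ N)%:C).
  rewrite exprNn -RealX -exprM mul2n -addnn -Nn /kappa exprD expr1.
  by rewrite mulN1r mulNr opprK.
have vE : (wroot z 0 ^+ 2) ^+ n = kappa N * z ^+ N.
  rewrite -exprM mul2n -addnn -Nn /wroot exprNn -signr_odd (negbTE N_even) mul1r.
  rewrite exprMn exprVn (thetaX N_gt2 N_even) mulrC; congr (_ * _).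
  have k0 : kappa N != 0 :> C by apply: contra_eqN k2 => /eqP ->; rewrite mul0r eq_sym oner_eq0.
  by apply: (mulIf k0); rewrite mulVf.
have k0 : kappa N != 0 :> C by apply: contra_eqN k2 => /eqP ->; rewrite mul0r eq_sym oner_eq0.
have d0 : z ^+ N + (u ^+ N)%:C != 0.
  have : 0 < Re (z ^+ N + (u ^+ N)%:C).
    by rewrite cReD /= ltr_wpDr// -[N]odd_double_half (negbTE N_even) -mul2n exprM exprn_ge0// sqr_ge0.
  by apply: contraTneq => ->; rewrite ltxx.
have dE : (wroot z 0 ^+ 2) ^+ n - (- (u ^+ 2)%:C) ^+ n = kappa N * (z ^+ N + (u ^+ N)%:C).
  by rewrite vE kE opprK mulrDr.
have := @partial_fractions R n (wroot z 0 ^+ 2) q (- (u ^+ 2)%:C) n_gt0.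
rewrite dE vE => pf.
transitivity (2 * \sum_(l < n) wroot z 0 ^+ 2 * q ^+ l / (wroot z 0 ^+ 2 * q ^+ l - - (u ^+ 2)%:C)).
  by rewrite mulr_sumr; apply: eq_bigr => l _; rewrite wq opprK !mulrA.
rewrite pf.
- have -> : N%:R = 2 * n%:R :> C by rewrite {1}Nn natrD mulr_natl mulr2n.
  by field; rewrite k0 d0.
- rewrite /q -cisV exprVn cisX mulrCA divff// mulr1.
  by rewrite (cis_natpi 2) sqrrN expr1n invr1.
- move=> j /andP[j0 jn]; rewrite /q -cisV exprVn cisX invr_eq1.
  have pn : 0 < 2 * pi / n%:R :> R by rewrite divr_gt0 ?mulr_gt0 ?pi_gt0// ltr0n.
  apply: cis_neq1; first by rewrite mulr_gt0// ltr0n.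
  have {2}-> : 2 * pi = n%:R * (2 * pi / n%:R) :> R by rewrite mulrCA divff// mulr1.
  by rewrite ltr_pM2r// ltr_nat.
- by rewrite -subr_eq0 -vE dE mulf_neq0.
Qed.

End principal_root_quotients.

(** * Laplace transforms of the kernel and of psi *)

Section two_sided_exponentials.
Context {R : realType}.
Local Notation mu := (@lebesgue_measure R).
Local Notation T := (measurableTypeR R).
Local Notation C := R[i].
Local Notation Re := (@complex.Re R).

Definition two_sided (p q : C) (y : R) : C :=
  if 0 <= y then cexp (- p * y%:C) else cexp (q * y%:C).

Lemma integral_two_sided (p q : C) : 0 < Re p -> 0 < Re q ->
  cint mu (two_sided p q) /\ cintegral mu (two_sided p q) = p^-1 + q^-1.
Proof.
move=> p0 q0.
have [ip ep] := cintegral_exp_half_line p0.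
have [iq eq] := cintegral_exp_half_line q0.
have n1 : (-1 : R) != 0 by rewrite oppr_eq0 oner_eq0.
have iq' := cint_affine 0 n1 iq.
pose fp (c : C) (u : R) := if 0 <= u then cexp (- c * u%:C) else 0.
pose F u := fp p u + fp q (0 + -1 * u).
have iF : cint mu F by exact: (cintD ip iq').
have mt : cmeas (two_sided p q : T -> C).
  apply: cmeas_if; first exact: measurable_ge0.
    by apply: cmeas_cexp; apply: cmeasM; [exact: cmeas_cst|exact: cmeas_real].
  by apply: cmeas_cexp; apply: cmeasM; [exact: cmeas_cst|exact: cmeas_real].
have tF u : u != 0 -> two_sided p q u = F u.
  rewrite /two_sided /F /fp add0r mulN1r oppr_ge0.
  case: ltgtP => // [u0|u0] _; last by rewrite add0r mulNr RealN mulrN opprK.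
  by rewrite addr0.
split; last first.
  rewrite (cintegral_eq_off mt (cint_cmeas iF) tF) (cintegralD ip iq') ep.
  by have := cintegral_affine 0 n1 iq; rewrite eq normrN1 Real1 mul1r => <-.
have ih := rintD (rint_exp_abs p0) (rint_exp_abs q0).
apply: (cint_le mt ih).
move=> u; rewrite /two_sided; case: ifP => u0.
  rewrite mulNr normc_cexp_ray ger0_norm// lerDl expR_ge0//.
rewrite -[_ * _]opprK -mulrN -RealN normc_cexp_ray ltr0_norm; last by rewrite ltNge u0.
by rewrite lerDr expR_ge0.
Qed.

Lemma ccont_cexp (f : R -> C) : ccont f -> ccont (fun t => cexp (f t)).
Proof.
move=> [fr fi]; split => x.
- under eq_fun do rewrite Re_cexp; apply: cvgM.
    by apply: continuous_cvg; [exact: continuous_expR|exact: fr].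
  by apply: continuous_cvg; [exact: continuous_cos|exact: fi].
- under eq_fun do rewrite Im_cexp; apply: cvgM.
    by apply: continuous_cvg; [exact: continuous_expR|exact: fr].
  by apply: continuous_cvg; [exact: continuous_sin|exact: fi].
Qed.

Lemma ccont_sum (I : Type) (s : seq I) (F : I -> R -> C) : (forall i, ccont (F i)) ->
  ccont (fun t => \sum_(i <- s) F i t).
Proof.
move=> cF; elim: s => [|i s IH].
  by under eq_fun do rewrite big_nil; exact: ccont_cst.
by under eq_fun do rewrite big_cons; exact: ccontD.
Qed.

End two_sided_exponentials.

(** * The resolvent kernel and its Fourier transform *)

Section resolvent_kernel.
Context {R : realType} (N : nat).
Hypotheses (N_gt2 : (2 < N)%N) (N_even : ~~ odd N).
Local Notation mu := (@lebesgue_measure R).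
Local Notation T := (measurableTypeR R).
Local Notation C := R[i].
Local Notation Re := (@complex.Re R).
Local Notation n := (N./2).
Variable z : C.
Hypothesis zN_gt0 : 0 < Re (z ^+ N).
Hypothesis wroot_gt0 : forall l : 'I_n, 0 < Re (wroot N z l).

Local Notation w := (wroot N z).

(* The kernel of the resolvent at z ^ N of the generator, by partial fractions. *)
Definition resolvent (y : R) : C :=
  (N%:R * z ^+ N)^-1 * \sum_(l < n) w l * cexp (- (w l * `|y|%:C)).

Lemma cexp_abs_cis (c : C) (u y : R) : cexp (- (c * `|y|%:C)) * cis (u * y) =
  two_sided (c - 'i%C * u%:C) (c + 'i%C * u%:C) y.
Proof.
rewrite cisE -cexpD /two_sided; case: (leP 0 y) => y0.
  by rewrite ger0_norm// RealM; congr cexp; ring.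
by rewrite ltr0_norm// RealM RealN; congr cexp; ring.
Qed.

(** The damping acts on y >= 0 only; hence nu enters only the right exponent, and in the end only
    one of the two products of the denominator. *)
Lemma cexp_abs_test (c : C) (m nu y : R) : cexp (- (c * `|y|%:C)) * test_fun m nu y =
  two_sided (c - ('i%C * m%:C - nu%:C)) (c + 'i%C * m%:C) y.
Proof.
rewrite /test_fun /damp cisE -cexp_real -!cexpD /two_sided /pos; case: (leP 0 y) => y0.
  by rewrite ger0_norm// ?max_l// RealN !RealM; congr cexp; ring.
by rewrite ltr0_norm// ?max_r ?(ltW y0)// mulr0 oppr0 Real0 RealM RealN; congr cexp; ring.
Qed.

Lemma integral_resolvent (g : R -> C) (p q : 'I_n -> C) :
  (forall l, 0 < Re (p l)) -> (forall l, 0 < Re (q l)) ->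
  (forall (l : 'I_n) y, cexp (- (w l * `|y|%:C)) * g y = two_sided (p l) (q l) y) ->
  cint mu (fun y => resolvent y * g y) /\
  cintegral mu (fun y => resolvent y * g y) =
    (N%:R * z ^+ N)^-1 * \sum_(l < n) w l * ((p l)^-1 + (q l)^-1).
Proof.
move=> p0 q0 pq.
have e : (fun y => resolvent y * g y) =
    (fun y => (N%:R * z ^+ N)^-1 * \sum_(l < n) w l * two_sided (p l) (q l) y).
  apply/funext => y; rewrite /resolvent -mulrA mulr_suml; congr (_ * _).
  by apply: eq_bigr => l _; rewrite -mulrA pq.
have ci (l : 'I_n) : cint mu (fun y => w l * two_sided (p l) (q l) y).
  by apply: cintZl; exact: (integral_two_sided (p0 l) (q0 l)).1.
have cs := cint_sum (index_enum 'I_n) ci.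
rewrite e; split; first exact: cintZl.
rewrite (cintegralZl _ cs) (cintegral_sum _ ci); congr (_ * _).
apply: eq_bigr => l _; have [cl el] := integral_two_sided (p0 l) (q0 l).
by rewrite (cintegralZl _ cl) el.
Qed.

Lemma zN_neq0 : z ^+ N != 0.
Proof. by apply: contraTneq zN_gt0 => ->; rewrite ltxx. Qed.

Lemma gt0_neq0 (c : C) : 0 < Re c -> c != 0.
Proof. by move=> c0; apply: contraTneq c0 => ->; rewrite ltxx. Qed.

Lemma Re_addi (c : C) (u : R) : Re (c + 'i%C * u%:C) = Re c.
Proof. by rewrite !ReImE oppr0 addr0. Qed.

Lemma Re_subi (c : C) (u : R) : Re (c - 'i%C * u%:C) = Re c.
Proof. by rewrite -mulrN -RealN Re_addi. Qed.

(** The two halves of each exponential give 2 w / (w^2 + u^2), and [wroot_partial_fractions] sums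
    these. *)
Lemma resolvent_hat (u : R) :
  cint mu (fun y => resolvent y * cis (u * y)) /\
  cintegral mu (fun y => resolvent y * cis (u * y)) = (z ^+ N + (u ^+ N)%:C)^-1.
Proof.
have p0 (l : 'I_n) : 0 < Re (w l - 'i%C * u%:C) by rewrite Re_subi wroot_gt0.
have q0 (l : 'I_n) : 0 < Re (w l + 'i%C * u%:C) by rewrite Re_addi wroot_gt0.
have [ci ei] := integral_resolvent p0 q0 (fun l y => cexp_abs_cis (w l) u y).
split=> //; rewrite ei.
have := wroot_partial_fractions N_gt2 N_even u zN_gt0.
have -> : \sum_(l < n) 2 * w l ^+ 2 / (w l ^+ 2 + (u ^+ 2)%:C) =
    \sum_(l < n) w l * ((w l - 'i%C * u%:C)^-1 + (w l + 'i%C * u%:C)^-1).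
  apply: eq_bigr => l _.
  have -> : w l ^+ 2 + (u ^+ 2)%:C = (w l - 'i%C * u%:C) * (w l + 'i%C * u%:C).
    by rewrite -subr_sqr exprMn (expr2 'i%C) mulii mulN1r opprK RealX.
  have pn := gt0_neq0 (p0 l); have qn := gt0_neq0 (q0 l).
  by move: (w l) ('i%C * u%:C) pn qn => c b pn qn; field; rewrite pn qn.
move=> ->; have z0 := zN_neq0.
have N0 : N%:R != 0 :> C by rewrite pnatr_eq0 -lt0n (N_gt0 N_gt2).
rewrite mulKf//; exact: mulf_neq0.
Qed.

Lemma ccont_resolvent : ccont resolvent.
Proof.
apply: ccontM; first exact: ccont_cst.
apply: ccont_sum => l; apply: ccontM; first exact: ccont_cst.
apply: ccont_cexp; rewrite (_ : (fun t => _) = fun t => - w l * `|t|%:C).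
  apply: ccontM; first exact: ccont_cst.
  by apply: ccont_real; exact: norm_continuous.
by apply/funext => t; exact/esym/mulNr.
Qed.

Lemma resolventN y : resolvent (- y) = resolvent y.
Proof. by rewrite /resolvent normrN. Qed.

Lemma cint_resolvent : cint mu resolvent.
Proof.
have [c _] := resolvent_hat 0; move: c.
by under eq_fun do rewrite mul0r cis0 mulr1.
Qed.

Lemma resolvent_bounded : exists B, forall y, normc (resolvent y) <= B.
Proof.
exists (normc (N%:R * z ^+ N)^-1 * \sum_(l < n) normc (w l)) => y.
rewrite normcM ler_wpM2l ?normc_ge0// (le_trans (normc_sum _ _ _))//.
apply: ler_sum => l _; rewrite normcM ler_piMr ?normc_ge0// normc_cexp_ray.
by rewrite -expR0 ler_expR oppr_le0 mulr_ge0// ltW.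
Qed.

Lemma rint_resolvent_hat : rint mu (fun u : R => (Re (z ^+ N) + u ^+ N)^-1).
Proof.
pose x := Re (z ^+ N); have x0 : 0 < x := zN_gt0.
have d0 (u : R) : 0 < x + u ^+ N by rewrite ltr_wpDr// (evenX_ge0 N_even).
apply: (rint_le _ (rintZl (2 + x^-1 * 2) integral_cauchy.1)).
  apply: continuous_measurable_fun => u; apply: cvgV; first by rewrite gt_eqF.
  by apply: cvgD; [exact: cvg_cst|exact: exprn_continuous].
move=> u; have c0 : 0 < 1 + u ^+ 2 by rewrite ltr_pwDl// sqr_ge0.
rewrite ger0_norm ?invr_ge0 ?(ltW (d0 u))// ler_pdivlMr// mulrC ler_pdivrMr//.
have h : u ^+ 2 <= 1 + u ^+ N.
  have := @expr_le_1D R `|u| 2 N (normr_ge0 u) (ltnW N_gt2).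
  by rewrite -!normrX !ger0_norm ?sqr_ge0// (evenX_ge0 N_even).
have e : (2 + x^-1 * 2) * (x + u ^+ N) = 2 * x + 2 * u ^+ N + 2 + x^-1 * 2 * u ^+ N.
  by field; rewrite gt_eqF.
have p1 : 0 <= x^-1 * 2 * u ^+ N by rewrite !mulr_ge0 ?invr_ge0 ?(ltW x0)// (evenX_ge0 N_even).
have p2 := evenX_ge0 N_even u.
rewrite e; lra.
Qed.

Lemma normc_resolvent_hat (u : R) :
  normc (z ^+ N + (u ^+ N)%:C)^-1 <= (Re (z ^+ N) + u ^+ N)^-1.
Proof.
have d0 : 0 < Re (z ^+ N) + u ^+ N by rewrite ltr_wpDr// (evenX_ge0 N_even).
have h : Re (z ^+ N) + u ^+ N <= normc (z ^+ N + (u ^+ N)%:C).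
  by have := Re_le_normc (z ^+ N + (u ^+ N)%:C); rewrite cReD /=; apply: le_trans; exact: ler_norm.
by rewrite normcV lef_pV2 ?posrE// (lt_le_trans d0).
Qed.

(** Inverting [resolvent_hat] evaluates this integral over the line without residues. *)
Lemma resolvent_inversion (y : R) :
  cintegral mu (fun u => (z ^+ N + (u ^+ N)%:C)^-1 * cis (y * u)) = (2 * pi)%:C * resolvent y.
Proof.
have [B hB] := resolvent_bounded.
rewrite -resolventN -(@fourier_inversion _ resolvent _ B (- y) ccont_resolvent cint_resolvent hB rint_resolvent_hat).
  apply: eq_cintegral => u; rewrite (resolvent_hat u).2.
  by apply: (congr1 (fun t : R => _ * cis t)); rewrite mulrN opprK mulrC.
by move=> u; rewrite (resolvent_hat u).2; exact: normc_resolvent_hat.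
Qed.

End resolvent_kernel.

(** * Laplace transforms in time *)

Section laplace_transforms.
Context {R : realType} (N : nat).
Hypotheses (N_gt2 : (2 < N)%N) (N_even : ~~ odd N).
Local Notation mu := (@lebesgue_measure R).
Local Notation T := (measurableTypeR R).
Local Notation C := R[i].
Local Notation Re := (@complex.Re R).
Local Notation n := (N./2).
Variable z : C.
Hypothesis zN_gt0 : 0 < Re (z ^+ N).
Hypothesis wroot_gt0 : forall l : 'I_n, 0 < Re (wroot N z l).

Local Notation w := (wroot N z).
Local Notation lam := (z ^+ N).

Lemma cmeas_cexp_ray (c : C) : cmeas ((fun t => cexp (- (c * t%:C))) : T -> C).
Proof.
by apply: cmeas_cexp; apply: cmeasN; apply: cmeasM; [exact: cmeas_cst|exact: cmeas_real].
Qed.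

Lemma cintegral_exp_pos (c : C) : 0 < Re c ->
  cint mu (fun t => if 0 < t then cexp (- (c * t%:C)) else 0) /\
  cintegral mu (fun t => if 0 < t then cexp (- (c * t%:C)) else 0) = c^-1.
Proof.
move=> c0; have [ic ec] := cintegral_exp_half_line c0.
have mp := cmeas_positive_part (cmeas_cexp_ray c).
have e t : t != 0 -> (if 0 < t then cexp (- (c * t%:C)) else 0) =
    (if 0 <= t then cexp (- c * t%:C) else 0).
  by rewrite le_eqVlt eq_sym => /negbTE ->; rewrite /= mulNr.
split; last by rewrite (cintegral_eq_off mp (cint_cmeas ic) e).
apply: (cint_le mp (integral_exp_half_line c0).1) => t.
case: ltP => [t0|_]; first by rewrite (ltW t0) normc_cexp_ray.
by rewrite normc0; case: ifP => // _; exact: expR_ge0.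
Qed.

Lemma cmeas_resolvent_hat : cmeas ((fun u => (lam + (u ^+ N)%:C)^-1) : T -> C).
Proof.
have -> : (fun u : R => (lam + (u ^+ N)%:C)^-1) =
    (fun u => cintegral mu (fun y => resolvent N z y * cis (u * y))).
  by apply/funext => u; rewrite (resolvent_hat N_gt2 N_even zN_gt0 wroot_gt0 u).2.
apply: (@cmeas_cintegral_param _ _ T T R mu (fun p => resolvent N z p.2 * cis (p.1 * p.2))).
apply: cmeasM; first exact: (cmeas_comp (ccont_cmeas (ccont_resolvent N z)) measurable_snd).
by apply: cmeas_cis; apply: measurable_funM; [exact: measurable_fst|exact: measurable_snd].
Qed.

(** By Fubini the time integral of exp (- lambda t) [gexp N t u] comes first and is 1 / (lambda +
    u^N). The constant c will carry the value of the test function at y. *)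
Lemma laplace_gexp_hat (c : C) (y : R) :
  cintegral mu (fun t => if 0 < t then cexp (- (lam * t%:C)) * (c * gexp_hat N t y) else 0) =
  c * ((2 * pi)%:C * resolvent N z y).
Proof.
rewrite -(resolvent_inversion N_gt2 N_even zN_gt0 wroot_gt0).
pose x := Re lam; have x0 : 0 < x := zN_gt0.
have d0 (u : R) : 0 < x + u ^+ N by rewrite ltr_wpDr// (evenX_ge0 N_even).
pose F (p : T * T) : C :=
  if 0 < p.2 then cexp (- (lam * p.2%:C)) * (c * ((gexp N p.2 p.1)%:C * cis (y * p.1))) else 0.
pose g (u t : R) : R := normc c * (if 0 <= t then expR (- ((x + u ^+ N) * t)) else 0).
pose G (u : R) : R := normc c * (x + u ^+ N)^-1.
have [|||||_ q1 q2 _] := @cfubini _ _ T T R mu mu F g G _ _ _ _ _.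
- apply: cmeas_if; [|apply: cmeasM; last (apply: cmeasM; last apply: cmeasM)|exact: cmeas_cst].
  + exact: (measurableT_comp measurable_gt0 measurable_snd).
  + exact: (cmeas_comp (cmeas_cexp_ray lam) measurable_snd).
  + exact: cmeas_cst.
  + apply: cmeas_real; rewrite /gexp; apply: (measurableT_comp (@measurable_expR R)).
    apply: measurableT_comp => //; apply: measurable_funM; first exact: measurable_snd.
    by apply: measurable_funX; exact: measurable_fst.
  + apply: cmeas_cis; apply: measurable_funM; first exact: measurable_cst.
    exact: measurable_fst.
- by move=> u; apply: rintZl; exact: (integral_exp_half_line (d0 u)).1.
- move=> u t; rewrite /F /g /=; case: ltP => [t0|_]; last first.
    by rewrite normc0 mulr_ge0 ?normc_ge0//; case: ifP => // _; exact: expR_ge0.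
  rewrite (ltW t0) normcM normc_cexp_ray 2!normcM normc_cis mulr1 normc_real_ge0 ?gexp_ge0//.
  by rewrite mulrCA /gexp -expRD -opprD mulrDl [t * _]mulrC.
- by apply: rintZl; exact: (rint_resolvent_hat N_gt2 N_even zN_gt0).
- by move=> u; rewrite RintegralZl ?(integral_exp_half_line (d0 u)).2//; exact: (integral_exp_half_line (d0 u)).1.
transitivity (cintegral mu (fun t => cintegral mu (fun u => F (u, t)))).
  apply: eq_cintegral => t; rewrite /F /=; case: ltP => [t0|_]; last by rewrite cintegral0.
  have ci := cint_gexp_cis N_gt2 N_even y t0.
  apply/esym; apply: etrans (cintegralZl _ (cintZl c ci)) _.
  by apply: (congr1 (fun v : C => _ * v)); exact: (cintegralZl c ci).
apply: etrans (esym q2) _; apply: etrans q1 _.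
have c0 (u : R) : 0 < Re (lam + (u ^+ N)%:C) by rewrite cReD; exact: d0.
transitivity (cintegral mu (fun u => c * ((lam + (u ^+ N)%:C)^-1 * cis (y * u)))).
  apply: eq_cintegral => u; rewrite /F /=.
  have [ci ei] := cintegral_exp_pos (c0 u).
  rewrite -ei -(cintegralZr _ ci) -cintegralZl; last first.
    apply: (cint_le _ (integral_exp_half_line (d0 u)).1).
      apply: cmeasM; first exact: cint_cmeas ci.
      exact: cmeas_cst.
    move=> t; case: ltP => [t0|_]; last first.
      by rewrite mul0r normc0; case: ifP => // _; exact: expR_ge0.
    by rewrite (ltW t0) normcM normc_cexp_ray normc_cis mulr1 cReD.
  apply: eq_cintegral => t; case: ltP => _; last by rewrite mul0r mulr0.
  have -> : cexp (- ((lam + (u ^+ N)%:C) * t%:C)) = cexp (- (lam * t%:C)) * (gexp N t u)%:C.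
    by rewrite /gexp -cexp_real -cexpD RealN !RealM mulrDl opprD [(u ^+ N)%:C * _]mulrC.
  by move: (cexp _) (gexp _ _ _)%:C (cis _) => e1 e2 e3; ring.
rewrite cintegralZl//.
have hm : cmeas ((fun u => (lam + (u ^+ N)%:C)^-1 * cis (y * u)) : T -> C).
  apply: cmeasM; first exact: cmeas_resolvent_hat.
  exact: cmeas_cis_scale.
apply: (cint_le hm (rint_resolvent_hat N_gt2 N_even zN_gt0)) => u.
by rewrite normcM normc_cis mulr1; exact: normc_resolvent_hat.
Qed.

Variables (m nu : R).
Hypothesis nu_ge0 : 0 <= nu.
Local Notation psi := (psi N m nu).
Local Notation a := ('i%C * m%:C - nu%:C : C).
Local Notation b := ('i%C * m%:C : C).

Lemma Re_wroot_sub (l : 'I_n) : 0 < Re (w l - a).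
Proof. by rewrite opprB addrA Re_subi cReD /= ltr_wpDr// wroot_gt0. Qed.

Lemma Re_wroot_add (l : 'I_n) : 0 < Re (w l + b).
Proof. by rewrite Re_addi wroot_gt0. Qed.

(** Fubini moves the time integral onto the kernel, where it produces the resolvent; the positive
    half-line then yields the terms in a, the negative one those in b. *)
Lemma laplace_psi :
  cint mu (fun t => if 0 < t then cexp (- (lam * t%:C)) * psi t else 0) /\
  cintegral mu (fun t => if 0 < t then cexp (- (lam * t%:C)) * psi t else 0) =
  (N%:R * lam)^-1 * \sum_(l < n) w l * ((w l - a)^-1 + (w l + b)^-1).
Proof.
have [_ <-] := @integral_resolvent R N z (test_fun m nu) (fun l => w l - a) (fun l => w l + b)
  Re_wroot_sub Re_wroot_add (fun l y => cexp_abs_test (w l) m nu y).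
pose x := Re lam; have x0 : 0 < x := zN_gt0.
pose kb (t y : R) : C := ((2 * pi)^-1)%:C * gexp_hat N t y.
pose F (p : T * T) : C :=
  if 0 < p.1 then cexp (- (lam * p.1%:C)) * (kb p.1 p.2 * test_fun m nu p.2) else 0.
pose g (t y : R) : R := if 0 < t then expR (- (x * t)) * kernel_bound N (root_scale N t) y else 0.
pose G (t : R) : R := decay_const N / 2 * (if 0 <= t then expR (- (x * t)) else 0).
have [|||||_ q1 q2 q3] := @cfubini _ _ T T R mu mu F g G _ _ _ _ _.
- apply: cmeas_if; [|apply: cmeasM; last apply: cmeasM|exact: cmeas_cst].
  + exact: (measurableT_comp measurable_gt0 measurable_fst).
  + exact: (cmeas_comp (cmeas_cexp_ray lam) measurable_fst).
  + exact: cmeas_kernel_param.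
  + exact: (cmeas_comp (cmeas_test_fun m nu_ge0) measurable_snd).
- move=> t; rewrite /g; case: ltP => [t0|_]; last exact: rint0.
  by apply: rintZl; exact: (integral_kernel_bound N (root_scale_gt0 N t0)).1.
- move=> t y; rewrite /F /g /=; case: ltP => [t0|_]; last by rewrite normc0.
  rewrite normcM normc_cexp_ray ler_wpM2l ?expR_ge0// normcM.
  rewrite (@le_trans _ _ (normc (kb t y)))//; first by rewrite ler_piMr ?normc_ge0// normc_test_fun.
  by rewrite /kb -kernelE//; exact: normc_kernel_le.
- by apply: rintZl; exact: (integral_exp_half_line x0).1.
- move=> t; rewrite /g /G; case: ltP => [t0|_].
    have [ik ek] := integral_kernel_bound N (root_scale_gt0 N t0).
    by rewrite RintegralZl// ek mulrC (ltW t0).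
  rewrite /Rintegral integral0 mulr_ge0 ?divr_ge0 ?decay_const_ge0//.
  by case: ifP => // _; exact: expR_ge0.
have e t : cintegral mu (fun y => F (t, y)) = if 0 < t then cexp (- (lam * t%:C)) * psi t else 0.
  rewrite /F /=; case: ltP => [t0|_]; last by rewrite cintegral0.
  have ci := cint_psi N_gt2 N_even m nu_ge0 t0.
  have -> : (fun y => cexp (- (lam * t%:C)) * (kb t y * test_fun m nu y)) =
      (fun y => cexp (- (lam * t%:C)) * (Defs.kernel N t y * test_fun m nu y)).
    by apply/funext => y; rewrite kernelE.
  by rewrite (cintegralZl _ ci) -psiE.
have eF : (fun t => cintegral mu (fun y => F (t, y))) =
    (fun t => if 0 < t then cexp (- (lam * t%:C)) * psi t else 0) by apply/funext.
move: q1 q3; rewrite eF => q1 q3; split=> //.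
rewrite -q1 q2; apply: eq_cintegral => y; rewrite /F /=.
transitivity (cintegral mu (fun t => if 0 < t then
    cexp (- (lam * t%:C)) * ((((2 * pi)^-1)%:C * test_fun m nu y) * gexp_hat N t y) else 0)).
  apply: eq_cintegral => t; case: ltP => // _.
  by apply: (congr1 (fun c : C => _ * c)); exact: mulrAC.
rewrite laplace_gexp_hat; move: (resolvent _ _ _) (test_fun _ _ _) => e1 e2.
transitivity (((2 * pi)^-1)%:C * (2 * pi)%:C * (e1 * e2)); first by ring.
rewrite -RealM mulVf ?Real1 ?mul1r//.
by rewrite gt_eqF// mulr_gt0// pi_gt0.
Qed.

End laplace_transforms.

(** * The exponent along a ray *)

Section logarithmic_derivative.
Context {R : realType}.
Local Notation C := R[i].

Lemma cderive_comp_real (f : R -> C) (k : R -> R) (s dk : R) (df : C) :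
  cderive f (k s) df -> is_derive s 1 k dk -> cderive (fun t => f (k t)) s (df * dk%:C).
Proof.
move=> [fr fi] kd; split; rewrite mulrC ?cRe_rM ?cIm_rM mulrC.
- exact: (is_derive_comp fr kd).
- exact: (is_derive_comp fi kd).
Qed.

Lemma is_derive_inv (s : R) : s != 0 -> is_derive s 1 (fun t : R => t^-1) (- s ^- 2).
Proof.
move=> s0; apply: is_derive_eqr (is_deriveV s0 (is_derive_id s 1)) _.
by rewrite /GRing.scale /= mulr1.
Qed.

(* Without division, so that products need no hypothesis of nonvanishing. *)
Definition log_derive (f : R -> C) (s : R) (L : C) := cderive f s (L * f s).

Lemma log_deriveM (f g : R -> C) (s : R) (L M : C) :
  log_derive f s L -> log_derive g s M -> log_derive (fun t => f t * g t) s (L + M).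
Proof. by move=> fL gM; apply: cderive_eqr (cderiveM fL gM) _; ring. Qed.

Lemma log_derive_prod (I : Type) (r : seq I) (f : I -> R -> C) (s : R) (L : I -> C) :
  (forall i, log_derive (f i) s (L i)) ->
  log_derive (fun t => \prod_(i <- r) f i t) s (\sum_(i <- r) L i).
Proof.
move=> fL; elim: r => [|i r IH].
  rewrite /log_derive !big_nil mul0r; under eq_fun do rewrite big_nil; exact: cderive_cst.
by rewrite big_cons; under eq_fun do rewrite big_cons; exact: log_deriveM.
Qed.

Lemma log_derive_inv_affine (c d : C) (s : R) : s != 0 -> c * s%:C + d != 0 ->
  log_derive (fun t => c + d * (t^-1)%:C) s (- ((s^-1)%:C * (d / (c * s%:C + d)))).
Proof.
move=> s0 cd0; have sC : s%:C != 0 :> C by rewrite Real_eq0.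
apply: cderive_eqr (cderiveD (cderive_cst c s) (cderiveZl d (cderive_real (is_derive_inv s0)))) _.
have -> : (- s ^- 2)%:C = - (s%:C^-1 ^+ 2) :> C by rewrite RealN -exprVn RealX RealV.
by rewrite add0r !RealV; field; rewrite sC cd0.
Qed.

Lemma ccvg_prod (I : Type) (r : seq I) (u : I -> nat -> C) (l : I -> C) :
  (forall i, ccvg (u i) (l i)) -> ccvg (fun k => \prod_(i <- r) u i k) (\prod_(i <- r) l i).
Proof.
move=> ul; elim: r => [|i r IH].
  by under eq_fun do rewrite big_nil; rewrite big_nil; exact: ccvg_cst.
by under eq_fun do rewrite big_cons; rewrite big_cons; exact: ccvgM.
Qed.

End logarithmic_derivative.

(** * Identification of the exponent along a ray *)

Section identification.
Context {R : realType} (N : nat).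
Hypotheses (N_gt2 : (2 < N)%N) (N_even : ~~ odd N).
Local Notation C := R[i].
Local Notation Re := (@complex.Re R).
Local Notation n := (N./2).
Variables (m nu : R).
Hypothesis nu_ge0 : 0 <= nu.
Local Notation a := ('i%C * m%:C - nu%:C : C).
Local Notation b := ('i%C * m%:C : C).
Local Notation E := (laplace_exponent N m nu).

(** The transform 1 / lambda of the constant 1 is spread as 2 over each of the N / 2 roots; then w /
    (w - a) - 1 = a / (w - a) and w / (w + b) - 1 = - b / (w + b). *)
Lemma laplace_psi1E (z : C) : 0 < Re (z ^+ N) -> (forall l : 'I_n, 0 < Re (wroot N z l)) ->
  laplace_psi1 N m nu (z ^+ N) = (N%:R * z ^+ N)^-1 *
    \sum_(l < n) (a / (wroot N z l - a) - b / (wroot N z l + b)).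
Proof.
move=> zN wz.
have [c1 e1] := laplace_psi N_gt2 N_even zN wz m nu_ge0.
have [c2 e2] := cintegral_exp_pos zN.
transitivity (cintegral (@lebesgue_measure R) (fun t =>
    (if 0 < t then cexp (- (z ^+ N * t%:C)) * psi N m nu t else 0) -
    (if 0 < t then cexp (- (z ^+ N * t%:C)) else 0))).
  apply: eq_cintegral => t; case: ltP => _; last by rewrite subr0.
  by rewrite mulrBl mul1r mulrC.
apply: etrans (cintegralB c1 c2) _; rewrite e1 e2.
have N0 : N%:R != 0 :> C by rewrite pnatr_eq0 -lt0n (N_gt0 N_gt2).
have z0 := gt0_neq0 zN.
have -> : (z ^+ N)^-1 = (N%:R * z ^+ N)^-1 * \sum_(l < n) 2.
  rewrite sumr_const card_ord -[2 *+ n]mulr_natr -natrM mul2n.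
  rewrite -[(n.*2)%N]add0n -[0%N]/(false : nat) -(negbTE N_even) odd_double_half.
  by field; rewrite N0 z0.
rewrite -mulrBr -sumrB; congr (_ * _); apply: eq_bigr => l _.
have pn := gt0_neq0 (Re_wroot_sub wz m nu_ge0 l).
have qn := gt0_neq0 (Re_wroot_add wz m l).
by move: (wroot N z l) a b pn qn => c p q pn qn; field; rewrite pn qn.
Qed.

Variable z : C.
Hypothesis zN_gt0 : 0 < Re (z ^+ N).
Hypothesis wroot_gt0 : forall l : 'I_n, 0 < Re (wroot N z l).
Local Notation w := (wroot N z).

(** Each factor w_l s - a or w_l s + b of the denominator at lambda s^N is divided by s, so that it
    tends to w_l as s grows. *)
Let ray (s : R) : C :=
  cexp (E (z ^+ N * (s ^+ N)%:C)) *
  \prod_(l < n) ((w l + - a * (s^-1)%:C) * (w l + b * (s^-1)%:C)).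

Lemma ray_derive (s : R) : 0 < s -> cderive ray s 0.
Proof.
move=> s0; have sn : s != 0 by rewrite gt_eqF.
have sC : s%:C != 0 :> C by rewrite Real_eq0.
have zs : z ^+ N * (s ^+ N)%:C = (z * s%:C) ^+ N by rewrite exprMn RealX.
have wsE l : wroot N (z * s%:C) l = w l * s%:C by exact: wroot_scale.
have zs0 : 0 < Re ((z * s%:C) ^+ N).
  by rewrite -zs mulrC cRe_rM mulr_gt0// exprn_gt0.
have ws0 (l : 'I_n) : 0 < Re (wroot N (z * s%:C) l).
  by rewrite wsE mulrC cRe_rM mulr_gt0.
have N0 : N%:R != 0 :> C by rewrite pnatr_eq0 -lt0n (N_gt0 N_gt2).
have pn (l : 'I_n) : w l * s%:C + - a != 0.
  by rewrite -wsE; exact: gt0_neq0 (Re_wroot_sub ws0 m nu_ge0 l).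
have qn (l : 'I_n) : w l * s%:C + b != 0.
  by rewrite -wsE; exact: gt0_neq0 (Re_wroot_add ws0 m l).
pose D : C := - laplace_psi1 N m nu ((z * s%:C) ^+ N) * z ^+ N * (N%:R * s ^+ N.-1)%:C.
have d1 : cderive (fun t => E (z ^+ N * (t ^+ N)%:C)) s D.
  apply: (@cderive_comp_real _ (fun r => E (z ^+ N * r%:C)) (fun t => t ^+ N)).
    apply: cdiff_cderive; rewrite zs; exact: laplace_exponent_cdiff.
  exact: is_derive_expr.
have d2 : log_derive (fun t => cexp (E (z ^+ N * (t ^+ N)%:C))) s D.
  exact: (cderive_cexp d1).
have d3 (l : 'I_n) := log_deriveM (log_derive_inv_affine sn (pn l)) (log_derive_inv_affine sn (qn l)).
have := log_deriveM d2 (log_derive_prod (index_enum 'I_n) d3).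
move=> h; apply: cderive_eqr h _.
set S := (X in D + X).
suff -> : D + S = 0 by rewrite mul0r.
have DE : D = - ((s^-1)%:C * \sum_(l < n) (a / (w l * s%:C - a) - b / (w l * s%:C + b))).
  rewrite /D laplace_psi1E// -zs.
  under eq_bigr do rewrite wsE; move: (\sum_(l < n) _) => X.
  have -> : (s ^+ N)%:C = s%:C * (s ^+ N.-1)%:C :> C by rewrite -RealM -exprS prednK// (N_gt0 N_gt2).
  rewrite RealM RealV Real_nat.
  have s1 : (s ^+ N.-1)%:C != 0 :> C by rewrite Real_eq0 expf_neq0.
  have z0 := gt0_neq0 zN_gt0.
  move: (z ^+ N) (N%:R : C) ((s ^+ N.-1)%:C) z0 N0 s1 => y k r y0 k0 r0.
  by field; rewrite y0 k0 r0 sC.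
rewrite DE /S mulr_sumr -sumrN -big_split big1// => l _ /=.
by move: (s^-1)%:C (pn l) (qn l) => r p q; field; rewrite p q.
Qed.

Lemma cexp_laplace_exponent :
  cexp (E (z ^+ N)) * \prod_(l < n) ((w l - a) * (w l + b)) = \prod_(l < n) w l ^+ 2.
Proof.
have ray1 : ray 1 = cexp (E (z ^+ N)) * \prod_(l < n) ((w l - a) * (w l + b)).
  rewrite /ray expr1n Real1 mulr1 invr1 Real1.
  by apply: (congr1 (fun y : C => _ * y)); apply: eq_bigr => l _; rewrite !mulr1.
(* A zero derivative on [1, k + 1] forces equal end values, by [cderive_bound] with bound 0. *)
have rayE k : ray k.+1%:R = ray 1.
  have k1 : 1 <= k.+1%:R :> R by rewrite ler1n.
  have := @cderive_bound R ray (fun=> 0) 0 1 k.+1%:R k1.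
  rewrite mulr0 mul0r => h; apply/eqP; rewrite -subr_eq0 -normc_eq0 eq_le normc_ge0 andbT.
  apply: h => [s|s _]; last by rewrite normc0.
  rewrite in_itv /= => /andP[s1 _].
  by apply: ray_derive; exact: lt_le_trans s1.
rewrite -ray1; apply: (@ccvg_unique _ (fun k => ray k.+1%:R)).
  by under eq_fun do rewrite rayE; exact: ccvg_cst.
rewrite -[X in ccvg _ X]mul1r -[X in ccvg _ (X * _)]cexp0; apply: ccvgM.
  apply: ccvg_cexp; apply: laplace_exponent_cvg0 => // k.
  by rewrite ler_eXnr ?ler1n// (N_gt0 N_gt2).
have inv0 : ccvg (fun k => (k.+1%:R^-1)%:C) (0 : C).
  rewrite -Real0; apply: ccvg_real; exact: cvg_harmonic_real.
have lim (c d : C) : ccvg (fun k => c + d * (k.+1%:R^-1)%:C) c.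
  rewrite -[X in ccvg _ X]addr0 -[X in ccvg _ (_ + X)](mulr0 d).
  by apply: ccvgD; [exact: ccvg_cst|apply: ccvgM => //; exact: ccvg_cst].
by apply: (@ccvg_prod _ _ (index_enum 'I_n)
  (fun l k => (w l + - a * (k.+1%:R^-1)%:C) * (w l + b * (k.+1%:R^-1)%:C)))
  => l; rewrite expr2; apply: ccvgM; exact: lim.
Qed.

End identification.

(** * Products over J and K *)

Section theta_products.
Context {R : realType} (N : nat).
Hypotheses (N_gt2 : (2 < N)%N) (N_even : ~~ odd N).
Local Notation C := R[i].
Local Notation Re := (@complex.Re R).
Local Notation n := (N./2).

Let Nn : (n + n = N)%N.
Proof. by rewrite addnn -[RHS]odd_double_half (negbTE N_even). Qed.

Lemma Re_theta_lt0 l : (l < n)%N -> Re (theta N l) < 0.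
Proof. by move=> ln; rewrite Re_theta// oppr_lt0; exact: sin_angle_gt0. Qed.

Lemma Re_theta_gt0 (l : 'I_N) : (n <= l)%N -> 0 < Re (theta N l).
Proof.
move=> nl; rewrite -(subnK nl) thetaD// cReN oppr_gt0; apply: Re_theta_lt0.
by rewrite ltn_subLR// Nn.
Qed.

Lemma mem_idxK (l : 'I_N) : (l \in idxK R N) = (l < n)%N.
Proof.
rewrite inE; have [ln|nl] := ltnP l n; first by rewrite Re_theta_lt0.
by apply/negbTE; rewrite -leNgt ltW// Re_theta_gt0.
Qed.

Lemma mem_idxJ (l : 'I_N) : (l \in idxJ R N) = (n <= l)%N.
Proof.
rewrite inE; have [ln|nl] := ltnP l n; last by rewrite Re_theta_gt0.
by apply/negbTE; rewrite -leNgt ltW// Re_theta_lt0.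
Qed.

Lemma prod_idxK (F : C -> C) :
  \prod_(k in idxK R N) F (theta N k) = \prod_(l < n) F (theta N l).
Proof.
rewrite (@big_ord_widen _ _ _ n N (fun l => F (theta N l))); last by rewrite -{2}Nn leq_addr.
by apply: eq_bigl => l; rewrite mem_idxK.
Qed.

(** J consists of the upper half of the indices, and theta_(l + N/2) = - theta_l carries the product
    over to the lower half. *)
Lemma prod_idxJ (F : C -> C) :
  \prod_(j in idxJ R N) F (theta N j) = \prod_(l < n) F (- theta N l).
Proof.
transitivity (\prod_(0 <= j < N | true && (n <= j)%N) F (theta N j)).
  by rewrite big_mkord; apply: eq_bigl => l; rewrite mem_idxJ.
rewrite -(@big_nat_widenl _ _ _ n 0 N xpredT (fun j => F (theta N j)))// -{1}[n]add0n big_addn.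
have -> : (N - n = n)%N by rewrite -{1}Nn addnK.
by rewrite big_mkord; apply: eq_bigr => l _; rewrite thetaD.
Qed.

(** Factor by factor: with t = theta_l and w = - z / t, (w - a) (w + b) = (z + a t) (z - b t) / t^2
    and w^2 = z^2 / t^2. *)
Lemma prod_theta_wroot (z a b : C) : z != 0 ->
  \prod_(j in idxJ R N) (z - a * theta N j) * \prod_(k in idxK R N) (z - b * theta N k) *
    \prod_(l < n) wroot N z l ^+ 2 =
  z ^+ N * \prod_(l < n) ((wroot N z l - a) * (wroot N z l + b)).
Proof.
move=> z0; rewrite (prod_idxJ (fun t => z - a * t)) (prod_idxK (fun t => z - b * t)).
rewrite -!big_split /=.
have -> : z ^+ N = \prod_(l < n) z ^+ 2.
  by rewrite prodr_const card_ord -exprM mul2n -addnn Nn.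
rewrite -big_split /=; apply: eq_bigr => l _.
have t0 := theta_neq0 (R := R) N_gt2 N_even l.
by rewrite /wroot; move: (theta N l) t0 => t t0; field; rewrite t0.
Qed.

End theta_products.

Section laplace_exponent_value.
Context {R : realType} (N : nat).
Hypotheses (N_gt2 : (2 < N)%N) (N_even : ~~ odd N).
Local Notation C := R[i].
Local Notation Re := (@complex.Re R).
Local Notation n := (N./2).

Lemma cexp_laplace_exponent_croot (m nu : R) (lambda : C) : 0 <= nu -> 0 < Re lambda ->
  lambda^-1 * cexp (laplace_exponent N m nu lambda) =
  (\prod_(j in idxJ R N) (croot N lambda - ('i%C * m%:C - nu%:C) * theta N j) *
   \prod_(k in idxK R N) (croot N lambda - 'i%C * m%:C * theta N k))^-1.
Proof.
move=> nu0 l0; have ln := gt0_neq0 l0.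
have zN := crootX N_gt2 ln; set z := croot N lambda in zN *.
have wz (l : 'I_n) : 0 < Re (wroot N z l) by apply: wroot_croot_gt0.
have zN0 : 0 < Re (z ^+ N) by rewrite zN.
have z0 : z != 0.
  by apply: contraNneq ln => z0; rewrite -zN z0 expr0n eqn0Ngt (N_gt0 N_gt2).
have E := cexp_laplace_exponent N_gt2 N_even m nu0 zN0 wz.
have P := prod_theta_wroot N_gt2 N_even ('i%C * m%:C - nu%:C) ('i%C * m%:C) z0.
have W0 : \prod_(l < n) wroot N z l ^+ 2 != 0.
  by apply/prodf_neq0 => l _; rewrite expf_neq0// gt0_neq0.
move: E P; rewrite zN; set Q := \prod_(l < n) ((_ - _) * _).
set W := \prod_(l < n) _ ^+ 2 in W0 *; set D := _ * \prod_(k in _) _ => E P.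
have Q0 : Q != 0 by apply: contraNneq W0 => q0; rewrite -E q0 mulr0.
have D0 : D != 0.
  by apply: contraNneq (mulf_neq0 ln Q0) => d0; rewrite -P d0 mul0r.
apply: (mulIf D0); rewrite mulVf//; apply: (mulIf W0).
by rewrite mul1r -(mulrA _ D W) P mulrACA mulVf// mul1r E.
Qed.

End laplace_exponent_value.

(** * The expectations *)

Section step_process_expectation.
Context {R : realType} (N : nat).
Hypotheses (N_gt2 : (2 < N)%N) (N_even : ~~ odd N).
Local Notation C := R[i].
Local Notation Re := (@complex.Re R).

(** The exponential formula for the constant sequences 1, whose series is geometric; it presents 1 -
    w as an exponential without a logarithm. *)
Lemma geometric_exponential (w : C) : 8 * normc w <= 1 ->
  ccvg (series (fun j => w ^+ j.+1 / j.+1%:R)) (cser (fun j => w ^+ j.+1 / j.+1%:R)) /\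
  (1 - w) * cexp (cser (fun j => w ^+ j.+1 / j.+1%:R)) = 1.
Proof.
move=> w8; have w0 := normc_ge0 w.
have w1 : normc w <= 8^-1 by rewrite -ler_pdivlMl// mulr1 in w8.
have r01 : 0 <= normc w < 1 by rewrite w0 (le_lt_trans w1)// invf_lt1// ltr1n.
split.
  apply: (@ccvg_series _ _ (fun j => 1 * normc w ^+ j)); last exact: cvg_series_geometric.
  move=> j; rewrite normcM normcV -Real_nat normc_real_ge0// normcX mul1r ler_pdivrMr//.
  rewrite exprS mulrC; apply: ler_wpM2l; first exact: exprn_ge0.
  by rewrite (le_trans (ltW (andP r01).2))// ler1n.
have e : ccvg (series (fun k => 1 * w ^+ k)) (cexp (cser (fun j => 1 * w ^+ j.+1 / j.+1%:R))).
  apply: (@exponential_formula R (fun=> 1) (fun=> 1) 1) => //.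
  - by move=> j; rewrite normc1.
  - by move=> k; rewrite sumr_const card_ord mulr1 mulr1.
  - by rewrite mul1r.
have e' := ccvgM (ccvg_cst (1 - w)) e.
have -> : (fun j => w ^+ j.+1 / j.+1%:R) = (fun j => 1 * w ^+ j.+1 / j.+1%:R).
  by apply/funext => j; rewrite mul1r.
apply: (ccvg_unique e').
have -> : (fun n => (1 - w) * series (fun k => 1 * w ^+ k) n) = (fun n => 1 - w ^+ n).
  apply/funext => n; have := subrX1 w n; rewrite /series /= big_mkord => h.
  rewrite -[RHS]opprB h -mulNr opprB; congr (_ * _).
  by apply: eq_bigr => i _; rewrite mul1r.
apply: (@ccvg_bound _ _ _ (fun n => normc w ^+ n)).
  by move=> n; rewrite addrAC subrr add0r normcN normcX.
by apply: cvg_expr; rewrite ger0_norm//; case/andP: r01.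
Qed.

Variables (m nu x s : R) (phi : R -> R -> R -> C).
Hypothesis nu_ge0 : 0 <= nu.
Hypothesis s1 : s = 1 \/ s = -1.
Hypothesis phiE : forall w : seq R,
  phi (last x w) (\big[Num.max/x]_(y <- w) y) (\big[Num.min/x]_(y <- w) y) =
  cexp ('i%C * (m * last x w)%:C - (nu * \big[Num.max/s * x]_(y <- w) (s * y))%:C).

Let K : C := cexp (('i%C * m%:C - (s * nu)%:C) * x%:C).

Definition exponent_sum (n : nat) (z : C) : C :=
  dirichlet (psi_coef N (s * m) nu (dyadic n)) (dyadic n) z.

Lemma step_series (n : nat) : exists L : R, forall z : C, L < Re z ->
  cvgn (series (fun k => normc (step_term N x phi n z k))) /\
  ccvg (series (step_term N x phi n z)) (K * z^-1 * cexp (exponent_sum n z)).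
Proof.
pose h : R := dyadic n; have h0 : 0 < h := dyadic_gt0 n.
(* Large enough to be at least 1 and to bound psi on the grid. *)
pose A : R := decay_const N + 2.
have A1 : 1 <= A by rewrite /A; have := decay_const_ge0 (R := R) N; lra.
have A0 : 0 < A by exact: lt_le_trans A1.
pose c := max_mean N (s * m) nu h.
pose f j := psi N (s * m) nu (j.+1%:R * h).
have fA j : normc (f j) <= A.
  have t0 : 0 < j.+1%:R * h by rewrite mulr_gt0.
  rewrite (le_trans (psi_bound N_gt2 N_even (s * m) nu_ge0 t0))// lerDl//.
have cr := max_mean_rec N_gt2 N_even (s * m) nu_ge0 h0.
(* Beyond this abscissa w = exp (- z h) satisfies A |w| <= 1/8, the range of
   [exponential_formula]. *)
exists (Num.max 0 (ln (8 * A) / h)) => z; rewrite gt_max => /andP[z0 zL].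
have zn : z != 0 by exact: gt0_neq0.
pose w : C := cexp (- (z * h%:C)).
have wn : normc w = expR (- (Re z * h)) by exact: normc_cexp_ray.
have Aw : A * normc w <= 8^-1.
  have : ln (8 * A) < Re z * h by rewrite -ltr_pdivrMr.
  rewrite -ltr_expR lnK ?posrE ?mulr_gt0// wn expRN => /ltW hh.
  by rewrite ler_pdivrMr ?expR_gt0// mulrC ler_pdivlMr// mulrC.
have w8 : 8 * normc w <= 1.
  rewrite -ler_pdivlMl// mulr1 (le_trans _ Aw)// ler_peMl ?normc_ge0//.
have termE k : step_term N x phi n z k = K * z^-1 * (1 - w) * (c k * w ^+ k).
  rewrite /step_term (Estep_extremum N_gt2 N_even nu_ge0 n k s1 phiE) -/K -/h -/c.
  have hE : h%:C = (2 ^+ n)^-1 :> C by rewrite /h /dyadic RealV RealX Real_nat.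
  have -> : cexp (- z / 2 ^+ n) = w by rewrite /w hE mulNr.
  have -> : cexp (- z * (k%:R / 2 ^+ n)) = w ^+ k.
    by rewrite /w -cexpMn hE; congr cexp; ring.
  by ring.
have cA := coef_bound A1 fA (max_mean0 N (s * m) nu h) cr.
have Awr : 0 <= A * normc w < 1.
  by rewrite mulr_ge0 ?normc_ge0 ?(ltW A0)// (le_lt_trans Aw)// invf_lt1// ltr1n.
split.
  apply: (@series_le_cvg R _ (fun k => normc (K * z^-1 * (1 - w)) * (A * normc w) ^+ k)).
  - by move=> k; exact: normc_ge0.
  - by move=> k; rewrite mulr_ge0 ?normc_ge0// exprn_ge0//; case/andP: Awr.
  - move=> k; rewrite termE normcM ler_wpM2l ?normc_ge0// normcM normcX exprMn.
    by rewrite ler_wpM2r ?exprn_ge0 ?normc_ge0.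
  - exact: cvg_series_geometric.
have [c2 e2] := geometric_exponential w8.
set S2 := cser _ in c2 e2.
have c1 := dirichlet_cvg h0 (fun k => psi_coef_bound N_gt2 N_even (s * m) nu_ge0 k h0) z0.
have c3 := cserD c1 c2.
(* Splitting psi as (psi - 1) + 1 separates the Dirichlet series from the series of w^j / j, whose
   exponential the prefactor 1 - w cancels below. *)
have S1 : cser (fun j => f j * w ^+ j.+1 / j.+1%:R) = exponent_sum n z + S2.
  apply: cser_unique.
  have -> : (fun j => f j * w ^+ j.+1 / j.+1%:R) =
      (fun k => dirichlet_term (psi_coef N (s * m) nu h) h z k + w ^+ k.+1 / k.+1%:R).
    apply/funext => k; rewrite /dirichlet_term /psi_coef -/(f k).
    have -> : cexp (- (z * (k.+1%:R * h)%:C)) = w ^+ k.+1.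
      by rewrite /w -cexpMn; congr cexp; rewrite RealM Real_nat; ring.
    by rewrite RealV Real_nat; ring.
  exact: c3.
have e1 := exponential_formula A1 fA (max_mean0 N (s * m) nu h) cr Aw.
have := cserZ (K * z^-1 * (1 - w)) e1; rewrite S1 cexpD.
have -> : K * z^-1 * (1 - w) * (cexp (exponent_sum n z) * cexp S2) = K * z^-1 * cexp (exponent_sum n z).
  transitivity (K * z^-1 * cexp (exponent_sum n z) * ((1 - w) * cexp S2)); last by rewrite e2 mulr1.
  by move: (cexp S2) (cexp _) => p q; ring.
have -> // : (fun k => K * z^-1 * (1 - w) * (c k * w ^+ k)) = step_term N x phi n z.
by apply/funext => k; rewrite termE.
Qed.

Lemma dyadic_cvg0 : (@dyadic R) @ \oo --> 0.
Proof.
have -> : @dyadic R = fun n => 2^-1 ^+ n by apply/funext => n; rewrite /dyadic exprVn.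
by apply: cvg_expr; rewrite ger0_norm// invf_lt1// ltr1n.
Qed.

Lemma expectation_extremum (lambda : C) : 0 < Re lambda ->
  expectation_laplace N x phi lambda
    (K * (lambda^-1 * cexp (laplace_exponent N (s * m) nu lambda))).
Proof.
(* The closed form of the sum, whose exponent converges for all Re z > 0, serves as the
   continuation. *)
move=> l0; exists (fun n z => K * z^-1 * cexp (exponent_sum n z)); split.
- move=> n z z0.
  have [d /cdiff_cexp dd] := dirichlet_cdiff (dyadic_gt0 n)
    (fun k => psi_coef_bound N_gt2 N_even (s * m) nu_ge0 k (dyadic_gt0 n)) z0.
  have d1 := @cdiff_derivable R (fun z => cexp (exponent_sum n z)) z _ dd.
  have zn : z != 0 by exact: gt0_neq0.
  have d2 := @derivableV C C^o (fun y => y) z 1 zn (@derivable_id C C^o z 1).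
  have d3 := @derivableM C C^o _ _ z 1 (@derivable_cst C C^o C^o K z 1) d2.
  exact: (@derivableM C C^o _ _ z 1 d3 d1).
- move=> n; have [L hL] := step_series n; exists L => z /hL[h1 h2]; split=> //.
  exact: ccvg_cvg.
- apply: ccvg_cvg; rewrite mulrA; apply: ccvgM; first exact: ccvg_cst.
  apply: ccvg_cexp; apply: (dirichlet_psi_cvg N_gt2 N_even (s * m) nu_ge0 l0).
    exact: dyadic_gt0.
  exact: dyadic_cvg0.
Qed.

End step_process_expectation.

Theorem theorem4p1 (R : realType) (N : nat) (x : R) (lambda : R[i]) (mu nu : R) :
  (2 < N)%N -> ~~ odd N -> 0 < complex.Re lambda -> 0 < nu ->
  expectation_laplace N x
    (fun X M _ => cexp ('i%C * (mu * X)%:C - (nu * M)%:C)) lambda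
    (cexp (('i%C * mu%:C - nu%:C) * x%:C) /
      (\prod_(j in idxJ R N)
         (croot N lambda - ('i%C * mu%:C - nu%:C) * theta N j) *
       \prod_(k in idxK R N)
         (croot N lambda - 'i%C * mu%:C * theta N k)))
  /\
  expectation_laplace N x
    (fun X _ m => cexp ('i%C * (mu * X)%:C + (nu * m)%:C)) lambda
    (cexp (('i%C * mu%:C + nu%:C) * x%:C) /
      (\prod_(j in idxJ R N)
         (croot N lambda - 'i%C * mu%:C * theta N j) *
       \prod_(k in idxK R N)
         (croot N lambda - ('i%C * mu%:C + nu%:C) * theta N k))).
Proof.
move=> N_gt2 N_even l0 /ltW nu0; split.
  have phiE (w : seq R) : cexp ('i%C * (mu * last x w)%:C - (nu * \big[Num.max/x]_(y <- w) y)%:C) =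
      cexp ('i%C * (mu * last x w)%:C - (nu * \big[Num.max/1 * x]_(y <- w) (1 * y))%:C) :> R[i].
    by rewrite mul1r; under [in RHS]eq_bigr do rewrite mul1r.
  have := @expectation_extremum R N N_gt2 N_even mu nu x 1
    (fun X M _ => cexp ('i%C * (mu * X)%:C - (nu * M)%:C)) nu0 (or_introl erefl) phiE lambda l0.
  by rewrite !mul1r (cexp_laplace_exponent_croot N_gt2 N_even mu nu0 l0).
have nuN : nu%:C = - (-1 * nu)%:C :> R[i] by rewrite mulN1r RealN opprK.
have -> : cexp (('i%C * mu%:C + nu%:C) * x%:C) = cexp (('i%C * mu%:C - (-1 * nu)%:C) * x%:C).
  by rewrite -nuN.
have -> : \prod_(j in idxJ R N) (croot N lambda - 'i%C * mu%:C * theta N j) *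
    \prod_(k in idxK R N) (croot N lambda - ('i%C * mu%:C + nu%:C) * theta N k) =
  \prod_(j in idxJ R N) (croot N lambda - ('i%C * (-1 * mu)%:C - nu%:C) * theta N j) *
    \prod_(k in idxK R N) (croot N lambda - 'i%C * (-1 * mu)%:C * theta N k).
  (* Reflection changes the sign of mu. Since the roots in J are the negatives of those in K, this
     exchanges the two products. *)
  rewrite (prod_idxJ N_gt2 N_even (fun t => croot N lambda - 'i%C * mu%:C * t)).
  rewrite (prod_idxK N_gt2 N_even (fun t => croot N lambda - ('i%C * mu%:C + nu%:C) * t)).
  rewrite (prod_idxJ N_gt2 N_even (fun t => croot N lambda - ('i%C * (-1 * mu)%:C - nu%:C) * t)).
  rewrite (prod_idxK N_gt2 N_even (fun t => croot N lambda - 'i%C * (-1 * mu)%:C * t)).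
  rewrite mulrC mulN1r RealN.
  by congr (_ * _); apply: eq_bigr => l _; move: (croot _ _) (theta _ _) => z t; ring.
have phiE (w : seq R) : cexp ('i%C * (mu * last x w)%:C + (nu * \big[Num.min/x]_(y <- w) y)%:C) =
    cexp ('i%C * (mu * last x w)%:C - (nu * \big[Num.max/-1 * x]_(y <- w) (-1 * y))%:C) :> R[i].
  by rewrite bigmin_max mulrN RealN.
have := @expectation_extremum R N N_gt2 N_even mu nu x (-1)
  (fun X _ m => cexp ('i%C * (mu * X)%:C + (nu * m)%:C)) nu0 (or_intror erefl) phiE lambda l0.
by rewrite (cexp_laplace_exponent_croot N_gt2 N_even (-1 * mu) nu0 l0).
Qed.
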